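(* Let $f_0$ be a Borel probability measure on $\mathbb{R}^2$ with $\mathrm{Supp}(f_0)\subset[-R_x,R_x]\times[-R_v,R_v]$ and with atomless spatial marginal, i.e. $f_0(\{x\}\times\mathbb{R})=0$ for every $x\in\mathbb{R}$. Let $A=[-R_v,R_v+1]$, $\mu$, $h$, $\boldsymbol{\nu}_0=(\nu_0^a)_{a\in A}$ and the energy $J$ be as in the context. Then for any $T>0$ there exists a gradient flow of $J$ starting from $\boldsymbol{\nu}_0$ on the time interval $[0,T]$. In particular, there exists a measure solution on $[0,T]\times\mathbb{R}$ to the system $$\partial_t\nu_t^a+\partial_x(\nu_t^a v_t^a)=0,\quad \nu^a|_{t=0}=\nu_0^a,\qquad v_t^a(x)\in[a-G_t(x),\,a-G_t^-(x)],$$ $$\rho_t:=\int_{\mathbb{R}}\nu_t^a\,d\mu(a),\quad G_t(x)=\rho_t((-\infty,x]),\quad G_t^-(x)=\rho_t((-\infty,x)).$$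
   Context: Setting. $R_x,R_v>0$. $f_0$ is a Borel probability measure on $\mathbb{R}^2$ supported in $[-R_x,R_x]\times[-R_v,R_v]$ with atomless first (spatial) marginal $\rho_0$; $G_0(x):=\rho_0((-\infty,x])$. $\eta_0$ is the push-forward of $f_0$ by $(x,v)\mapsto(x,v+G_0(x))$. $\mu$ is a fixed $\sigma$-finite Borel measure on $\mathbb{R}$ such that the second marginal of $\eta_0$ is absolutely continuous with respect to $\mu$, with density $h$; thus $h\ge0$, $\int h\,d\mu=1$ and $h=0$ outside $A:=[-R_v,R_v+1]$. Disintegrate $\eta_0=\nu_0^a\otimes\mu$: $\int\phi\,d\eta_0=\int_{\mathbb{R}}\left(\int_{\mathbb{R}}\phi(x,a)\,d\nu_0^a(x)\right)d\mu(a)$, so $\nu_0^a$ is a nonnegative measure of mass $h(a)$ supported in $[-R_x,R_x]$. Set $\boldsymbol{\nu}_0=(\nu_0^a)_{a\in A}$. Spaces. $X$ is the set of $\mu$-measurable families $\boldsymbol{\nu}=(\nu^a)_{a\in A}$ of nonnegative Borel measures on $\mathbb{R}$ with $\nu^a(\mathbb{R})=h(a)$ for $\mu$-a.e. $a$ and $\int_A\int x^2\,d\nu^a\,d\mu(a)<\infty$. For $R>0$, $X_R$ is the set of $\boldsymbol{\nu}\in X$ with $\mathrm{Supp}(\nu^a)\subset[-R,R]$ for $\mu$-a.e. $a$. $\boldsymbol{\nu}\otimes\mu$ denotes the measure $\int\phi\,d(\boldsymbol{\nu}\otimes\mu)=\int_A\int\phi(a,x)\,d\nu^a(x)\,d\mu(a)$.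 For measures of equal mass, $\Pi(\nu,\theta)$ is the set of nonnegative measures on the product with marginals $\nu,\theta$, and $W_2^2(\nu,\theta)=\inf_{\gamma\in\Pi(\nu,\theta)}\int|x-y|^2d\gamma$. $d^2(\boldsymbol{\nu},\boldsymbol{\theta}):=\int_AW_2^2(\nu^a,\theta^a)\,d\mu(a)$. $\boldsymbol{\gamma}\in\Pi(\boldsymbol{\nu},\boldsymbol{\theta})$ means $\boldsymbol{\gamma}=(\gamma^a)_{a\in A}$ is a $\mu$-measurable family with $\gamma^a\in\Pi(\nu^a,\theta^a)$. Energy. With $\overline{\boldsymbol{\nu}}:=\int_A\nu^a\,d\mu(a)$, $$J(\boldsymbol{\nu})=\frac14\int_{\mathbb{R}\times\mathbb{R}}|x-y|\,d\overline{\boldsymbol{\nu}}(x)\,d\overline{\boldsymbol{\nu}}(y)+\int_A\int_{\mathbb{R}}\left(\tfrac12-a\right)x\,d\nu^a(x)\,d\mu(a).$$ Subdifferential. For $\boldsymbol{\nu}\in X_R$, $\partial J(\boldsymbol{\nu})$ is the set of $\boldsymbol{w}=(w^a)_{a\in A}\in L^1(\boldsymbol{\nu}\otimes\mu)$ such that for all $R'>0$, $\boldsymbol{\theta}\in X_{R'}$ and $\boldsymbol{\gamma}\in\Pi(\boldsymbol{\nu},\boldsymbol{\theta})$: $J(\boldsymbol{\theta})-J(\boldsymbol{\nu})\ge\int_A\int w^a(y)(z-y)\,d\gamma^a(y,z)\,d\mu(a)$. Gradient flow. A gradient flow of $J$ on $[0,T]$ starting from $\boldsymbol{\nu}_0$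 is a curve $t\in[0,T]\mapsto\boldsymbol{\nu}(t)=(\nu(t)^a)_{a\in A}\in X_R$ (for some $R>0$), Lipschitz for $d$, with $\boldsymbol{\nu}(0)=\boldsymbol{\nu}_0$, together with a measurable map $t\mapsto\boldsymbol{v}(t)=(v(t)^a)_{a\in A}\in L^1(\boldsymbol{\nu}(t)\otimes\mu)$, such that $\boldsymbol{v}(t)\in-\partial J(\boldsymbol{\nu}(t))$ for a.e. $t$, and for $\mu$-a.e. $a$, $t\mapsto\nu(t)^a$ solves $\partial_t\nu^a+\partial_x(\nu^av^a)=0$, $\nu^a|_{t=0}=\nu_0^a$, in the sense of distributions, i.e. $\int_0^T\int(\partial_t\phi+v(t)^a\partial_x\phi)\,d\nu(t)^a\,dt=\int\phi(T,\cdot)\,d\nu(T)^a-\int\phi(0,\cdot)\,d\nu_0^a$ for all $\phi\in C_c^1([0,T]\times\mathbb{R})$. Measure solution. A measure solution of the system on $[0,T]\times\mathbb{R}$ is a family $(t,a)\in[0,T]\times A\mapsto\nu_t^a$, where $\nu_t^a$ is $h(a)$ times a probability measure on $\mathbb{R}$ with finite second moment, such that (1) for every bounded Borel $\phi$ on $[0,T]\times\mathbb{R}\times\mathbb{R}$, $(t,a)\mapsto\int\phi(t,a,x)\,d\nu_t^a(x)$ is $dt\otimes\mu$-measurable; (2) for $h\mu$-a.e. $a$ the continuity equation with initial datum $\nu_0^a$ holds in the sense of distributions, with a $\nu_t^a\otimes\mu\otimes dt$-measurable velocity $v_t^a$ satisfying $v_t^a(x)\in[a-G_t(x),a-G_t^-(x)]$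 for $\nu_t^a\otimes\mu\otimes dt$-a.e. $(x,a,t)$. *)

(* Defs.v *)
From mathcomp Require Import all_boot all_order all_algebra.
From mathcomp Require Import all_classical all_reals all_analysis.
From mathcomp Require Import measurable_realfun.

Set Implicit Arguments.
Unset Strict Implicit.
Unset Printing Implicit Defensive.

Import Order.TTheory GRing.Theory Num.Theory.
Import numFieldNormedType.Exports.

Local Open Scope classical_set_scope.
Local Open Scope ring_scope.
Local Open Scope ereal_scope.

Section generic.
Context d d' (T : measurableType d) (U : measurableType d') (R : realType).

(* Measurability with respect to the completion of m: f has a measurable
   version on D. The library integral is a supremum over measurable simple
   functions, so its value for f is that of the version. *)
Definition almost_measurable (m : set T -> \bar R) (D : set T) (f : T -> U) :=
  exists2 g : T -> U, measurable_fun D g &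
    {ae m, forall x, D x -> f x = g x}.

End generic.

Definition supp (R : realType) (T : topologicalType) (m : set T -> \bar R) :
    set T :=
  [set x | forall V, open V -> V x -> 0 < m V].

Section initial_data.
Context (R : realType) (f0 : probability (R * R)%type R).

Definition rho0 : set R -> \bar R := pushforward f0 fst.

Definition G0 (x : R) : R := fine (rho0 `]-oo, x]).

Definition eta0 : set (R * R) -> \bar R :=
  pushforward f0 (fun p : R * R => (p.1, p.2 + G0 p.1)%R).

End initial_data.

Section transport.
Context (R : realType).

Definition couplings (nu theta : set R -> \bar R) :
    set {measure set (R * R) -> \bar R} :=
  [set gamma : {measure set (R * R) -> \bar R} |
    forall B : set R, measurable B ->
      pushforward gamma fst B = nu B /\ pushforward gamma snd B = theta B].

Definition W2sq (nu theta : set R -> \bar R) : \bar R :=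
  ereal_inf [set \int[gamma]_p ((`|p.1 - p.2| ^+ 2)%R)%:E
            | gamma in couplings nu theta].

(* Points of space-time are pairs (t, x). *)
Definition dt (phi : R * R -> R) (p : R * R) : R :=
  derive1 (fun s : R => phi (s, p.2)) p.1.
Definition dx (phi : R * R -> R) (p : R * R) : R :=
  derive1 (fun y : R => phi (p.1, y)) p.2.

(* C^1_c([0,T] x R) consists of the restrictions to [0,T] x R of these. *)
Definition C1c (phi : R * R -> R) : Prop :=
  [/\ forall p : R * R, derivable (fun s : R => phi (s, p.2)) p.1 1 /\
                        derivable (fun y : R => phi (p.1, y)) p.2 1,
      continuous (dt phi), continuous (dx phi) &
      compact (closure [set p | phi p != 0%R])].

(* Weak form on [0,T] of  d_t n + d_x (n u) = 0,  n(0) = n0, including the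
   requirement that the integrand be integrable. *)
Definition continuity_equation (T : R) (n : R -> {measure set R -> \bar R})
    (u : R -> R -> R) (n0 : set R -> \bar R) : Prop :=
  forall phi, C1c phi ->
    let F t x := (dt phi (t, x) + u t x * dx phi (t, x))%R in
    \int[lebesgue_measure]_(t in `[0%R, T]) \int[n t]_x `|(F t x)%:E| < +oo /\
    \int[lebesgue_measure]_(t in `[0%R, T]) \int[n t]_x (F t x)%:E =
      \int[n T]_x (phi (T, x))%:E - \int[n0]_x (phi (0%R, x))%:E.

End transport.

Section families.
Context (R : realType) (mu : {sigma_finite_measure set R -> \bar R}).

Definition measurable_family d (U : measurableType d) (D : set R)
    (nu : R -> {measure set U -> \bar R}) : Prop :=
  forall B, measurable B -> almost_measurable mu D (fun a => nu a B).

(* eta = nu (x) mu, for eta a measure on pairs (x, a). *)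
Definition disintegration (eta : set (R * R) -> \bar R)
    (nu : R -> {measure set R -> \bar R}) : Prop :=
  measurable_family setT nu /\
  forall phi : R * R -> \bar R, measurable_fun setT phi ->
    (forall p, 0 <= phi p) ->
    \int[eta]_p phi p = \int[mu]_a \int[nu a]_x phi (x, a).

(* Families are indexed by R, but only the members nu a with a in A matter;
   integrals of families over R are integrals over A. *)
Variables (A : set R) (h : R -> R).

Definition X (nu : R -> {measure set R -> \bar R}) : Prop :=
  [/\ measurable_family A nu,
      {ae mu, forall a, A a -> nu a setT = (h a)%:E} &
      \int[mu]_(a in A) \int[nu a]_x ((x ^+ 2)%R)%:E < +oo].

Definition X_ (r : R) (nu : R -> {measure set R -> \bar R}) : Prop :=
  X nu /\ {ae mu, forall a, A a -> supp (nu a) `<=` `[(- r)%R, r]}.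

(* The measure nu (x) mu, on pairs (a, x). *)
Definition otimes (nu : R -> {measure set R -> \bar R}) (B : set (R * R)) :
    \bar R :=
  \int[mu]_(a in A) nu a (xsection B a).

Definition L1 (nu : R -> {measure set R -> \bar R}) (w : R -> R -> R) : Prop :=
  almost_measurable (otimes nu) (A `*` setT) (fun p => w p.1 p.2) /\
  \int[mu]_(a in A) \int[nu a]_x `|(w a x)%:E| < +oo.

Definition d2 (nu theta : R -> {measure set R -> \bar R}) : \bar R :=
  \int[mu]_(a in A) W2sq (nu a) (theta a).

Definition dist (nu theta : R -> {measure set R -> \bar R}) : \bar R :=
  sqrte (d2 nu theta).

Definition family_couplings (nu theta : R -> {measure set R -> \bar R})
    (gamma : R -> {measure set (R * R) -> \bar R}) : Prop :=
  measurable_family A gamma /\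
  {ae mu, forall a, A a -> couplings (nu a) (theta a) (gamma a)}.

Definition mixture (nu : R -> {measure set R -> \bar R}) (B : set R) : \bar R :=
  \int[mu]_(a in A) nu a B.

Definition J (nu : R -> {measure set R -> \bar R}) : \bar R :=
  (4^-1)%:E * \int[mixture nu]_x \int[mixture nu]_y (`|x - y|%R)%:E +
  \int[mu]_(a in A) \int[nu a]_x ((2^-1 - a) * x)%:E.

Definition subdiff (nu : R -> {measure set R -> \bar R}) (w : R -> R -> R) :
    Prop :=
  L1 nu w /\
  forall (r : R) theta gamma, (0 < r)%R -> X_ r theta ->
    family_couplings nu theta gamma ->
    J theta - J nu >=
      \int[mu]_(a in A) \int[gamma a]_p (w a p.1 * (p.2 - p.1))%:E.

(* Curves are written nu t a; velocities v t a x. The type of times is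
   measurableTypeR R because this is the space on which the library puts
   lebesgue_measure; it unfolds to R, with the Borel sigma-algebra. *)
Let time := measurableTypeR R.

Definition measurable_curve (T : R) (nu : R -> R -> {measure set R -> \bar R}) :
    Prop :=
  forall phi : time * R * R -> R,
    measurable_fun (`[0%R, T] `*` setT `*` setT) phi ->
    (exists M : R, forall q, (`[0%R, T] `*` setT `*` setT) q ->
      (`|phi q| <= M)%R) ->
    almost_measurable (lebesgue_measure \x mu) (`[0%R, T] `*` A)
      (fun p : time * R => \int[nu p.1 p.2]_x (phi (p, x))%:E).

(* The measure nu_t^a (x) mu (x) dt on [0,T] x A x R, on triples (t, a, x). *)
Definition space_time (T : R) (nu : R -> R -> {measure set R -> \bar R})
    (B : set (time * R * R)) : \bar R :=
  \int[lebesgue_measure \x mu]_(p in `[0%R, T] `*` A)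
    nu p.1 p.2 (xsection B p).

Definition measurable_velocity (T : R)
    (nu : R -> R -> {measure set R -> \bar R}) (v : R -> R -> R -> R) : Prop :=
  almost_measurable (space_time T nu) (`[0%R, T] `*` A `*` setT)
    (fun q : time * R * R => v q.1.1 q.1.2 q.2).

Record gradient_flow (T : R) (nu0 : R -> {measure set R -> \bar R})
    (nu : R -> R -> {measure set R -> \bar R}) (v : R -> R -> R -> R) : Prop := {
  gf_X : exists2 r : R, (0 < r)%R &
    forall t, t \in `[0%R, T] -> X_ r (nu t);
  gf_lipschitz : exists L : R, forall s t, s \in `[0%R, T] -> t \in `[0%R, T] ->
    dist (nu s) (nu t) <= (L * `|s - t|)%:E;
  gf_init : forall a, A a -> forall B, measurable B -> nu 0%R a B = nu0 a B;
  gf_measurable_curve : measurable_curve T nu;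
  gf_measurable_velocity : measurable_velocity T nu v;
  gf_L1 : forall t, t \in `[0%R, T] -> L1 (nu t) (v t);
  gf_subdiff : {ae lebesgue_measure, forall t : time, t \in `[0%R, T] ->
    subdiff (nu t) (fun a x => - v t a x)%R};
  gf_continuity_equation : {ae mu, forall a, A a ->
    continuity_equation T (fun t => nu t a) (fun t => v t a) (nu0 a)}
}.

Definition G (n : R -> {measure set R -> \bar R}) (x : R) : \bar R :=
  mixture n `]-oo, x].
Definition Gminus (n : R -> {measure set R -> \bar R}) (x : R) : \bar R :=
  mixture n `]-oo, x[.

(* The measure h mu. *)
Definition hmu (B : set R) : \bar R := \int[mu]_(a in B) (h a)%:E.

Record measure_solution (T : R) (nu0 : R -> {measure set R -> \bar R})
    (nu : R -> R -> {measure set R -> \bar R}) : Prop := {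
  ms_mass : forall t a, t \in `[0%R, T] -> A a ->
    exists P : probability R R,
      (forall B, measurable B -> nu t a B = (h a)%:E * P B) /\
      \int[P]_x ((x ^+ 2)%R)%:E < +oo;
  ms_measurable_curve : measurable_curve T nu;
  ms_equation : exists v : R -> R -> R -> R,
    [/\ measurable_velocity T nu v,
        {ae hmu, forall a, A a ->
          continuity_equation T (fun t => nu t a) (fun t => v t a) (nu0 a)} &
        {ae space_time T nu, forall q : time * R * R,
          (`[0%R, T] `*` A `*` setT) q ->
          q.1.2%:E - G (nu q.1.1) q.2 <= (v q.1.1 q.1.2 q.2)%:E
            <= q.1.2%:E - Gminus (nu q.1.1) q.2}]
}.

End families.

(* Main.v *)
Require Import Defs.
From HB Require Import structures.
From mathcomp Require Import all_boot all_order all_algebra finmap.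
From mathcomp Require Import all_classical all_reals all_analysis.
From mathcomp Require Import measurable_realfun.
From mathcomp Require Import ring lra.

(** The idea is to build the flow in Lagrangian coordinates.  On the probability
    space [nu0 (x) mu] of pairs (x, a), explicit Euler schemes with dyadic steps
    move the particle (x, a) with velocity a - F(X), where F is the cumulative
    distribution function of the current law of X, symmetrized at atoms.  As
    a - F(X) is minus a monotone field, schemes with different steps remain
    close uniformly in (x, a), and the step can be sent to 0: this gives a
    Lipschitz flow X_t, whose law for fixed a is nu_t^a.  The velocity at time t
    of a particle of parameter b placed at y is defined as the limsup of the
    difference quotients over a time 2^-m of a fine scheme which starts from y
    in the field generated by X_t.  It is a function of (t, b, y), it depends
    on the law of (X_t, a) only, it lies between b - G_t(y) and b - G_t^-(y),
    and by Rademacher's theorem in t it is the derivative of X_t along almost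
    every trajectory, hence the continuity equation.  The energy is convex in
    Lagrangian coordinates, and each Euler step is a subgradient step; since
    the quotients depend on the law only, the subgradient inequality can be
    written on the probability space given by any family of couplings, and it
    passes to the limit. *)

Set Implicit Arguments.
Unset Strict Implicit.
Unset Printing Implicit Defensive.

Import Order.TTheory GRing.Theory Num.Theory.
Import numFieldNormedType.Exports.

Local Open Scope classical_set_scope.
Local Open Scope ring_scope.

(** * Bounded measurable functions *)

Section bounded_measurable.
Context d (T : measurableType d) (R : realType).
Implicit Types f g : T -> R.

(** The velocity a - F(x) jumps at the atoms of the law, so stability cannot come from Lipschitz
    bounds; the only tool is monotonicity, and for two different laws it holds after averaging over
    the labels (x, a). Stability is therefore proved twice: in mean square, where the cross terms
    have the right sign, then for each label, where the mean estimate pays for the difference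
    between the two laws.

    A gradient flow asks for a measurable function of (t, a, x), whereas differentiating
    trajectories gives a function of the label, defined for almost every time. Two labels may share
    a and their position; hence a restarted scheme, which cannot tell them apart, and an upper
    limit, which exists everywhere. The subdifferential tests arbitrary couplings, which live on
    spaces unrelated to that of the labels: only the law of (position, parameter) passes from one to
    the other, so exceptional sets too are expressed through it.

    Finally, the data are controlled for almost every a only, and families are measurable up to
    completion; truncations and integrals of possibly nonmeasurable functions absorb this. *)

Definition bmeas f := measurable_fun setT f /\ exists M, forall x, `|f x| <= M.

Lemma bmeas_cst (c : R) : bmeas (fun=> c).
Proof. by split; [exact: measurable_cst|exists `|c|]. Qed.

Lemma bmeasD f g : bmeas f -> bmeas g -> bmeas (fun x => f x + g x).
Proof.
move=> [mf [M hM]] [mg [N hN]]; split; first exact: measurable_funD.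
by exists (M + N) => x; rewrite (le_trans (ler_normD _ _))// lerD.
Qed.

Lemma bmeasN f : bmeas f -> bmeas (fun x => - f x).
Proof.
move=> [mf [M hM]]; split; first exact: measurable_funN.
by exists M => x; rewrite normrN.
Qed.

Lemma bmeasB f g : bmeas f -> bmeas g -> bmeas (fun x => f x - g x).
Proof. by move=> bf bg; apply: bmeasD => //; exact: bmeasN. Qed.

Lemma bmeasM f g : bmeas f -> bmeas g -> bmeas (fun x => f x * g x).
Proof.
move=> [mf [M hM]] [mg [N hN]]; split; first exact: measurable_funM.
by exists (M * N) => x; rewrite normrM ler_pM.
Qed.

Lemma bmeasX f n : bmeas f -> bmeas (fun x => f x ^+ n).
Proof.
move=> bf; elim: n => [|n ih]; first exact: bmeas_cst.
by under eq_fun do rewrite exprS; exact: bmeasM.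
Qed.

Lemma bmeas_norm f : bmeas f -> bmeas (fun x => `|f x|).
Proof.
move=> [mf [M hM]]; split; first exact: measurableT_comp.
by exists M => x; rewrite normr_id.
Qed.

End bounded_measurable.

Lemma bmeas_comp d d' (T : measurableType d) (U : measurableType d')
    (R : realType) (f : U -> R) (g : T -> U) :
  bmeas f -> measurable_fun setT g -> bmeas (fun x => f (g x)).
Proof.
move=> [mf [M hM]] mg; split; first exact: measurableT_comp.
by exists M => x.
Qed.

Create HintDb bm.
#[export] Hint Resolve bmeas_cst bmeasD bmeasN bmeasB bmeasM bmeasX bmeas_norm
  : bm.

(** * Expectations of bounded functions, as real numbers *)

Section expectation.
Context d (T : measurableType d) (R : realType) (P : probability T R).
Implicit Types f g : T -> R.
Local Notation E f := (Rintegral P setT f).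

Lemma bmeas_integrable f : bmeas f -> P.-integrable setT (EFin \o f).
Proof.
move=> [mf [M hM]]; apply: measurable_bounded_integrable => //.
  by apply: (le_lt_trans (probability_le1 P measurableT)); rewrite ltry.
by exists M; split; [exact: num_real|move=> N /ltW MN x _ /=; exact: le_trans MN].
Qed.

Lemma EFin_E f : bmeas f -> (E f)%:E = (\int[P]_x (f x)%:E)%E.
Proof.
move=> bf; rewrite /Rintegral fineK//.
by apply: integrable_fin_num => //; exact: bmeas_integrable.
Qed.

Lemma E_cst (c : R) : E (fun=> c) = c.
Proof.
rewrite Rintegral_cst// [X in fine X](_ : _ = 1%E) ?mulr1//.
exact: probability_setT.
Qed.

Lemma E_D f g : bmeas f -> bmeas g -> E (fun x => f x + g x) = E f + E g.
Proof. by move=> bf bg; rewrite RintegralD//; exact: bmeas_integrable. Qed.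

Lemma E_B f g : bmeas f -> bmeas g -> E (fun x => f x - g x) = E f - E g.
Proof. by move=> bf bg; rewrite RintegralB//; exact: bmeas_integrable. Qed.

Lemma E_Zl c f : bmeas f -> E (fun x => c * f x) = c * E f.
Proof. by move=> bf; rewrite RintegralZl//; exact: bmeas_integrable. Qed.

Lemma E_Zr c f : bmeas f -> E (fun x => f x * c) = E f * c.
Proof. by move=> bf; rewrite RintegralZr//; exact: bmeas_integrable. Qed.

Lemma E_N f : bmeas f -> E (fun x => - f x) = - E f.
Proof.
move=> bf; rewrite -mulN1r -E_Zl//.
by apply: eq_Rintegral => x _; rewrite mulN1r.
Qed.

Lemma E_le f g : bmeas f -> bmeas g -> (forall x, f x <= g x) -> E f <= E g.
Proof.
by move=> bf bg fg; apply: le_Rintegral => //; exact: bmeas_integrable.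
Qed.

Lemma E_le_cst f c : bmeas f -> (forall x, f x <= c) -> E f <= c.
Proof. by move=> bf fc; rewrite -(E_cst c); apply: E_le => //; exact: bmeas_cst. Qed.

Lemma E_ge_cst f c : bmeas f -> (forall x, c <= f x) -> c <= E f.
Proof. by move=> bf fc; rewrite -(E_cst c); apply: E_le => //; exact: bmeas_cst. Qed.

Lemma E_norm f : bmeas f -> `|E f| <= E (fun x => `|f x|).
Proof. by move=> bf; apply: le_normr_Rintegral => //; exact: bmeas_integrable. Qed.

(** Integrate |f| <= e/2 + f^2/(2e), which is (e - |f|)^2 >= 0; each term on the right has mean at
    most e/2. *)
Lemma E_sqr_le f (e : R) : bmeas f -> 0 < e ->
  E (fun x => f x ^+ 2) <= e ^+ 2 -> E (fun x => `|f x|) <= e.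
Proof.
move=> bf e0 fe.
have b2 : bmeas (fun x => f x ^+ 2) by auto with bm.
apply: (@le_trans _ _ (E (fun x => e / 2 + (2 * e)^-1 * f x ^+ 2))).
  apply: E_le; [auto with bm|auto 7 with bm|] => x.
  rewrite -subr_ge0 -[f x ^+ 2]real_normK ?num_real//.
  rewrite (_ : _ - _ = (2 * e)^-1 * (e - `|f x|) ^+ 2); last by field; lra.
  by rewrite mulr_ge0 ?sqr_ge0// invr_ge0; lra.
rewrite E_D; [|exact: bmeas_cst|auto with bm].
rewrite E_cst E_Zl//.
have h : (2 * e)^-1 * E (fun x => f x ^+ 2) <= (2 * e)^-1 * e ^+ 2.
  by rewrite ler_wpM2l// invr_ge0; lra.
rewrite (le_trans (lerD (lexx _) h))//.
by rewrite [leLHS](_ : _ = e)//; field; lra.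
Qed.

End expectation.

Section double_expectation.
Context d d' (T : measurableType d) (U : measurableType d') (R : realType).
Variables (Q : probability U R) (f : T * U -> R).
Hypothesis bf : bmeas f.

Lemma bmeas_xsec x : bmeas (fun y => f (x, y)).
Proof. by apply: bmeas_comp => //; exact: measurable_pair1. Qed.

Lemma bmeas_ysec y : bmeas (fun x => f (x, y)).
Proof. by apply: bmeas_comp => //; exact: measurable_pair2. Qed.

Lemma bmeas_integrable_prod (P : probability T R) : (P \x Q)%E.-integrable setT (EFin \o f).
Proof.
have [mf [M hM]] := bf.
apply: measurable_bounded_integrable => //.
  apply: (@le_lt_trans _ _ (P setT * Q setT)%E).
    by rewrite -product_measure1E// setXTT.
  by rewrite (probability_setT P) (probability_setT Q) mule1 ltry.
by exists M; split; [exact: num_real|move=> N /ltW MN x _ /=; exact: le_trans MN].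
Qed.

Lemma bmeas_E : bmeas (fun x => Rintegral Q setT (fun y => f (x, y))).
Proof.
split.
  have := measurable_fubini_F (bmeas_integrable_prod \d_point).
  move/(measurableT_comp (fine_measurable measurableT)); exact.
have [_ [M hM]] := bf; exists M => x.
by rewrite (le_trans (E_norm _ _))// ?E_le_cst//; do ?apply: bmeas_norm; exact: bmeas_xsec.
Qed.

End double_expectation.

Lemma E_swap d d' (T : measurableType d) (U : measurableType d') (R : realType)
  (P : probability T R) (Q : probability U R) (f : T * U -> R) : bmeas f ->
  Rintegral P setT (fun x => Rintegral Q setT (fun y => f (x, y))) =
  Rintegral Q setT (fun y => Rintegral P setT (fun x => f (x, y))).
Proof.
move=> bf; apply: EFin_inj; rewrite EFin_E; last exact: bmeas_E.
rewrite EFin_E; last first.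
    apply: (@bmeas_E _ _ _ _ _ P (fun z => f (z.2, z.1))).
  apply: (bmeas_comp bf); apply: measurable_fun_pair.
    exact: measurable_snd.
  exact: measurable_fst.
transitivity (\int[P]_x \int[Q]_y (f (x, y))%:E)%E.
  by apply: eq_integral => x _; rewrite EFin_E//; exact: bmeas_xsec.
rewrite (Fubini (bmeas_integrable_prod Q bf P)).
by apply: eq_integral => x _; rewrite EFin_E//; exact: bmeas_ysec.
Qed.

(** * The field of a law and its monotonicity *)

Section step_function.
Variable R : realType.
Implicit Types p q r : R.

(** The value 1/2 at 0 gives [hstep (- r) = 1 - hstep r], so that the kernels built on it below are
    antisymmetric in two labels; it also makes [2 * hstep r - 1] the sign of r, with value 0 at
    0. *)
Definition hstep r : R := if 0 < r then 1 else if r == 0 then 2^-1 else 0.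

Lemma hstep_ge0 r : 0 <= hstep r.
Proof. by rewrite /hstep; case: ifP => // _; case: ifP => // _; lra. Qed.

Lemma hstep_le1 r : hstep r <= 1.
Proof. by rewrite /hstep; case: ifP => // _; case: ifP => // _; lra. Qed.

Lemma hstepN r : hstep (- r) = 1 - hstep r.
Proof.
rewrite /hstep oppr_gt0 oppr_eq0; case: (ltgtP r 0) => // _; lra.
Qed.

Lemma hstep_nd : {homo hstep : p q / p <= q}.
Proof.
move=> p q; rewrite /hstep.
by case: (ltgtP 0 p); case: (ltgtP 0 q) => //; lra.
Qed.

Lemma hstep_mono p q : 0 <= (hstep p - hstep q) * (p - q).
Proof.
by case: (leP p q) => [pq|/ltW pq]; have := hstep_nd pq; nra.
Qed.

(* [2 hstep - 1] is a subgradient of the absolute value. *)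
Lemma hstep_subgradient p q : (2 * hstep p - 1) * (q - p) <= `|q| - `|p|.
Proof.
have := ler_norm q; have := ler_norm (- q); rewrite normrN.
rewrite /hstep; case: (ltgtP 0 p) => [hp|hp|<-].
- by rewrite (gtr0_norm hp); lra.
- by rewrite (ltr0_norm hp); lra.
- by rewrite normr0; lra.
Qed.

Lemma measurable_hstep : measurable_fun setT hstep.
Proof. by apply: nondecreasing_measurable => // p q; exact: hstep_nd. Qed.

Lemma hstep_norm_le1 r : `|hstep r| <= 1.
Proof. by rewrite ger0_norm ?hstep_ge0// hstep_le1. Qed.

End step_function.

Lemma bmeas_hstep d (T : measurableType d) (R : realType) (f : T -> R) :
  measurable_fun setT f -> bmeas (fun x => hstep (f x)).
Proof.
move=> mf; split; first by apply: measurableT_comp => //; exact: measurable_hstep.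
by exists 1 => x; exact: hstep_norm_le1.
Qed.

Section field.
Context d (T : measurableType d) (R : realType) (P : probability T R).
Local Notation E f := (Rintegral P setT f).
Implicit Types A B W : T -> R.

(** This is P(W < u) + P(W = u)/2, the symmetrized distribution function of [W]. *)
Definition field W (u : R) : R := E (fun w => hstep (u - W w)).

Lemma bmeas_field_par d' (S : measurableType d') (g : S -> R) (W : S * T -> R) :
  measurable_fun setT g -> measurable_fun setT W ->
  bmeas (fun s => field (fun w => W (s, w)) (g s)).
Proof.
move=> mg mW; apply: (@bmeas_E _ _ _ _ _ P (fun z => hstep (g z.1 - W z))).
apply: bmeas_hstep; apply: measurable_funB => //.
by apply: measurableT_comp => //; exact: measurable_fst.
Qed.

Lemma bmeas_field d' (S : measurableType d') (g : S -> R) W :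
  measurable_fun setT g -> measurable_fun setT W ->
  bmeas (fun s => field W (g s)).
Proof.
move=> mg mW; apply: (bmeas_field_par (W := fun z => W z.2)) => //.
by apply: measurableT_comp => //; exact: measurable_snd.
Qed.

Lemma bmeas_field_integrand W u :
  measurable_fun setT W -> bmeas (fun w => hstep (u - W w)).
Proof. by move=> mW; apply: bmeas_hstep; exact: measurable_funB. Qed.

Lemma field_ge0 W u : 0 <= field W u.
Proof. by apply: Rintegral_ge0 => x _; exact: hstep_ge0. Qed.

Lemma field_le1 W u : measurable_fun setT W -> field W u <= 1.
Proof.
move=> mW; apply: E_le_cst => [|x]; last exact: hstep_le1.
exact: bmeas_field_integrand.
Qed.

Lemma field_sub_norm A B u v : measurable_fun setT A -> measurable_fun setT B ->
  `|field A u - field B v| <= 1.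
Proof.
move=> mA mB; have := field_ge0 A u; have := field_ge0 B v.
have := field_le1 u mA; have := field_le1 v mB.
by rewrite ler_norml; lra.
Qed.

(** Written as a double integral over labels (w, w'), the expression has a kernel [K] that changes
    sign under exchange of w and w'. Averaging with the exchanged copy leaves half the integral of a
    product (hstep p - hstep q)(p - q), nonnegative by [hstep_mono]. *)
Lemma field_mono A B : bmeas A -> bmeas B ->
  0 <= E (fun w => (field A (A w) - field B (B w)) * (A w - B w)).
Proof.
move=> bA bB; have [mA _] := bA; have [mB _] := bB.
pose K (z : T * T) := hstep (A z.1 - A z.2) - hstep (B z.1 - B z.2).
have m1 W : measurable_fun setT W -> measurable_fun setT (fun z : T * T => W z.1).
  by move=> mW; apply: measurableT_comp => //; exact: measurable_fst.
have m2 W : measurable_fun setT W -> measurable_fun setT (fun z : T * T => W z.2).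
  by move=> mW; apply: measurableT_comp => //; exact: measurable_snd.
have bK : bmeas K by apply: bmeasB; apply: bmeas_hstep; apply: measurable_funB; auto.
pose f (z : T * T) := K z * (A z.1 - B z.1).
pose g (z : T * T) := K z * (A z.2 - B z.2).
have b1 : bmeas (fun z : T * T => A z.1 - B z.1).
  by apply: bmeasB; apply: bmeas_comp => //; exact: measurable_fst.
have b2 : bmeas (fun z : T * T => A z.2 - B z.2).
  by apply: bmeasB; apply: bmeas_comp => //; exact: measurable_snd.
have bf : bmeas f by exact: bmeasM.
have bg : bmeas g by exact: bmeasM.
have EfE : E (fun w => (field A (A w) - field B (B w)) * (A w - B w)) =
    E (fun w => E (fun w' => f (w, w'))).
  apply: eq_Rintegral => w _; rewrite /f/= E_Zr; last exact: bmeas_xsec.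
  by rewrite /field -E_B//; exact: bmeas_field_integrand.
have EgE : E (fun w => E (fun w' => g (w, w'))) = - E (fun w => E (fun w' => f (w, w'))).
  rewrite -E_N; last exact: bmeas_E.
  rewrite (E_swap P P bg); apply: eq_Rintegral => w _.
  rewrite -E_N; last exact: bmeas_xsec.
  apply: eq_Rintegral => w' _; rewrite /g /f /K /=.
  rewrite -(opprB (A w)) -(opprB (B w)) !hstepN; ring.
(* Doubling turns the integral of [f] into that of [f - g], since [g] integrates to the opposite of
   [f]. *)
rewrite EfE -(pmulrn_lge0 _ (ltn0Sn 1)) mulr2n -[X in _ + X]opprK -EgE.
rewrite -E_B; [|exact: bmeas_E..].
apply: Rintegral_ge0 => w _; rewrite -E_B; [|exact: bmeas_xsec..].
apply: Rintegral_ge0 => w' _; rewrite /f /g /K /=.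
have := hstep_mono (A w - A w') (B w - B w').
by congr (_ <= _); ring.
Qed.

(* Monotonicity of [hstep] turns the mismatch between the two laws into the
   L1 distance of [A] and [B], with no regularity of the laws needed. *)
Lemma field_pointwise A B u v : bmeas A -> bmeas B ->
  - E (fun w => `|A w - B w|) <= (field A u - field B v) * (u - v).
Proof.
move=> bA bB; have [mA _] := bA; have [mB _] := bB.
have bu := bmeas_field_integrand u mA; have bv := bmeas_field_integrand v mB.
have bn : bmeas (fun w => `|A w - B w|) by auto with bm.
rewrite /field -E_B// -E_Zr; last exact: bmeasB.
rewrite -E_N//; apply: E_le; [exact: bmeasN|by apply: bmeasM; [exact: bmeasB|exact: bmeas_cst]|].
move=> w; have := hstep_mono (u - A w) (v - B w).
set p := hstep _; set q := hstep _.
have p0 : 0 <= p := hstep_ge0 _; have p1 : p <= 1 := hstep_le1 _.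
have q0 : 0 <= q := hstep_ge0 _; have q1 : q <= 1 := hstep_le1 _.
have := ler_norm (A w - B w); have := ler_norm (- (A w - B w)); rewrite normrN.
have := normr_ge0 (A w - B w); set r := `|_|; clearbody r p q.
nra.
Qed.

End field.

(** * Stability of perturbed Euler schemes *)

Section comparison.
Context d (T : measurableType d) (R : realType) (P : probability T R).
Local Notation E f := (Rintegral P setT f).
Local Notation field := (field P).

(** The inner root bounds the mean-square gap after a total time [L]: the squared gap starts at e^2
    and gains 5e per unit of time. For a single label the cross term adds 2 (inner root + 2e) per
    unit of time, whence 9e + 2 (inner root). *)
Definition rate (L e : R) : R :=
  Num.sqrt (e ^+ 2 + L * (9 * e + 2 * Num.sqrt (e ^+ 2 + 5 * L * e))).

(** Expand the square: replacing x by y in the cross term costs at most 2s * 2e, and s^2 D^2 is at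
    most s * e, so 5e in total per unit of time. Here D is a difference of two fields, read at
    points whose gap y differs from x. *)
Lemma step_sqr_le (D x y s e : R) : 0 <= s -> s <= e -> `|D| <= 1 ->
  `|y - x| <= 2 * e ->
  (x - s * D) ^+ 2 <= x ^+ 2 - 2 * s * (D * y) + s * (5 * e).
Proof.
move=> s0 se; rewrite !ler_norml => /andP[D1 D2] /andP[h1 h2].
have D2' : D ^+ 2 <= 1 by nra.
have : D * (y - x) <= 2 * e by nra.
move=> h; rewrite -subr_ge0.
rewrite (_ : _ - _ = 2 * s * (2 * e - D * (y - x)) + s * (e - s * D ^+ 2)); last by ring.
by rewrite addr_ge0// mulr_ge0//; nra.
Qed.

Variables (al : T -> R) (A A' B B' : nat -> T -> R) (s e L : R) (n : nat).
Hypotheses (bA : forall i, bmeas (A i)) (bA' : forall i, bmeas (A' i)).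
Hypotheses (bB : forall i, bmeas (B i)) (bB' : forall i, bmeas (B' i)).
Hypotheses (s0 : 0 < s) (se : s <= e) (nL : n%:R * s <= L).
Hypothesis AS : forall i w, A i.+1 w = A i w - s * (field (A' i) (A' i w) - al w).
Hypothesis BS : forall i w, B i.+1 w = B i w - s * (field (B' i) (B' i w) - al w).
Hypothesis AA' : forall i w, `|A' i w - A i w| <= e.
Hypothesis BB' : forall i w, `|B' i w - B i w| <= e.
Hypothesis AB0 : forall w, `|A 0%N w - B 0%N w| <= e.

Let e0 : 0 < e. Proof. exact: lt_le_trans se. Qed.
Let L0 : 0 <= L. Proof. by rewrite (le_trans _ nL)// mulr_ge0// ltW. Qed.

Let step i w : (A i.+1 w - B i.+1 w) ^+ 2 <= (A i w - B i w) ^+ 2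
  - 2 * s * ((field (A' i) (A' i w) - field (B' i) (B' i w)) * (A' i w - B' i w))
  + s * (5 * e).
Proof.
have [mA' _] := bA' i; have [mB' _] := bB' i.
rewrite AS BS.
rewrite (_ : _ - _ - _ = (A i w - B i w) -
  s * (field (A' i) (A' i w) - field (B' i) (B' i w))); last by ring.
apply: step_sqr_le => //; [exact: ltW|exact: field_sub_norm|].
rewrite (_ : _ - _ = (A' i w - A i w) - (B' i w - B i w)); last by ring.
by rewrite (le_trans (ler_normB _ _))// mulr_natl mulr2n lerD.
Qed.

Let sqr0 w : (A 0%N w - B 0%N w) ^+ 2 <= e ^+ 2.
Proof.
by rewrite -[X in X <= _]real_normK ?num_real// lerXn2r// nnegrE// ltW.
Qed.

(** The field that drives [A] is read at the nearby position [A'], which allows a coarse scheme to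
    be seen as a fine one with frozen field. In mean, the cross term of [step] has a favourable sign
    by [field_mono], so only the 5e term accumulates. *)
Lemma comparison_L2 i :
  E (fun w => (A i w - B i w) ^+ 2) <= e ^+ 2 + i%:R * (s * (5 * e)).
Proof.
elim: i => [|i ih].
  by rewrite mul0r addr0; apply: E_le_cst => //; auto with bm.
have [mA' _] := bA' i; have [mB' _] := bB' i.
have bf : bmeas (fun w => (field (A' i) (A' i w) - field (B' i) (B' i w)) * (A' i w - B' i w)).
  by apply: bmeasM; apply: bmeasB => //; exact: bmeas_field.
have b2 : bmeas (fun w => (A i w - B i w) ^+ 2) by auto with bm.
apply: (@le_trans _ _ (E (fun w => (A i w - B i w) ^+ 2
  - 2 * s * ((field (A' i) (A' i w) - field (B' i) (B' i w)) * (A' i w - B' i w))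
  + s * (5 * e)))).
  by apply: E_le => //; auto 10 with bm.
rewrite E_D; [|by auto with bm..].
rewrite E_B; [|by auto with bm..].
rewrite E_Zl// E_cst -[in leRHS]natr1.
have := field_mono P (bA' i) (bB' i).
have : 0 <= s by exact: ltW.
by move: ih; set X := E _; set Y := E _; clearbody X Y; nra.
Qed.

(** For a fixed label the cross term has no sign, but [field_pointwise] bounds it below by minus the
    mean distance of [A'] and [B'], which [comparison_L2] and [E_sqr_le] control. *)
Lemma comparison i w : (i <= n)%N -> `|A i w - B i w| <= rate L e.
Proof.
move=> ni.
pose ep := Num.sqrt (e ^+ 2 + 5 * L * e).
have ep_gt0 : 0 < ep.
  by rewrite sqrtr_gt0 ltr_wpDr ?exprn_gt0// mulr_ge0 ?mulr_ge0// ltW.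
have ep2 : ep ^+ 2 = e ^+ 2 + 5 * L * e.
  by rewrite sqr_sqrtr// addr_ge0 ?sqr_ge0// mulr_ge0 ?mulr_ge0// ltW.
have jL j : (j <= n)%N -> j%:R * s <= L.
  by move=> jn; rewrite (le_trans _ nL)// ler_wpM2r ?ler_nat// ltW.
have L1 j : (j <= n)%N -> E (fun w => `|A' j w - B' j w|) <= ep + 2 * e.
  move=> jn; have b1 : bmeas (fun w => `|A j w - B j w|) by auto with bm.
  apply: (@le_trans _ _ (E (fun w => `|A j w - B j w| + 2 * e))).
    apply: E_le; [by auto with bm|by auto with bm|] => u.
    rewrite (_ : A' j u - _ = (A j u - B j u) + ((A' j u - A j u) - (B' j u - B j u))); last by ring.
    rewrite (le_trans (ler_normD _ _))// lerD2l (le_trans (ler_normB _ _))//.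
    by rewrite mulr_natl mulr2n lerD.
  rewrite E_D; [|by auto with bm..]; rewrite E_cst lerD2r.
  apply: E_sqr_le => //; [by auto with bm|].
  rewrite ep2 (le_trans (comparison_L2 j))// lerD2l.
  rewrite (_ : j%:R * _ = 5 * (j%:R * s) * e); last by ring.
  by rewrite ler_wpM2r ?(ltW e0)// ler_wpM2l// jL.
rewrite /rate -/ep -[leLHS]sqrtr_sqr ler_wsqrtr//.
apply: (@le_trans _ _ (e ^+ 2 + i%:R * s * (9 * e + 2 * ep))); last first.
  rewrite lerD2l ler_wpM2r ?jL// addr_ge0// mulr_ge0// ltW//.
elim: i ni => [_|i ih ni]; first by rewrite !mul0r addr0.
have {}ih := ih (ltnW ni).
apply: (le_trans (step i w)).
have := field_pointwise P (A' i w) (B' i w) (bA' i) (bB' i).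
have := L1 i (ltnW ni).
rewrite -natr1; have : 0 <= s by exact: ltW.
by move: ih; set X := E _; set Z := (field _ _ - _) * _; set Y := _ ^+ 2; clearbody X Y Z; nra.
Qed.

End comparison.

Lemma rate_cvg0 (R : realType) (L : R) (e : nat -> R) :
  e @ \oo --> 0 -> (fun k => rate L (e k)) @ \oo --> 0.
Proof.
have r0 : rate L 0 = 0.
  by rewrite /rate expr0n/= !mulr0 addr0 sqrtr0 !(mulr0, addr0) sqrtr0.
have cr : continuous (rate L).
  have sq : continuous (fun x : R => x ^+ 2) by exact: exprn_continuous.
  have l1 (c : R) : continuous (fun x : R => c * x) by exact: mulrl_continuous.
  have c2 : continuous (fun x : R => x ^+ 2 + 5 * L * x).
    by move=> y; apply: cvgD; [exact: sq|exact: l1].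
  move=> y; apply: (@continuous_comp _ _ _ (fun x : R => x ^+ 2 + L * (9 * x +
    2 * Num.sqrt (x ^+ 2 + 5 * L * x))) (@Num.sqrt R)); last exact: sqrt_continuous.
  apply: cvgD; first exact: sq.
  apply: cvgM; first exact: cvg_cst.
  apply: cvgD; first exact: l1.
  apply: cvgM; first exact: cvg_cst.
  apply: (@continuous_comp _ _ _ (fun x : R => x ^+ 2 + 5 * L * x) (@Num.sqrt R)); first exact: c2.
  exact: sqrt_continuous.
by move=> e0; rewrite -r0; exact: continuous_cvg (cr 0) e0.
Qed.

(** * Dyadic steps and indices of times *)

Section dyadic.
Variable R : realType.

Definition dy (k : nat) : R := 2^-1 ^+ k.

Lemma dy_gt0 k : 0 < dy k. Proof. by rewrite exprn_gt0// invr_gt0. Qed.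

Lemma dy_neq0 k : dy k != 0. Proof. by rewrite gt_eqF// dy_gt0. Qed.

Lemma dyE k : dy k = (2 ^+ k)^-1. Proof. by rewrite /dy exprVn. Qed.

Lemma dyD k d : (2 ^ d)%:R * dy (k + d) = dy k.
Proof. by rewrite !dyE exprD natrX invfM mulrCA divff ?mulr1// expf_neq0. Qed.

Lemma dy_le k l : (k <= l)%N -> dy l <= dy k.
Proof.
move=> kl; rewrite -(subnKC kl) -(dyD k (l - k)) -{1}[dy _]mul1r.
by rewrite ler_wpM2r ?(ltW (dy_gt0 _))// ler1n expn_gt0.
Qed.

Lemma dy_le1 k : dy k <= 1. Proof. by rewrite exprn_ile1//; lra. Qed.

Lemma dy_cvg0 : dy @ \oo --> 0.
Proof. by apply: cvg_expr; rewrite ger0_norm; lra. Qed.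

(** Dyadic grids are nested: dividing the index of a time on the fine grid gives its index on the
    coarse one. *)
Lemma truncn_div (x : R) n : (0 < n)%N ->
  (Num.truncn (n%:R * x) %/ n = Num.truncn x)%N.
Proof.
move=> n0; have n0' : (0 : R) < n%:R by rewrite ltr0n.
have [x0|x0] := leP 0 x; last first.
  have h (y : R) : y < 0 -> Num.truncn y = 0%N.
    by move=> y0; apply/truncn0Pn; rewrite -ltNge (lt_trans y0).
  by rewrite !h ?div0n ?pmulr_rlt0.
apply/esym/truncn_def.
have /andP[h1 h2] := truncn_itv (mulr_ge0 (ltW n0') x0).
set N := Num.truncn _ in h1 h2 *.
rewrite -(ler_pM2l n0') -(ltr_pM2l n0') -!natrM; apply/andP; split.
  by rewrite (le_trans _ h1)// ler_nat mulnC leq_divM.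
rewrite (lt_le_trans h2)// ler_nat mulnC.
by rewrite ltn_ceil.
Qed.

Lemma truncn_addn (x : R) n : 0 <= x -> Num.truncn (x + n%:R) = (Num.truncn x + n)%N.
Proof.
move=> x0; apply/truncn_def; have /andP[h1 h2] := truncn_itv x0.
by rewrite -addSn !natrD lerD2r ltrD2r h1.
Qed.

End dyadic.

Section limn_sup_bounds.
Variable R : realType.

Lemma limn_sup_bounds (u : R^nat) (lo hi : R) : bounded_fun u ->
  (forall e, 0 < e -> \forall n \near \oo, lo - e <= u n <= hi + e) ->
  lo <= limn_sup u <= hi.
Proof.
move=> bu ue.
have hu : has_ubound (range u) := bounded_fun_has_ubound bu.
have hl : has_lbound (range u) := bounded_fun_has_lbound bu.
rewrite limn_supE//; apply/andP; split; apply/ler_addgt0Pr => e e0.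
  rewrite -lerBlDr; apply: lb_le_inf; first by exists (sups u 0%N), 0%N.
  move=> _ [n _ <-]; have [N _ hN] := ue e e0.
  have /andP[h _] := hN (n + N)%N (leq_addl _ _).
  rewrite (le_trans h)//; apply: ub_le_sup; first exact: has_ubound_sdrop.
  by exists (n + N)%N => //=; rewrite leq_addr.
have [N _ hN] := ue e e0.
apply: (@le_trans _ _ (sups u N)).
  apply: ge_inf; last by exists N.
  exact: bounded_fun_has_lbound_sups.
apply: ge_sup; first by exists (u N), N => /=.
by move=> _ [n /= Nn <-]; have /andP[] := hN n Nn.
Qed.

End limn_sup_bounds.

(** * Explicit Euler schemes *)

Section euler.
Context d (T : measurableType d) (R : realType) (P : probability T R).
Variables (al : T -> R).
Hypothesis (mal : measurable_fun setT al).
Local Notation field := (field P).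

(* Position at step [n] of a particle of parameter [b] issued from [y], in the
   field of the particles that have parameters [al] and issue from [Z]. *)
Fixpoint euler (Z : T -> R) (s : R) (n : nat) (y b : R) : R :=
  if n is m.+1 then
    let z := euler Z s m y b in
    z - s * (field (fun w => euler Z s m (Z w) (al w)) z - b)
  else y.

Definition eulerT (Z : T -> R) (s : R) n w := euler Z s n (Z w) (al w).

Lemma eulerS Z s n y b : euler Z s n.+1 y b =
  euler Z s n y b - s * (field (eulerT Z s n) (euler Z s n y b) - b).
Proof. by []. Qed.

Lemma eulerTS Z s n w : eulerT Z s n.+1 w =
  eulerT Z s n w - s * (field (eulerT Z s n) (eulerT Z s n w) - al w).
Proof. by []. Qed.

(** The parameter space [U] is arbitrary for the sake of the induction: the field at step n
    integrates the scheme over labels, so the hypothesis is needed on [U * T]. *)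
Lemma measurable_euler s n d' (U : measurableType d') (Z : U * T -> R)
    (y b : U -> R) : measurable_fun setT Z -> measurable_fun setT y ->
  measurable_fun setT b ->
  measurable_fun setT (fun u => euler (fun w => Z (u, w)) s n (y u) (b u)).
Proof.
elim: n d' U Z y b => [//|n ih] d' U Z y b mZ my mb.
have my' := ih _ _ _ _ _ mZ my mb.
apply: measurable_funB => //; apply: measurable_funM => //.
apply: measurable_funB => //.
have m2 : measurable_fun setT (fun z : U * T => al z.2).
  by apply: measurableT_comp => //; exact: measurable_snd.
have mW : measurable_fun setT
    (fun z : U * T => euler (fun w => Z (z.1, w)) s n (Z z) (al z.2)).
  apply: (ih _ _ (fun zw : (U * T) * T => Z (zw.1.1, zw.2))) => //.
  apply: measurableT_comp => //; apply: measurable_fun_pair.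
    by apply: measurableT_comp; exact: measurable_fst.
  exact: measurable_snd.
by have [] := bmeas_field_par P my' mW.
Qed.

Lemma measurable_eulerT Z s n : measurable_fun setT Z ->
  measurable_fun setT (eulerT Z s n).
Proof.
move=> mZ; apply: (@measurable_euler s n _ _ (fun z => Z z.2) Z al) => //.
by apply: measurableT_comp => //; exact: measurable_snd.
Qed.

Variables (M : R).
Hypothesis M0 : 0 <= M.
(** Bound on the speed: the field lies in [0, 1] and the parameter in [-M, M]. *)
Let C := 1 + M.

Lemma euler_step Z s n y b : measurable_fun setT Z -> 0 <= s -> `|b| <= M ->
  `|euler Z s n.+1 y b - euler Z s n y b| <= s * C.
Proof.
move=> mZ s0 bM; rewrite eulerS addrAC subrr add0r normrN normrM ger0_norm//.
rewrite ler_wpM2l// (le_trans (ler_normB _ _))// lerD//.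
rewrite ger0_norm ?field_ge0//; apply: field_le1.
exact: measurable_eulerT.
Qed.

Lemma euler_dist Z s n k y b : measurable_fun setT Z -> 0 <= s -> `|b| <= M ->
  `|euler Z s (n + k) y b - euler Z s n y b| <= k%:R * (s * C).
Proof.
move=> mZ s0 bM; elim: k => [|k ih]; first by rewrite addn0 subrr normr0 mul0r.
rewrite addnS -natr1 mulrDl mul1r [leRHS]addrC.
rewrite (_ : _ - _ = (euler Z s (n + k).+1 y b - euler Z s (n + k) y b) +
  (euler Z s (n + k) y b - euler Z s n y b)); last by ring.
by rewrite (le_trans (ler_normD _ _))// lerD//; exact: euler_step.
Qed.

Lemma euler_dist0 Z s k y b : measurable_fun setT Z -> 0 <= s -> `|b| <= M ->
  `|euler Z s k y b - y| <= k%:R * (s * C).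
Proof. by move=> *; exact: (@euler_dist Z s 0 k y b). Qed.

Hypothesis alM : forall w, `|al w| <= M.

Lemma bmeas_eulerT Z s n : 0 <= s -> bmeas Z -> bmeas (eulerT Z s n).
Proof.
move=> s0 [mZ [N hN]]; split; first exact: measurable_eulerT.
exists (n%:R * (s * C) + N) => w.
rewrite /eulerT -[X in `|X|](subrK (Z w)) (le_trans (ler_normD _ _))//.
by rewrite lerD//; exact: euler_dist0.
Qed.

(** Interpolated affinely on the fine grid, the coarse scheme is a fine scheme whose velocity is
    frozen at the last coarse time, where its position differs by at most [dy k * C]. Hence
    [comparison] applies; the last term brings the interpolation back to the coarse grid. *)
Lemma euler_refine Z k l N (L : R) w : bmeas Z -> N%:R * dy R (k + l) <= L ->
  `|eulerT Z (dy R k) (N %/ 2 ^ l) w - eulerT Z (dy R (k + l)) N w| <=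
  rate L (dy R k * C) + dy R k * C.
Proof.
move=> bZ NL; have [mZ _] := bZ.
set hk := dy R k; set hl := dy R (k + l); set D := (2 ^ l)%N.
have D0 : (0 < D)%N by rewrite expn_gt0.
have hkl : D%:R * hl = hk by exact: dyD.
have hl0 : 0 < hl by exact: dy_gt0.
have hk0 : 0 < hk by exact: dy_gt0.
have C1 : 1 <= C by rewrite /C lerDl.
pose X := eulerT Z hk.
have bX i : bmeas (X i) by apply: bmeas_eulerT => //; exact: ltW.
pose V i w := field (X i) (X i w) - al w.
have bV i : bmeas (V i).
  apply: bmeasB; first by apply: bmeas_field => //; have [] := bX i.
  by split => //; exists M.
have VC i u : `|V i u| <= C.
  rewrite (le_trans (ler_normB _ _))// lerD// ger0_norm ?field_ge0//.
  by apply: field_le1; have [] := bX i.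
(* The affine interpolation: [i %/ D] coarse steps are complete and [i %% D] fine steps of the next
   one are done. *)
pose A i w := X (i %/ D)%N w - (i %% D)%:R * hl * V (i %/ D)%N w.
have dA i u : `|X (i %/ D)%N u - A i u| <= hk * C.
  rewrite /A opprB addrCA subrr addr0 normrM ler_pM// normrM !ger0_norm ?ler0n//; last exact: ltW.
  by rewrite -hkl ler_wpM2r ?(ltW hl0)// ler_nat ltnW// ltn_mod.
have dN : `|A N w - eulerT Z hl N w| <= rate L (hk * C).
  apply: (@comparison _ _ _ P al A (fun i => X (i %/ D)%N) (eulerT Z hl) (eulerT Z hl) hl (hk * C) L N) => //.
  - by move=> i; apply: bmeasB => //; apply: bmeasM => //; exact: bmeas_cst.
  - by move=> i; apply: bmeas_eulerT => //; exact: ltW.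
  - by move=> i; apply: bmeas_eulerT => //; exact: ltW.
  - rewrite -hkl mulrC mulrA ler_peMl ?(ltW hl0)//.
    by rewrite mulr_ege1// ler1n.
  - move=> i u; rewrite /A -/(V _ _).
    (* Either the fine step stays inside the current coarse step, or it completes it and the
       remainder returns to 0. *)
    have [h|h] := ltnP (i %% D).+1 D.
      have e1 : (i.+1 %/ D = i %/ D)%N.
        by rewrite {1}(divn_eq i D) -addnS divnMDl// [X in (_ + X)%N]divn_small// addn0.
      have e2 : (i.+1 %% D = (i %% D).+1)%N.
        by rewrite {1}(divn_eq i D) -addnS modnMDl modn_small.
      by rewrite e1 e2 -natr1; ring.
    have {}h : (i %% D).+1 = D by apply/eqP; rewrite eqn_leq h ltn_mod D0.
    have e1 : (i.+1 %/ D = (i %/ D).+1)%N.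
      by rewrite {1}(divn_eq i D) -addnS h -mulSnr mulnK.
    have e2 : (i.+1 %% D = 0)%N.
      by rewrite {1}(divn_eq i D) -addnS h -mulSnr modnMl.
    rewrite e1 e2 mul0r mul0r subr0 {1}/X eulerTS -/X -/(V _ _).
    have hkE : hk = ((i %% D)%:R + 1) * hl by rewrite natr1 h.
    by move: (V _ _) (X _ _) => v x; rewrite hkE; ring.
  - by move=> i u; rewrite subrr normr0 mulr_ge0// ?(ltW hk0)//; exact: le_trans C1.
  - move=> u; rewrite /A div0n mod0n mul0r mul0r subr0 subrr normr0.
    by rewrite mulr_ge0// ?(ltW hk0)//; exact: le_trans C1.
rewrite -[X in `|X - _|](subrK (A N w)) -addrA addrC (le_trans (ler_normD _ _))//.
by rewrite lerD.
Qed.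

End euler.

(** * The Lagrangian flow *)

Section flow.
Context d (T : measurableType d) (R : realType) (P : probability T R).
Variables (al Z : T -> R) (M : R).
Hypotheses (mal : measurable_fun setT al) (alM : forall w, `|al w| <= M).
Hypotheses (bZ : bmeas Z) (M0 : 0 <= M).
Local Notation C := (1 + M).
Local Notation eulerT := (eulerT P al).
Local Notation euler := (euler P al).

Let C0 : 0 <= C. Proof. by rewrite addr_ge0. Qed.

Definition flowk (k : nat) (t : R) : T -> R :=
  eulerT Z (dy R k) (Num.truncn ((2 ^ k)%:R * t)).

Definition flow (t : R) (w : T) : R := limn (fun k => flowk k t w).

Definition err1 (L : R) k := rate L (dy R k * C) + dy R k * C.

Lemma err1_cvg0 L : err1 L @ \oo --> 0.
Proof.
have h : (fun k => dy R k * C) @ \oo --> 0.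
  by rewrite -(mul0r C); apply: cvgM; [exact: dy_cvg0|exact: cvg_cst].
by rewrite -[X in _ --> X]addr0; apply: cvgD => //; exact: rate_cvg0.
Qed.

Let dy0 k : 0 <= dy R k. Proof. exact/ltW/dy_gt0. Qed.

Lemma truncn_dy (t L : R) k : 0 <= L -> t <= L ->
  (Num.truncn ((2 ^ k)%:R * t))%:R * dy R k <= L.
Proof.
move=> L0 tL; have dk : (2 ^ k)%:R * dy R k = 1.
  by rewrite -[k in dy R k]add0n dyD /dy expr0.
have [t0|t0] := leP 0 t.
  have x0 : 0 <= (2 ^ k)%:R * t by rewrite mulr_ge0.
  have /andP[h _] := truncn_itv x0.
  apply: le_trans tL; apply: (@le_trans _ _ ((2 ^ k)%:R * t * dy R k)).
    by rewrite ler_wpM2r.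
  by rewrite mulrAC dk mul1r.
have -> : Num.truncn ((2 ^ k)%:R * t) = 0%N; last by rewrite mul0r.
apply/truncn0Pn; rewrite -ltNge (le_lt_trans _ ltr01)//.
by rewrite mulr_ge0_le0// ltW.
Qed.

Lemma flowk_refine L t k l w : 0 <= L -> t <= L ->
  `|flowk k t w - flowk (k + l) t w| <= err1 L k.
Proof.
move=> L0 tL; rewrite /flowk.
have -> : Num.truncn ((2 ^ k)%:R * t) =
    (Num.truncn ((2 ^ (k + l))%:R * t) %/ 2 ^ l)%N.
  rewrite -(@truncn_div _ ((2 ^ k)%:R * t) (2 ^ l)) ?expn_gt0//.
  by rewrite mulrA -natrM -expnD addnC.
by apply: euler_refine => //; exact: truncn_dy.
Qed.

Lemma flowk_cvg t w : flowk k t w @[k --> \oo] --> flow t w.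
Proof.
pose L := Num.max t 0.
have L0 : 0 <= L by rewrite le_max lexx orbT.
have tL : t <= L by rewrite le_max lexx.
suff : cvgn (fun k => flowk k t w) by [].
apply/cauchy_cvgP/cauchy_exP => e e0.
have /cvgrPdist_lt/(_ e e0)[K _ hK] := err1_cvg0 L.
exists (flowk K t w); exists K => // n /= Kn; rewrite /ball/=.
rewrite -(subnKC Kn) (le_lt_trans (flowk_refine _ _ _ L0 tL))//.
have := hK K (leqnn K); rewrite sub0r normrN; apply: le_lt_trans.
exact: ler_norm.
Qed.

Lemma flow_err L t k w : 0 <= L -> t <= L ->
  `|flowk k t w - flow t w| <= err1 L k.
Proof.
move=> L0 tL.
have h : `|flowk k t w - flowk n t w| @[n --> \oo] --> `|flowk k t w - flow t w|.
  by apply: cvg_norm; apply: cvgB; [exact: cvg_cst|exact: flowk_cvg].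
apply: (closed_cvg (fun x => x <= err1 L k)) h; first exact: closed_le.
exists k => // n /= kn; rewrite -(subnKC kn); exact: flowk_refine.
Qed.

(** [Num.truncn] is 0 below 1, so for t <= 0 all schemes are still at their start. The flow is
    thereby defined, and Lipschitz, on the whole line. *)
Lemma flow0 t w : t <= 0 -> flow t w = Z w.
Proof.
move=> t0; apply: cvg_lim => //; rewrite (_ : (fun k => _) = fun=> Z w); first exact: cvg_cst.
apply/funext => k; rewrite /flowk.
have -> // : Num.truncn ((2 ^ k)%:R * t) = 0%N.
apply/truncn0Pn; rewrite -ltNge (le_lt_trans _ ltr01)//.
by rewrite mulr_ge0_le0.
Qed.

(** Schemes are sampled at the last grid time, so between s and t they make at most one step more
    than (t - s) / [dy k]; this excess vanishes in the limit. *)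
Lemma flow_lipschitz s t w : `|flow s w - flow t w| <= C * `|s - t|.
Proof.
wlog st : s t / s <= t => [h|].
  by have [st|ts] := leP s t; [exact: h|rewrite distrC (distrC s t) h// ltW].
have mZ : measurable_fun setT Z by have [] := bZ.
have [t0|t0] := leP t 0.
  by rewrite !flow0 ?(le_trans st)// subrr normr0 mulr_ge0.
wlog s0 : s st / 0 <= s => [h|].
  have [s0|s0] := leP 0 s; first exact: h.
  rewrite (flow0 w (ltW s0)) -(flow0 w (lexx 0)).
  rewrite (le_trans (h 0 (ltW t0) (lexx _)))// ler_wpM2l//.
  by rewrite !(distrC _ t) !ger0_norm ?subr_ge0//; lra.
have h : `|flowk k s w - flowk k t w| @[k --> \oo] --> `|flow s w - flow t w|.
  by apply: cvg_norm; apply: cvgB; exact: flowk_cvg.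
have g : (fun k => C * `|s - t| + C * dy R k) @ \oo --> C * `|s - t| + C * 0.
  apply: cvgD; first exact: cvg_cst.
  by apply: cvgM; [exact: cvg_cst|exact: dy_cvg0].
rewrite [leRHS](_ : _ = C * `|s - t| + C * 0); last by rewrite mulr0 addr0.
apply: (ler_cvg_to h g); apply: nearW => k.
rewrite distrC /flowk /eulerT.
have dk : (2 ^ k)%:R * dy R k = 1.
  by rewrite -[k in dy R k]add0n dyD /dy expr0.
have p0 : 0 <= (2 ^ k)%:R :> R by [].
have le_n : (Num.truncn ((2 ^ k)%:R * s) <= Num.truncn ((2 ^ k)%:R * t))%N.
  by apply: le_truncn; rewrite ler_wpM2l.
have /andP[a1 a2] := truncn_itv (mulr_ge0 p0 s0).
have /andP[b1 b2] := truncn_itv (mulr_ge0 p0 (ltW t0)).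
move: le_n a1 a2 b1 b2; set n := Num.truncn _; set m := Num.truncn _ => nm a1 a2 b1 b2.
apply: (@le_trans _ _ ((m - n)%:R * (dy R k * C))).
  by have := euler_dist P mal n (m - n) (Z w) mZ (dy0 k) (alM w); rewrite subnKC.
rewrite natrB// distrC ger0_norm ?subr_ge0// mulrA [leLHS]mulrC -mulrDr ler_wpM2l//.
apply: (@le_trans _ _ (((2 ^ k)%:R * t - ((2 ^ k)%:R * s - 1)) * dy R k)).
  by rewrite ler_wpM2r// lerB// lerBlDr natr1 ltW.
rewrite [leLHS](_ : _ = (2 ^ k)%:R * dy R k * (t - s) + dy R k).
  by rewrite dk mul1r.
by move: (2 ^ k)%:R (dy R k) => p q; ring.
Qed.

(** The number of steps depends on u through t, so the preimage is cut into the countably many sets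
    on which this number is constant. *)
Lemma measurable_flow d' (U : measurableType d') (t : U -> R) (w : U -> T) :
  measurable_fun setT t -> measurable_fun setT w ->
  measurable_fun setT (fun u => flow (t u) (w u)).
Proof.
move=> mt mw.
apply: (measurable_fun_cvg (h := fun k u => flowk k (t u) (w u))) => [k|u _]; last first.
  exact: flowk_cvg.
move=> _ B mB; rewrite setTI.
pose N u := Num.truncn ((2 ^ k)%:R * t u).
rewrite (_ : _ @^-1` B = \bigcup_n ((N @^-1` [set n]) `&`
   ((fun u => eulerT Z (dy R k) n (w u)) @^-1` B))); last first.
  by apply/seteqP; split=> [u Bu|u [n _ []] /= <-//]; exists (N u).
apply: bigcupT_measurable => n; apply: measurableI; last first.
  rewrite -[X in measurable X]setTI.
  suff : measurable_fun setT (fun u => eulerT Z (dy R k) n (w u)) by exact.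
  apply: measurableT_comp => //; apply: measurable_eulerT => //.
  by have [] := bZ.
have h m : measurable [set u | m%:R <= (2 ^ k)%:R * t u].
  have mf : measurable_fun setT (fun u => (2 ^ k)%:R * t u).
    by apply: measurable_funM.
  have := mf measurableT _ (measurable_itv `[m%:R, +oo[).
  by rewrite setTI; congr measurable; apply/seteqP; split=> u /=; rewrite in_itv/= andbT.
rewrite (_ : N @^-1` [set n] = (if n is 0%N then setT else
  [set u | n%:R <= (2 ^ k)%:R * t u]) `\` [set u | n.+1%:R <= (2 ^ k)%:R * t u]).
  by apply: measurableD => //; case: n.
apply/seteqP; split => u /=; rewrite -truncn_gt_nat -/(N u).
  move=> Nn; split; last by rewrite -Nn ltnn.
  by case: n Nn => //= n Nn; rewrite -truncn_gt_nat -/(N u) Nn.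
move=> [h1 /negP]; rewrite -leqNgt => h2; apply/eqP; rewrite eqn_leq h2/=.
by case: n h1 {h2} => //= n; rewrite -truncn_gt_nat.
Qed.

Lemma bmeas_flow t : bmeas (flow t).
Proof.
split; first by apply: (@measurable_flow _ _ (fun=> t) id).
have [_ [N hN]] := bZ; exists (C * `|t| + N) => w.
rewrite -(subrK (Z w) (flow t w)) (le_trans (ler_normD _ _))// lerD//.
by rewrite -(flow0 w (lexx 0)) (le_trans (flow_lipschitz _ _ _))// subr0.
Qed.

Definition err2 (L : R) k := rate L (err1 L k + dy R k) + err1 L k.

Lemma err2_cvg0 L : err2 L @ \oo --> 0.
Proof.
have h : (fun k => err1 L k + dy R k) @ \oo --> 0.
  by rewrite -[X in _ --> X]addr0; apply: cvgD; [exact: err1_cvg0|exact: dy_cvg0].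
rewrite -[X in _ --> X]addr0; apply: cvgD; last exact: err1_cvg0.
exact: rate_cvg0.
Qed.

(** After its first [j] steps, the scheme issued from [Z] is again a scheme of step [dy k], with a
    start within [err1 L k] of [flow t]; [comparison] sets it against the scheme restarted exactly
    at [flow t]. *)
Lemma flow_semigroup t L m k w : 0 <= t -> t + dy R m <= L -> (m <= k)%N ->
  `|eulerT (flow t) (dy R k) (2 ^ (k - m)) w - flow (t + dy R m) w| <= err2 L k.
Proof.
move=> t0 tL mk; pose j := Num.truncn ((2 ^ k)%:R * t).
have L0 : 0 <= L by rewrite (le_trans _ tL)// addr_ge0.
have tL' : t <= L by rewrite (le_trans _ tL)// lerDl.
have nE : (2 ^ (k - m))%:R * dy R k = dy R m by rewrite -{2}(subnKC mk) dyD.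
have e10 : 0 <= err1 L k by exact: le_trans (flow_err k point L0 tL').
have d1 : `|eulerT Z (dy R k) (j + 2 ^ (k - m)) w -
    eulerT (flow t) (dy R k) (2 ^ (k - m)) w| <= rate L (err1 L k + dy R k).
  apply: (@comparison _ _ _ P al (fun i => eulerT Z (dy R k) (j + i))
    (fun i => eulerT Z (dy R k) (j + i)) (eulerT (flow t) (dy R k))
    (eulerT (flow t) (dy R k)) (dy R k) _ _ (2 ^ (k - m))) => //.
  - by move=> i; exact: (bmeas_eulerT _ mal alM).
  - by move=> i; exact: (bmeas_eulerT _ mal alM).
  - by move=> i; apply: (bmeas_eulerT _ mal alM) => //; exact: bmeas_flow.
  - by move=> i; apply: (bmeas_eulerT _ mal alM) => //; exact: bmeas_flow.
  - exact: dy_gt0.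
  - by rewrite lerDr.
  - by rewrite nE (le_trans _ tL)// lerDr.
  - by move=> i u; rewrite addnS eulerTS.
  - by move=> i u; rewrite subrr normr0 addr_ge0.
  - by move=> i u; rewrite subrr normr0 addr_ge0.
  - move=> u; rewrite addn0 (le_trans (flow_err k u L0 tL'))//.
    by rewrite lerDl.
(* As m <= k, adding [dy m] to the time shifts the index on the grid of level k by exactly
   [2 ^ (k - m)]. *)
have e2 : eulerT Z (dy R k) (j + 2 ^ (k - m)) w = flowk k (t + dy R m) w.
  rewrite /flowk; congr (eulerT _ _ _ _).
  rewrite mulrDr -[in RHS]nE mulrCA -[k in dy R k]add0n dyD /dy expr0 mulr1.
  by rewrite truncn_addn// mulr_ge0.
rewrite -[X in `|X - _|](subrK (flowk k (t + dy R m) w)) -addrA.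
rewrite (le_trans (ler_normD _ _))// lerD ?flow_err//.
by rewrite distrC -e2.
Qed.

End flow.

(** * The velocity field *)

Section velocity.
Context d (T : measurableType d) (R : realType) (P : probability T R).
Variables (al Z : T -> R) (M : R).
Hypotheses (mal : measurable_fun setT al) (alM : forall w, `|al w| <= M).
Hypotheses (bZ : bmeas Z) (M0 : 0 <= M).
Local Notation C := (1 + M).
Local Notation eulerT := (eulerT P al).
Local Notation euler := (euler P al).
Local Notation flow := (flow P al Z).

Variable S : R.
Hypothesis S0 : 0 <= S.

Let dy0 k : 0 <= dy R k. Proof. exact/ltW/dy_gt0. Qed.
Let C0 : 0 <= C. Proof. by rewrite addr_ge0. Qed.

(** The error must stay small after division by the duration [dy m] of the restart, hence the
    square. The horizon is S + 1 because t <= S and [dy m] <= 1. *)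
Lemma fine_mesh_exists : exists kappa : nat -> nat, forall m,
  (m <= kappa m)%N /\ err2 M (S + 1) (kappa m) <= dy R m * dy R m.
Proof.
suff /choice[f hf] : forall m, exists k, (m <= k)%N /\ err2 M (S + 1) k <= dy R m * dy R m.
  by exists f.
move=> m; have /cvgrPdist_le := @err2_cvg0 R M (S + 1).
have d0 : 0 < dy R m * dy R m by rewrite mulr_gt0 ?dy_gt0.
move=> /(_ _ d0)[N _ hN]; exists (m + N)%N; rewrite leq_addr; split => //.
have := hN (m + N)%N (leq_addl _ _); rewrite sub0r normrN; apply: le_trans.
exact: ler_norm.
Qed.

(** The choice depends on [M] and [S] only, not on the law, so quotients computed on two probability
    spaces use the same mesh. *)
Definition fine_mesh : nat -> nat := sval (cid fine_mesh_exists).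

Lemma fine_meshP m : (m <= fine_mesh m)%N /\
  err2 M (S + 1) (fine_mesh m) <= dy R m * dy R m.
Proof. by rewrite /fine_mesh; case: cid. Qed.

(* Difference quotient, over the time [dy m], of the scheme restarted at time
   [t]; it depends on the particle through [(y, b)] only. *)
Definition quot (m : nat) (t y b : R) : R := (dy R m)^-1 *
  (euler (flow t) (dy R (fine_mesh m)) (2 ^ (fine_mesh m - m)) y b - y).

Definition vel (t y b : R) : R := limn_sup (fun m => quot m t y b).

Lemma fine_mesh_dy m :
  (2 ^ (fine_mesh m - m))%:R * dy R (fine_mesh m) = dy R m.
Proof. by rewrite -{2}(subnKC (fine_meshP m).1) dyD. Qed.

Let mflow t : measurable_fun setT (flow t).
Proof. by have [] := bmeas_flow P mal alM bZ M0 t. Qed.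

Lemma quot_le m t y b : `|b| <= M -> `|quot m t y b| <= C.
Proof.
move=> bM; rewrite /quot normrM normfV (ger0_norm (dy0 m)) mulrC ler_pdivrMr ?dy_gt0//.
rewrite (le_trans (euler_dist0 P mal _ _ _ _ bM))//.
by rewrite mulrA fine_mesh_dy mulrC.
Qed.

Lemma quot_bounded t y b : `|b| <= M -> bounded_fun (fun m => quot m t y b).
Proof.
move=> bM; exists C; split; first exact: num_real.
by move=> N CN m _ /=; rewrite (le_trans (quot_le _ _ _ bM))// ltW.
Qed.

Lemma vel_le t y b : `|b| <= M -> `|vel t y b| <= C.
Proof.
move=> bM; rewrite ler_norml; apply: limn_sup_bounds; first exact: quot_bounded.
move=> e e0; apply: nearW => m.
by have := quot_le m t y bM; rewrite ler_norml => /andP[]; lra.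
Qed.

Lemma measurable_quot d' (U : measurableType d') (t y b : U -> R) m :
  measurable_fun setT t -> measurable_fun setT y -> measurable_fun setT b ->
  measurable_fun setT (fun u => quot m (t u) (y u) (b u)).
Proof.
move=> mt my mb; apply: measurable_funM => //; apply: measurable_funB => //.
apply: (@measurable_euler _ _ _ P _ mal _ _ _ _ (fun z => flow (t z.1) z.2)) => //.
apply: measurable_flow => //.
by apply: measurableT_comp => //; exact: measurable_fst.
Qed.

Lemma measurable_vel d' (U : measurableType d') (t y b : U -> R) :
  measurable_fun setT t -> measurable_fun setT y -> measurable_fun setT b ->
  (forall u, `|b u| <= M) ->
  measurable_fun setT (fun u => vel (t u) (y u) (b u)).
Proof.
move=> mt my mb bM.
apply: (measurable_fun_limn_sup (h := fun m u => quot m (t u) (y u) (b u))) => [u _|u _|m].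
- exact/bounded_fun_has_ubound/quot_bounded.
- exact/bounded_fun_has_lbound/quot_bounded.
- exact: measurable_quot.
Qed.

Lemma quot_flow t m w : 0 <= t -> t <= S ->
  `|quot m t (flow t w) (al w) - (dy R m)^-1 * (flow (t + dy R m) w - flow t w)| <= dy R m.
Proof.
move=> t0 tS; rewrite /quot -mulrBr opprB addrA subrK normrM normfV (ger0_norm (dy0 m)).
rewrite mulrC ler_pdivrMr ?dy_gt0//.
have [mk kE] := fine_meshP m; apply: le_trans kE.
apply: flow_semigroup => //.
by rewrite lerD// dy_le1.
Qed.

Lemma vel_flow t w g : 0 <= t -> t <= S ->
  (fun m => (dy R m)^-1 * (flow (t + dy R m) w - flow t w)) @ \oo --> g ->
  (fun m => quot m t (flow t w) (al w)) @ \oo --> g /\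
  vel t (flow t w) (al w) = g.
Proof.
move=> t0 tS hg.
pose u m := quot m t (flow t w) (al w).
pose v m := (dy R m)^-1 * (flow (t + dy R m) w - flow t w).
have h : u @ \oo --> g.
  have h0 : (u \- v) @ \oo --> 0.
    apply/norm_cvg0P; apply: (@squeeze_cvgr _ _ _ _ (fun=> 0) (dy R)).
    - by apply: nearW => m; rewrite normr_ge0 quot_flow.
    - exact: cvg_cst.
    - exact: dy_cvg0.
  have -> : u = (u \- v) \+ v by apply/funext => m; rewrite /= subrK.
  by rewrite -[g]add0r; exact: cvgD h0 hg.
by split => //; have [_ hl] := cvg_limn_inf_sup h; exact: hl.
Qed.

Let dyc_cvg (c : R) : (fun m => c * dy R m) @ \oo --> 0.
Proof.
by rewrite -(mulr0 c); apply: cvgM; [exact: cvg_cst|exact: dy_cvg0].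
Qed.

Let P_fin (A : set T) : measurable A -> (fine (P A))%:E = P A.
Proof. by move=> mA; rewrite fineK// fin_num_measure. Qed.

Lemma probability_cvg_le (W : T -> R) (y c e : R) : measurable_fun setT W ->
  0 <= c -> 0 < e -> \forall m \near \oo,
    fine (P [set w | W w <= y + c * dy R m]) <= fine (P [set w | W w <= y]) + e.
Proof.
move=> mW c0 e0.
have mA (r : R) : measurable [set w | W w <= r].
  by rewrite -[X in measurable X]setTI; exact: measurable_fun_ler.
pose F m := [set w | W w <= y + c * dy R m].
have capF : \bigcap_m F m = [set w | W w <= y].
  apply/seteqP; split => w /=; last first.
    by move=> h m _; rewrite /F/= (le_trans h)// lerDl mulr_ge0.
  move=> h; have g : (fun m => y + c * dy R m) @ \oo --> y.
    by rewrite -[X in _ --> X]addr0; apply: cvgD; [exact: cvg_cst|exact: dyc_cvg].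
  by apply: (ler_cvg_to (@cvg_cst _ (W w) _ \oo _) g); apply: nearW => m; exact: h.
have : P \o F @ \oo --> P (\bigcap_m F m).
  apply: nonincreasing_cvg_mu => //.
  - by rewrite (le_lt_trans (probability_le1 P (mA _)))// ltry.
  - by move=> i; exact: mA.
  - by rewrite capF.
  - move=> m n mn; apply/subsetPset => w; rewrite /F/= => /le_trans; apply.
    by rewrite lerD2l ler_wpM2l// dy_le.
rewrite capF -P_fin// => /fine_cvg /cvgrPdist_le /(_ e e0).
by apply: filterS => m /=; rewrite ler_distlC => /andP[_].
Qed.

Lemma probability_cvg_lt (W : T -> R) (y c e : R) : measurable_fun setT W ->
  0 <= c -> 0 < e -> \forall m \near \oo,
    fine (P [set w | W w < y]) - e <= fine (P [set w | W w < y - c * dy R m]).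
Proof.
move=> mW c0 e0.
have mA (r : R) : measurable [set w | W w < r].
  by rewrite -[X in measurable X]setTI; exact: measurable_fun_ltr.
pose F m := [set w | W w < y - c * dy R m].
have cupF : \bigcup_m F m = [set w | W w < y].
  apply/seteqP; split => w /=.
    by move=> [m _]; rewrite /F/= => /lt_le_trans; apply; rewrite gerBl mulr_ge0.
  rewrite -subr_gt0 => h.
  have /cvgrPdist_lt/(_ _ h)[N _ hN] := dyc_cvg c.
  exists N => //; rewrite /F/=; have := hN N (leqnn N).
  by rewrite /= sub0r normrN => /(le_lt_trans (ler_norm _)); lra.
have : P \o F @ \oo --> P (\bigcup_m F m).
  apply: nondecreasing_cvg_mu => //.
  - by move=> i; exact: mA.
  - by rewrite cupF.
  - move=> m n mn; apply/subsetPset => w; rewrite /F/= => /lt_le_trans; apply.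
    by rewrite lerD2l lerN2 ler_wpM2l// dy_le.
rewrite cupF -P_fin// => /fine_cvg /cvgrPdist_le /(_ e e0).
by apply: filterS => m /=; rewrite ler_distlC => /andP[].
Qed.

(** Both u and W' are displaced by at most r, so [hstep (u - W' w)] is 1 where W < y - 2r and 0
    where W > y + 2r. *)
Lemma field_le_cdf (W W' : T -> R) (u y r : R) : measurable_fun setT W ->
  measurable_fun setT W' -> (forall w, `|W' w - W w| <= r) -> `|u - y| <= r ->
  fine (P [set w | W w < y - 2 * r]) <= field P W' u <=
  fine (P [set w | W w <= y + 2 * r]).
Proof.
move=> mW mW' WW' uy.
have m1 : measurable [set w | W w < y - 2 * r].
  by rewrite -[X in measurable X]setTI; exact: measurable_fun_ltr.
have m2 : measurable [set w | W w <= y + 2 * r].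
  by rewrite -[X in measurable X]setTI; exact: measurable_fun_ler.
have EI (A : set T) : measurable A -> fine (P A) = Rintegral P setT (\1_A).
  by move=> mA; rewrite /Rintegral integral_indic// setIT.
have bI (A : set T) : measurable A -> bmeas (\1_A : T -> R).
  move=> mA; split; first exact: measurable_indic.
  by exists 1 => x; rewrite indicE; case: (_ \in _); rewrite ?normr1 ?normr0.
have bW : bmeas (fun w => hstep (u - W' w)) by exact: bmeas_field_integrand.
rewrite !EI//; apply/andP; split; apply: E_le => //; try exact: bI.
- move=> w; rewrite indicE; case: (boolP (w \in _)) => [/set_mem/= h|_]; last exact: hstep_ge0.
  rewrite /hstep ifT// subr_gt0.
  by have := WW' w; move: uy; rewrite !ler_norml; lra.
- move=> w; rewrite indicE; case: (boolP (w \in _)) => [_|]; first exact: hstep_le1.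
  rewrite notin_setE/= => /negP; rewrite -ltNge => h.
  have h' : u - W' w < 0 by have := WW' w; move: uy; rewrite !ler_norml; lra.
  by rewrite /hstep ltNge (ltW h') /= lt_eqF.
Qed.

(** During a time [dy m] neither the tested particle nor those generating the field move by more
    than [C * dy m]. Every substep therefore sees a field between the masses to the left of y - 2C
    [dy m] and of y + 2C [dy m]. *)
Lemma quot_cdf m t y b : `|b| <= M ->
  b - fine (P [set w | flow t w <= y + 2 * C * dy R m]) <= quot m t y b <=
  b - fine (P [set w | flow t w < y - 2 * C * dy R m]).
Proof.
move=> bM; rewrite /quot.
move: (2 ^ (fine_mesh m - m))%N (fine_mesh_dy m) (dy0 (fine_mesh m)).
move: (dy R (fine_mesh m)) => hk K hKm hk0.
set F := fine _; set G := fine _; pose z n := euler (flow t) hk n y b.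
have mz n : measurable_fun setT (eulerT (flow t) hk n) by exact: measurable_eulerT.
have H n : (n <= K)%N -> n%:R * hk * (b - F) <= z n - y <= n%:R * hk * (b - G).
  elim: n => [|n ih nk]; first by rewrite !mul0r /z /= subrr lexx.
  have nr : n%:R * (hk * C) <= C * dy R m.
    rewrite mulrA [leRHS]mulrC -hKm; apply: ler_wpM2r => //.
    by apply: ler_wpM2r => //; rewrite ler_nat ltnW.
  have /andP[h1 h2] : G <= field P (eulerT (flow t) hk n) (z n) <= F.
    rewrite /F /G -!(mulrA 2); apply: field_le_cdf => //.
      by move=> w; apply: le_trans nr; exact: euler_dist0.
    by apply: le_trans nr; exact: euler_dist0.
  have /andP[i1 i2] := ih (ltnW nk).
  have -> : z n.+1 - y = (z n - y) - hk * (field P (eulerT (flow t) hk n) (z n) - b).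
    by rewrite {1}/z eulerS -/(z n) [RHS]addrAC.
  rewrite -natr1 !mulrDl !mul1r -mulrN opprB.
  by apply/andP; split; apply: lerD => //; rewrite ler_wpM2l// lerB.
have := H _ (leqnn _); rewrite hKm -/(z K) => /andP[h1 h2].
by rewrite mulrC ler_pdivlMr ?dy_gt0// ler_pdivrMr ?dy_gt0// !(mulrC (b - _)) h1 h2.
Qed.

(** As m grows, the closed half-lines shrink to W <= y and the open ones increase to W < y; this is
    where the two ends, with and without the atom at y, come from. *)
Lemma vel_cdf t y b : `|b| <= M ->
  b - fine (P [set w | flow t w <= y]) <= vel t y b <=
  b - fine (P [set w | flow t w < y]).
Proof.
move=> bM; apply: limn_sup_bounds; first exact: quot_bounded.
have C20 : 0 <= 2 * C by rewrite mulr_ge0.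
move=> e e0.
have h1 := probability_cvg_le y (mflow t) C20 e0.
have h2 := probability_cvg_lt y (mflow t) C20 e0.
near=> m; have /andP[q1 q2] := quot_cdf m t y bM.
have g1 : fine (P [set w | flow t w <= y + 2 * C * dy R m]) <=
    fine (P [set w | flow t w <= y]) + e by near: m.
have g2 : fine (P [set w | flow t w < y]) - e <=
    fine (P [set w | flow t w < y - 2 * C * dy R m]) by near: m.
apply/andP; split.
  by apply: le_trans q1; rewrite -addrA -opprD lerB.
by apply: (le_trans q2); rewrite -addrA lerD2l lerNl opprD opprK.
Unshelve. all: by end_near. Qed.

End velocity.

(** * The energy in Lagrangian coordinates *)

Section set_function_integral.
Import HBNNSimple.

(** Mixtures and pushforwards are bare set functions, known to agree with measures on measurable
    sets only. This is enough, as the integral is built from measurable simple functions. *)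
Lemma eq_set_integral d (T : measurableType d) (R : realType)
    (m1 m2 : set T -> \bar R) (D : set T) (f : T -> \bar R) :
  (forall A, measurable A -> m1 A = m2 A) ->
  (\int[m1]_(x in D) f x = \int[m2]_(x in D) f x)%E.
Proof.
move=> m12; rewrite /integral.
have e (h : {nnsfun T >-> R}) : sintegral m1 h = sintegral m2 h.
  by apply: eq_fsbigr => x _; rewrite m12.
by congr (ereal_sup _ - ereal_sup _)%E; apply/seteqP; split => _ [h hf <-];
  exists h.
Qed.

End set_function_integral.

Section change_of_law.
Context d d' d'' (T : measurableType d) (U : measurableType d')
  (V : measurableType d'') (R : realType).
Variables (P : probability T R) (Q : probability U R) (f : T -> V) (g : U -> V).
Hypotheses (mf : measurable_fun setT f) (mg : measurable_fun setT g).
Hypothesis fg : forall B, measurable B -> P (f @^-1` B) = Q (g @^-1` B).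

Lemma E_law (phi : V -> R) : bmeas phi ->
  Rintegral P setT (fun w => phi (f w)) = Rintegral Q setT (fun w => phi (g w)).
Proof.
move=> bphi; have mphi : measurable_fun setT (EFin \o phi).
  by apply/measurable_EFinP; have [] := bphi.
rewrite /Rintegral; congr fine.
transitivity (\int[pushforward P f]_y (phi y)%:E)%E.
  rewrite (integral_pushforward mf mphi)//.
  by apply: bmeas_integrable; exact: bmeas_comp.
rewrite (eq_set_integral (m2 := pushforward Q g))//.
rewrite (integral_pushforward mg mphi)//.
by apply: bmeas_integrable; exact: bmeas_comp.
Qed.

End change_of_law.

Lemma E_cvg d (T : measurableType d) (R : realType) (P : probability T R)
    (f_ : nat -> T -> R) (f : T -> R) (K : R) :
  (forall n, bmeas (f_ n)) -> bmeas f -> (forall n x, `|f_ n x| <= K) ->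
  {ae P, forall x, f_ ^~ x @ \oo --> f x} ->
  (fun n => Rintegral P setT (f_ n)) @ \oo --> Rintegral P setT f.
Proof.
move=> bf_ bf fK cf.
have [|||||_ _] := @dominated_convergence _ _ _ P setT measurableT
  (fun n => EFin \o f_ n) (EFin \o f) (EFin \o cst K).
- by move=> n; apply/measurable_EFinP; have [] := bf_ n.
- by apply/measurable_EFinP; have [] := bf.
- apply: filterS cf => x cfx _; exact: cvg_EFin (nearW _ _) cfx.
- by apply: bmeas_integrable; exact: bmeas_cst.
- by apply: aeW => x n _; rewrite lee_fin.
by rewrite -EFin_E// => /fine_cvg; apply: cvg_trans.
Qed.

Section energy.
Context d (T : measurableType d) (R : realType) (P : probability T R).
Variables (b : T -> R) (M : R).
Hypotheses (mb : measurable_fun setT b) (bM : forall w, `|b w| <= M).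
Local Notation E f := (Rintegral P setT f).
Local Notation C := (1 + M).
Implicit Types Y Z : T -> R.

Let bb : bmeas b. Proof. by split => //; exists M. Qed.

Let M0 : 0 <= M. Proof. by rewrite (le_trans _ (bM point)). Qed.

Definition energy Y : R :=
  4^-1 * E (fun w => E (fun w' => `|Y w - Y w'|)) + E (fun w => (2^-1 - b w) * Y w).

Let bfst Y : bmeas Y -> bmeas (fun z : T * T => Y z.1).
Proof. by move=> bY; apply: bmeas_comp => //; exact: measurable_fst. Qed.

Let bsnd Y : bmeas Y -> bmeas (fun z : T * T => Y z.2).
Proof. by move=> bY; apply: bmeas_comp => //; exact: measurable_snd. Qed.

(** Apply [hstep_subgradient] to the differences of two labels and integrate. By antisymmetry of
    [K], the left side becomes twice the mean of (2F - 1)(Z - Y), where F is the field; after the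
    factor 1/4 this is (F - 1/2)(Z - Y), and the linear term 1/2 - b turns F - 1/2 into F - b. *)
Lemma energy_subgradient Y Z : bmeas Y -> bmeas Z ->
  E (fun w => (field P Y (Y w) - b w) * (Z w - Y w)) <= energy Z - energy Y.
Proof.
move=> bY bZ; have [mY _] := bY.
pose dZ (z : T * T) := `|Z z.1 - Z z.2|.
pose dY (z : T * T) := `|Y z.1 - Y z.2|.
pose K (z : T * T) := 2 * hstep (Y z.1 - Y z.2) - 1.
have b1 (W : T -> R) : bmeas W -> bmeas (fun z : T * T => W z.1 - W z.2).
  by move=> bW; exact: (bmeasB (bfst bW) (bsnd bW)).
have bdZ : bmeas dZ by apply: bmeas_norm; exact: b1.
have bdY : bmeas dY by apply: bmeas_norm; exact: b1.
have bK : bmeas K.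
  apply: bmeasB; last exact: bmeas_cst.
  apply: bmeasM; first exact: bmeas_cst.
  by apply: bmeas_hstep; have [] := b1 _ bY.
pose u w := Z w - Y w.
have bu : bmeas u by exact: bmeasB.
pose f (z : T * T) := K z * u z.1.
pose g (z : T * T) := K z * u z.2.
have bf : bmeas f by apply: bmeasM => //; exact: (bfst bu).
have bg : bmeas g by apply: bmeasM => //; exact: (bsnd bu).
pose EE h := E (fun w => E (fun w' => h (w, w'))).
have EEB h k : bmeas h -> bmeas k -> EE (fun z => h z - k z) = EE h - EE k.
  move=> bh bk; rewrite /EE -E_B; [|exact: bmeas_E..].
  by apply: eq_Rintegral => w _; rewrite E_B//; exact: bmeas_xsec.
have EEle h k : bmeas h -> bmeas k -> (forall z, h z <= k z) -> EE h <= EE k.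
  move=> bh bk hk; apply: E_le => [||w]; [exact: bmeas_E..|].
  by apply: E_le => //; exact: bmeas_xsec.
have gE : EE g = - EE f.
  rewrite /EE (E_swap P P bg) -E_N; last exact: bmeas_E.
  apply: eq_Rintegral => w _; rewrite -E_N; last exact: bmeas_xsec.
  apply: eq_Rintegral => w' _; rewrite /g /f /K /=.
  by rewrite -(opprB (Y w)) hstepN; ring.
have fE : EE f = E (fun w => (2 * field P Y (Y w) - 1) * u w).
  apply: eq_Rintegral => w _; rewrite /f/= E_Zr; last exact: (bmeas_xsec bK).
  congr (_ * _); rewrite /K/= E_B; [|by apply: bmeasM; [exact: bmeas_cst|exact: bmeas_field_integrand]|exact: bmeas_cst].
  by rewrite E_cst E_Zl//; exact: bmeas_field_integrand.
have le1 : EE f - EE g <= EE dZ - EE dY.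
  rewrite -!EEB//; apply: EEle; [exact: bmeasB..|] => z.
  rewrite /f /g /dZ /dY -mulrBr.
  have := hstep_subgradient (Y z.1 - Y z.2) (Z z.1 - Z z.2).
  by congr (_ <= _); rewrite /K /u; ring.
have bfu : bmeas (fun w => field P Y (Y w)) by exact: bmeas_field.
have bbu : bmeas (fun w => (2^-1 - b w) * u w).
  by apply: bmeasM => //; apply: bmeasB => //; exact: bmeas_cst.
have lhsE : E (fun w => (field P Y (Y w) - b w) * (Z w - Y w)) =
    2^-1 * EE f + E (fun w => (2^-1 - b w) * u w).
  rewrite fE -E_Zl; last by apply: bmeasM => //; apply: bmeasB; [apply: bmeasM => //|]; exact: bmeas_cst.
  rewrite -E_D//.
    by apply: eq_Rintegral => w _; rewrite /u; field.
  apply: bmeasM; first exact: bmeas_cst.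
  by apply: bmeasM => //; apply: bmeasB; [apply: bmeasM => //|]; exact: bmeas_cst.
have bEZ : E (fun w => (2^-1 - b w) * Z w) - E (fun w => (2^-1 - b w) * Y w) =
    E (fun w => (2^-1 - b w) * u w).
  rewrite -E_B; first by apply: eq_Rintegral => w _; rewrite /u; ring.
    by apply: bmeasM => //; apply: bmeasB => //; exact: bmeas_cst.
  by apply: bmeasM => //; apply: bmeasB => //; exact: bmeas_cst.
rewrite lhsE /energy.
rewrite (_ : _ + _ - _ = 4^-1 * (EE dZ - EE dY) + (E (fun w => (2^-1 - b w) * Z w) -
  E (fun w => (2^-1 - b w) * Y w))); last first.
  by rewrite /EE mulrBr opprD addrACA.
rewrite bEZ lerD2r; move: le1; rewrite gE.
by move: (EE f) (EE dZ) (EE dY) => p q r; lra.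
Qed.

(** Use the subgradient at the endpoint [Z], tested against [Y]: it is bounded by C. *)
Lemma energy_lipschitz Y Z (r : R) : bmeas Y -> bmeas Z ->
  (forall w, `|Z w - Y w| <= r) -> energy Z - energy Y <= C * r.
Proof.
move=> bY bZ ZY; have [mZ _] := bZ.
have := energy_subgradient bZ bY => h.
have bG : bmeas (fun w => field P Z (Z w) - b w).
  by apply: bmeasB => //; exact: bmeas_field.
have bG2 : bmeas (fun w => (field P Z (Z w) - b w) * (Y w - Z w)).
  by apply: bmeasM => //; exact: bmeasB.
rewrite -(opprB (energy Y)) lerNl; apply: le_trans h.
apply: E_ge_cst => // w; rewrite lerNl -mulrN opprB.
apply: (le_trans (ler_norm _)); rewrite normrM ler_pM//.
rewrite (le_trans (ler_normB _ _))// lerD//.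
by rewrite ger0_norm ?field_ge0// field_le1.
Qed.

End energy.

(** * The subgradient inequality for the limit velocity, on any space with the same law *)

Section subdifferential.
Context d (T : measurableType d) (R : realType) (P : probability T R).
Variables (al Z : T -> R) (M : R).
Hypotheses (mal : measurable_fun setT al) (alM : forall w, `|al w| <= M).
Hypotheses (bZ : bmeas Z) (M0 : 0 <= M).
Variable S : R.
Hypothesis S0 : 0 <= S.
Local Notation C := (1 + M).
Local Notation flow := (flow P al Z).
Local Notation quot := (quot P al Z M S).
Local Notation vel := (vel P al Z M S).

Context d' (U : measurableType d') (Q : probability U R).
Variables (y z b : U -> R) (t : R).
Hypotheses (by_ : bmeas y) (bz : bmeas z).
Hypotheses (mb : measurable_fun setT b) (bM : forall u, `|b u| <= M).
Hypothesis law : forall B : set (R * R), measurable B ->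
  P ((fun w => (flow t w, al w)) @^-1` B) = Q ((fun u => (y u, b u)) @^-1` B).

Let my : measurable_fun setT y. Proof. by have [] := by_. Qed.

Let bflow : bmeas (flow t). Proof. exact: bmeas_flow. Qed.

Let mflow : measurable_fun setT (flow t). Proof. by have [] := bflow. Qed.

Let bb : bmeas b. Proof. by split => //; exists M. Qed.

Let C0 : 0 <= C. Proof. by rewrite addr_ge0. Qed.

(** At each step the field is the mean of a function of the pair (position, parameter) at the start,
    so it depends on the law of that pair only; induct on the number of steps. *)
Lemma euler_law s n x c : euler P al (flow t) s n x c = euler Q b y s n x c.
Proof.
elim: n x c => [//|n ih] x c; rewrite !eulerS ih; congr (_ - _ * (_ - _)).
rewrite /field /eulerT.
pose phi (p : R * R) := hstep (euler Q b y s n x c - euler Q b y s n p.1 p.2).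
have bphi : bmeas phi.
  apply: bmeas_hstep; apply: measurable_funB => //.
  apply: (@measurable_euler _ _ _ Q _ mb _ _ _ _ (fun v => y v.2) fst snd).
  - by apply: measurableT_comp => //; exact: measurable_snd.
  - exact: measurable_fst.
  - exact: measurable_snd.
rewrite -(E_law (f := fun w => (flow t w, al w)) (g := fun u => (y u, b u)) _ _ law bphi).
- by apply: eq_Rintegral => w _; rewrite ih.
- exact: measurable_fun_pair.
- exact: measurable_fun_pair.
Qed.

Local Notation En := (energy Q b).
Local Notation E f := (Rintegral Q setT f).

(** Each step is a subgradient at the current position [Y n], while the claim refers to [y]. Since
    [Y n] is within C h of [y], replacing [Y n] by [y] in the test direction costs C^2 h, and in the
    energy C^2 h again. *)
Lemma euler_energy s n h : 0 <= s -> n%:R * s <= h ->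
  E (fun u => (y u - eulerT Q b y s n u) * (z u - y u)) <=
  n%:R * s * (En z - En y + 2 * C ^+ 2 * h).
Proof.
move=> s0; pose Y := eulerT Q b y s.
have bY k : bmeas (Y k) by exact: (bmeas_eulerT _ mb bM).
have bzy : bmeas (fun u => z u - y u) by exact: bmeasB.
elim: n => [|n ih] nh.
  rewrite !mul0r; apply: E_le_cst => [|u]; last by rewrite /eulerT /= subrr mul0r.
  by apply: bmeasM => //; apply: bmeasB => //; exact: (bY 0%N).
have nh' : n%:R * s <= h by apply: le_trans nh; rewrite ler_wpM2r// ler_nat.
have h0 : 0 <= h by apply: le_trans nh'; rewrite mulr_ge0.
have {}ih := ih nh'.
pose f u := field Q (Y n) (Y n u) - b u.
have bf : bmeas f by apply: bmeasB => //; apply: bmeas_field => //; have [] := bY n.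
have fC u : `|f u| <= C.
  rewrite (le_trans (ler_normB _ _))// lerD// ger0_norm ?field_ge0//.
  by rewrite field_le1//; have [] := bY n.
have Yy u : `|Y n u - y u| <= C * h.
  rewrite (le_trans (euler_dist0 Q mb _ _ _ _ (bM u)))// mulrA mulrC.
  by rewrite ler_wpM2l.
rewrite -/(Y _) in ih *.
have -> : E (fun u => (y u - Y n.+1 u) * (z u - y u)) =
    E (fun u => (y u - Y n u) * (z u - y u)) + s * E (fun u => f u * (z u - y u)).
  rewrite -E_Zl; last exact: bmeasM.
  rewrite -E_D.
  - by apply: eq_Rintegral => u _; rewrite {1}/Y eulerTS -/(Y n) -/(f u); ring.
  - by apply: bmeasM => //; exact: bmeasB.
  - by apply: bmeasM; [exact: bmeas_cst|exact: bmeasM].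
have e1 : E (fun u => f u * (z u - y u)) <= En z - En y + 2 * C ^+ 2 * h.
  have -> : E (fun u => f u * (z u - y u)) =
     E (fun u => f u * (z u - Y n u)) + E (fun u => f u * (Y n u - y u)).
    rewrite -E_D; [|by apply: bmeasM => //; exact: bmeasB..].
    by apply: eq_Rintegral => u _; ring.
  have g1 : E (fun u => f u * (z u - Y n u)) <= En z - En (Y n).
    exact: energy_subgradient.
  have g2 : E (fun u => f u * (Y n u - y u)) <= C * (C * h).
    apply: E_le_cst => [|u]; first by apply: bmeasM => //; exact: bmeasB.
    by rewrite (le_trans (ler_norm _))// normrM ler_pM.
  have g3 : En y - En (Y n) <= C * (C * h).
    by apply: (energy_lipschitz _ mb bM) => // u; rewrite distrC.
  move: g1 g2 g3; move: (E _) (E _) (En _) (En _) (En _) => p q r1 r2 r3.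
  by move: C => c; nra.
rewrite -natr1 2!mulrDl mul1r lerD//.
by rewrite ler_wpM2l.
Qed.

Let bzy : bmeas (fun u => z u - y u). Proof. exact: bmeasB. Qed.

Let bquot m : bmeas (fun u => quot m t (y u) (b u)).
Proof.
split; first by apply: measurable_quot.
by exists C => u; exact: quot_le.
Qed.

Lemma quot_energy m :
  E (fun u => - quot m t (y u) (b u) * (z u - y u)) <=
  En z - En y + 2 * C ^+ 2 * dy R m.
Proof.
have nE := fine_mesh_dy M S m; have hk0 := dy_gt0 R (fine_mesh M S m).
have -> : (fun u => - quot m t (y u) (b u) * (z u - y u)) = (fun u => (dy R m)^-1 *
  ((y u - eulerT Q b y (dy R (fine_mesh M S m)) (2 ^ (fine_mesh M S m - m)) u) *
   (z u - y u))).
  apply/funext => u; rewrite -[quot _ _ _ _]/((dy R m)^-1 * (euler P al (flow t) (dy R (fine_mesh M S m)) (2 ^ (fine_mesh M S m - m)) (y u) (b u) - y u)) euler_law /eulerT.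
  by move: (euler _ _ _ _ _ _ _) => e; ring.
move: nE hk0; move: (2 ^ _)%N (dy R (fine_mesh _ _ _)) => K hk nE hk0.
rewrite E_Zl; last first.
  apply: bmeasM => //; apply: bmeasB => //.
  exact: (bmeas_eulerT _ mb bM _ (ltW hk0)).
rewrite mulrC ler_pdivrMr ?dy_gt0//.
have := @euler_energy hk K (dy R m) (ltW hk0).
by rewrite nE lexx => /(_ erefl); rewrite mulrC.
Qed.

(** The quotients are bounded by C, so dominated convergence applies, and the error 2 C^2 [dy m]
    vanishes. *)
Lemma vel_energy :
  {ae Q, forall u, (fun m => quot m t (y u) (b u)) @ \oo --> vel t (y u) (b u)} ->
  E (fun u => - vel t (y u) (b u) * (z u - y u)) <= En z - En y.
Proof.
move=> cv.
have bv : bmeas (fun u => vel t (y u) (b u)).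
  split; first by apply: measurable_vel.
  by exists C => u; exact: vel_le.
have [_ [N hN]] := bzy.
have h1 : (fun m => E (fun u => - quot m t (y u) (b u) * (z u - y u))) @ \oo -->
    E (fun u => - vel t (y u) (b u) * (z u - y u)).
  apply: (@E_cvg _ _ _ _ _ _ (C * N)).
  - by move=> n; apply: bmeasM => //; exact: bmeasN.
  - by apply: bmeasM => //; exact: bmeasN.
  - by move=> n u; rewrite normrM normrN ler_pM//; exact: quot_le.
  - apply: filterS cv => u cu; apply: cvgM; last exact: cvg_cst.
    exact: cvgN.
have h2 : (fun m => En z - En y + 2 * C ^+ 2 * dy R m) @ \oo --> En z - En y.
  rewrite -[X in _ --> X]addr0; apply: cvgD; first exact: cvg_cst.
  by rewrite -(mulr0 (2 * C ^+ 2)); apply: cvgM; [exact: cvg_cst|exact: dy_cvg0].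
by apply: (ler_cvg_to h1 h2); apply: nearW => m; exact: quot_energy.
Qed.

End subdifferential.

(** * Lipschitz functions of time *)

Section lipschitz_derivative.
Variables (R : realType) (f : R -> R) (K : R).
Hypothesis K0 : 0 < K.
Hypothesis fK : forall x y, `|f x - f y| <= K * `|x - y|.
Local Notation leb := (@lebesgue_measure R).

Let cf : continuous f.
Proof.
move=> x; apply/cvgrPdist_le => e e0.
near=> y; rewrite (le_trans (fK _ _))// mulrC -ler_pdivlMr//; near: y.
have : id @ x --> x by exact: cvg_id.
by move/cvgrPdist_le; apply; rewrite divr_gt0.
Unshelve. all: by end_near. Qed.

Let Fp (x : R) : R := K * x + f x.
Let Fm (x : R) : R := K * x - f x.

Let Fp_nd : nondecreasing Fp.
Proof.
move=> x y xy; rewrite /Fp; have := fK x y.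
by rewrite ler_norml (distrC x y) (ger0_norm (_ : 0 <= y - x)) ?subr_ge0//; lra.
Qed.

Let Fm_nd : nondecreasing Fm.
Proof.
move=> x y xy; rewrite /Fm; have := fK x y.
by rewrite ler_norml (distrC x y) (ger0_norm (_ : 0 <= y - x)) ?subr_ge0//; lra.
Qed.

Let Fp_rc : right_continuous Fp.
Proof.
apply: right_continuousW => x; apply: cvgD; last exact: cf.
exact: mulrl_continuous.
Qed.

Let Fm_rc : right_continuous Fm.
Proof.
apply: right_continuousW => x; apply: cvgB; last exact: cf.
exact: mulrl_continuous.
Qed.

HB.instance Definition _ := isCumulative.Build R _ R Fp Fp_nd Fp_rc.
HB.instance Definition _ := isCumulative.Build R _ R Fm Fm_nd Fm_rc.

Let mp := lebesgue_stieltjes_measure Fp.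
Let mm := lebesgue_stieltjes_measure Fm.

Let ls_ocitv (g : cumulative R R) (a b : R) : a <= b ->
  lebesgue_stieltjes_measure g `]a, b] = (g b - g a)%:E.
Proof.
move=> ab; rewrite /lebesgue_stieltjes_measure/= /measure_extension/=.
by rewrite measurable_mu_extE/= ?wlength_itv_bnd//; exact: is_ocitv.
Qed.

Let K2 : 0 <= (2 * K)^-1. Proof. by rewrite invr_ge0 mulr_ge0// ltW. Qed.

(** The Stieltjes measures of K x + f and K x - f add up to 2K times Lebesgue measure, by uniqueness
    from half-open intervals; hence each of them is dominated by it. *)
Let mp_dom : mp `<< leb.
Proof.
apply/null_content_dominatesP => A mA A0.
have mE X : mscale (NngNum K2) (measure_add mp mm) X =
    (((2 * K)^-1)%:E * (mp X + mm X))%E.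
  by rewrite -measure_addE.
have E X : ocitv X -> leb X = mscale (NngNum K2) (measure_add mp mm) X.
  move=> [[a b] _ <-]; rewrite mE /=.
  have [ab|ba] := leP a b; last first.
    by rewrite set_itv_ge ?bnd_simp -?leNgt ?ltW// /mp /mm !measure0 adde0 mule0.
  rewrite /mp /mm !ls_ocitv// lebesgue_measure_itv/= lte_fin.
  rewrite -EFinD -EFinM /Fp /Fm.
  case: ifPn.
    by move=> _; congr EFin; field; rewrite gt_eqF.
  rewrite -leNgt => ba; have -> : a = b by apply/eqP; rewrite eq_le ab ba.
  by rewrite !subrr addr0 mulr0.
have lE : leb A = mscale (NngNum K2) (measure_add mp mm) A.
  exact: lebesgue_measure_unique E _ mA.
move: lE; rewrite mE [leb A]A0 => /esym/eqP.
rewrite mule_eq0 eqe gt_eqF ?invr_gt0 ?mulr_gt0//= => /eqP h.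
apply/eqP; rewrite eq_le measure_ge0 andbT.
have : (mp A <= mp A + mm A)%E by rewrite leeDl.
by rewrite h.
Qed.

Variable T : R.
Hypothesis T0 : 0 < T.

Let D : set (measurableTypeR R) := `]0, T].
Let mD : measurable D. Proof. exact: measurable_itv. Qed.
Let Dfin : (mp D < +oo)%E.
Proof. by rewrite /mp /D ls_ocitv ?ltW// ltry. Qed.

(** The restriction to ]0, T] is a finite measure, to which the Radon-Nikodym theorem is applied. *)
Let nu := mfrestr mD Dfin.
HB.instance Definition _ := FiniteMeasure.on nu.

Let nu_dom : nu `<< leb.
Proof.
apply/null_content_dominatesP => A mA A0.
have : mp A = 0%E.
  by move: mp_dom => /null_content_dominatesP; exact.
move=> h; apply/eqP; rewrite eq_le measure_ge0 andbT -h.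
rewrite /nu /mfrestr /mrestr le_measure ?inE//; exact: measurableI.
Qed.

(** The density of the Stieltjes measure of K x + f, minus K, is the derivative of f by the
    fundamental theorem of calculus for integrable functions. The exceptional null set does not
    depend on the sequence [h], so limits obtained along different sequences can be compared. *)
Lemma lipschitz_derivative : exists g : R -> R,
  [/\ leb.-integrable `[0, T] (EFin \o g),
      (\int[leb]_(t in `[0%R, T]) (g t)%:E = (f T - f 0)%:E)%E &
      {ae leb, forall t : measurableTypeR R, t \in `]0, T[ -> forall h : R^nat,
        (forall n, h n != 0) -> h @ \oo --> 0 ->
        (fun n => (h n)^-1 * (f (t + h n) - f t)) @ \oo --> g t}].
Proof.
have [k [k0 kfin intk kE]] := radon_nikodym_sigma_finite nu_dom.
pose g : R -> R := fun t => fine (k t).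
have gk : k = EFin \o g by apply/funext => t; rewrite /= fineK.
rewrite gk in intk kE.
have nuE (A : set (measurableTypeR R)) : measurable A ->
    (\int[leb]_(x in A) (g x)%:E)%E = mp (A `&` D).
  by move=> mA; rewrite -kE.
have kI x : 0 <= x -> x <= T -> Rintegral leb `]-oo, x] g = Fp x - Fp 0.
  move=> x0 xT; rewrite /Rintegral nuE//.
  rewrite (_ : _ `&` _ = `]0, x]%classic); last first.
    apply/seteqP; split => y /=; rewrite /D /= !in_itv/=; first by lra.
    by move=> /andP[-> yx]; rewrite yx (le_trans yx).
  by rewrite /mp ls_ocitv.
exists (fun t => g t - K); split.
- rewrite (_ : EFin \o _ = ((EFin \o g) \- (EFin \o cst K))%E)//.
  apply: integrableB => //.
    by apply: integrableS intk.
  apply: continuous_compact_integrable; first exact: segment_compact.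
  by apply: continuous_subspaceT => x; exact: cvg_cst.
- have i1 : leb.-integrable `[0, T] (EFin \o g) by apply: integrableS intk.
  have i2 : leb.-integrable `[0, T] (EFin \o cst K).
    apply: continuous_compact_integrable; first exact: segment_compact.
    by apply: continuous_subspaceT => x; exact: cvg_cst.
  rewrite -[LHS]/(\int[leb]_(t in `[0%R, T]) ((EFin \o g) t - (EFin \o cst K) t))%E.
  rewrite integralB//.
  have -> : (\int[leb]_(t in `[0%R, T]) (EFin \o cst K) t)%E = (K * T)%:E.
    rewrite -[LHS]/(\int[leb]_(t in `[0%R, T]) (cst K%:E t))%E integral_cst//.
    have lT : leb `[0, T]%classic = T%:E.
      by rewrite lebesgue_measure_itv/= lte_fin T0 sube0.
    by rewrite [X in (_ * X)%E]lT -EFinM.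
  rewrite -[X in (X - _)%E]/(\int[leb]_(t in `[0%R, T]) (g t)%:E)%E nuE//.
  rewrite (_ : _ `&` _ = `]0, T]%classic); last first.
    apply/seteqP; split => y /=; rewrite /D /= !in_itv/=; first by lra.
    by move=> /andP[y0 ->]; rewrite y0 (ltW y0).
  rewrite /mp ls_ocitv ?ltW// -EFinB; congr EFin.
  by rewrite -[LHS]/(K * T + f T - (K * 0 + f 0) - K * T); ring.
have locg : locally_integrable setT g.
  by apply: open_integrable_locally => //; exact: openT.
have := @FTC1Ny R g _ locg.
have inty y : leb.-integrable `]-oo, y] (EFin \o g) by apply: integrableS intk.
move=> /(_ inty); apply: filterS; first exact: (ae_filter_ringOfSetsType leb).
move=> t [/cvg_ex[l ld] Fl] tT h h0 hc.
have lE : l = g t.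
  by rewrite -Fl derive1E; apply/esym/cvg_lim => //; exact: ld.
rewrite {}lE in ld.
have qE n : (h n)^-1 * (f (t + h n) - f t) = (h n)^-1 * (Fp (t + h n) - Fp t) - K.
  have FpE x : Fp x = K * x + f x by [].
  by rewrite !FpE; field; exact: h0.
rewrite (eq_cvg _ _ qE); apply: cvgB; last exact: cvg_cst.
move/cvgr_dnbhsP: ld => /(_ h (conj h0 hc)).
apply: cvg_trans; apply: near_eq_cvg.
move: tT; rewrite in_itv/= => /andP[t0 tT].
(* For large n the point t + h n stays in [0, T], where [kI] identifies the primitive of the
   density. *)
near=> n; rewrite /= scaler1 !kI ?(ltW t0) ?(ltW tT)//.
- by rewrite opprB addrA subrK (addrC t).
- rewrite -lerBlDr sub0r; apply: (@le_trans _ _ (- `|h n|)).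
    rewrite lerN2; near: n; move/cvgrPdist_le: hc => /(_ t t0).
    by apply: filterS => j; rewrite sub0r normrN.
  by rewrite lerNl -normrN ler_norm.
- rewrite -lerBrDr (le_trans (ler_norm _))//; near: n.
  have Tt0 : 0 < T - t by rewrite subr_gt0.
  move/cvgrPdist_le: hc => /(_ _ Tt0).
  by apply: filterS => j; rewrite sub0r normrN.
Unshelve. all: by end_near. Qed.
End lipschitz_derivative.

(** * Test functions along a trajectory *)

Section C1c_functions.
Variable R : realType.

Lemma derivable_MVT (f : R -> R) : (forall x, derivable f x 1) ->
  forall x y, exists c, `|c - x| <= `|y - x| /\ f y - f x = derive1 f c * (y - x).
Proof.
move=> df.
have MVT' x y : x <= y -> exists2 c, c \in `[x, y] & f y - f x = derive1 f c * (y - x).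
  move=> xy; apply: MVT_segment => //.
    by move=> z _; rewrite derive1E; exact: derivableP.
  by apply: derivable_within_continuous => z _; exact: df.
move=> x y; have [xy|yx] := leP x y.
  have [c] := MVT' x y xy; rewrite in_itv/= => /andP[c1 c2] e.
  by exists c; split => //; rewrite !ger0_norm ?subr_ge0// lerB.
have [c] := MVT' y x (ltW yx); rewrite in_itv/= => /andP[c1 c2] e.
exists c; split; last by rewrite -[LHS]opprB e -mulrN opprB.
by rewrite !(distrC _ x) !ger0_norm ?subr_ge0// ?(ltW yx)// lerB.
Qed.

Lemma derivable_lipschitz (f : R -> R) (K : R) : (forall x, derivable f x 1) ->
  (forall x, `|derive1 f x| <= K) -> forall x y, `|f x - f y| <= K * `|x - y|.
Proof.
move=> df fK x y; have [c [_ e]] := derivable_MVT df y x.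
by rewrite e normrM ler_wpM2r.
Qed.

(** On the compact support continuity gives the bound; off it, phi vanishes near the point and so do
    both derivatives. *)
Lemma C1c_bound (phi : R * R -> R) : C1c phi ->
  exists K, (forall p, `|dt phi p| <= K) /\ (forall p, `|dx phi p| <= K).
Proof.
move=> [_ ct cx cS]; set S := closure _ in cS.
have out p : ~ S p -> dt phi p = 0 /\ dx phi p = 0.
  move=> Sp.
  have oS : open (~` S) by apply: closed_openC; exact: closed_closure.
  have [[V1 V2] /= [nV1 nV2] V12] : nbhs p (~` S) by exact: open_nbhs_nbhs.
  have phi0 q : ~ S q -> phi q = 0.
    by move=> Sq; apply: contrapT => /eqP q0; apply: Sq; exact: subset_closure.
  have p0 : phi p = 0 by exact: phi0.
  have d0 (f : R -> R) x : (\forall y \near x, f y = 0) -> derive1 f x = 0.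
    move=> fx; rewrite derive1E (near_eq_derive (g := cst 0)) ?derive_cst// ?oner_neq0//.
  split; apply: d0.
    apply: filterS nV1 => y yV; apply: phi0; apply: V12; split => //=.
    exact: nbhs_singleton.
  apply: filterS nV2 => y yV; apply: phi0; apply: V12; split => //=.
  exact: nbhs_singleton.
have bd (f : R * R -> R) : continuous f -> exists K, forall p, S p -> `|f p| <= K.
  move=> cf; have : compact (f @` S).
    by apply: continuous_compact => //; exact: continuous_subspaceT.
  move=> /compact_bounded [K [Kr hK]]; exists (`|K| + 1) => p Sp.
  by apply: hK; [rewrite (le_lt_trans (ler_norm _))// ltrDl|exists p].
have [K1 h1] := bd _ ct; have [K2 h2] := bd _ cx.
exists (Num.max 0 (Num.max K1 K2)); split => p;
  have [Sp|/out[e1 e2]] := pselect (S p); rewrite ?e1 ?e2 ?normr0 ?le_max ?lexx//.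
- by rewrite h1// orbT.
- by rewrite h2// !orbT.
Qed.

(** Only partial derivatives are given, so the increment is split into one in time at the new
    position and one in space at the old time. The mean value theorem applies to each, and joint
    continuity of the partial derivatives gives the limit. *)
Lemma C1c_chain (phi : R * R -> R) (x : R -> R) (t g : R) (h : R^nat) : C1c phi ->
  {for t, continuous x} -> (forall n, h n != 0) -> h @ \oo --> 0 ->
  (fun n => (h n)^-1 * (x (t + h n) - x t)) @ \oo --> g ->
  (fun n => (h n)^-1 * (phi (t + h n, x (t + h n)) - phi (t, x t))) @ \oo -->
  dt phi (t, x t) + g * dx phi (t, x t).
Proof.
move=> [dphi ct cx _] cx0 h0 hc hg.
pose y n := x (t + h n).
have yc : y @ \oo --> x t.
  have tc : (fun n => t + h n) @ \oo --> t.
    by rewrite -[X in _ --> X]addr0; apply: cvgD => //; exact: cvg_cst.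
  exact: (cvg_comp _ _ tc cx0).
have /choice[a aP] : forall n, exists a, `|a - t| <= `|h n| /\
    phi (t + h n, y n) - phi (t, y n) = dt phi (a, y n) * h n.
  move=> n; have [|c [c1 c2]] := @derivable_MVT (fun s => phi (s, y n)) _ t (t + h n).
    by move=> s; have [h1 _] := dphi (s, y n); exact: h1.
  by exists c; move: c1 c2; rewrite addrAC subrr add0r.
have /choice[b bP] : forall n, exists b, `|b - x t| <= `|y n - x t| /\
    phi (t, y n) - phi (t, x t) = dx phi (t, b) * (y n - x t).
  move=> n; apply: (@derivable_MVT (fun z => phi (t, z))).
  by move=> s; have [_ h2] := dphi (t, s); exact: h2.
have sq (u v : R^nat) (l : R) : (forall n, `|u n - l| <= `|v n|) -> v @ \oo --> 0 ->
    u @ \oo --> l.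
  move=> uv v0; apply/cvgrPdist_le => e e0; move/cvgrPdist_le : v0 => /(_ e e0).
  by apply: filterS => n; rewrite sub0r normrN distrC; exact: le_trans.
have ac : a @ \oo --> t by apply: (sq a h) => // n; have [] := aP n.
have bc : b @ \oo --> x t.
  apply: (sq b (fun n => y n - x t)) => // [n|]; first by have [] := bP n.
  by rewrite -(subrr (x t)); apply: cvgB => //; exact: cvg_cst.
have e n : (h n)^-1 * (phi (t + h n, x (t + h n)) - phi (t, x t)) =
    dt phi (a n, y n) + (h n)^-1 * (y n - x t) * dx phi (t, b n).
  have [_ e1] := aP n; have [_ e2] := bP n.
  rewrite -[phi (t + h n, _)](subrK (phi (t, y n))) -addrA e1 e2.
  by field; exact: h0.
rewrite (eq_cvg _ _ e); apply: cvgD.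
  have c2 : (fun n => (a n, y n)) @ \oo --> (t, x t) by exact: (cvg_pair ac yc).
  exact: (cvg_comp _ _ c2 (ct _)).
apply: cvgM => //.
have c2 : (fun n => (t, b n)) @ \oo --> (t, x t) by exact: (cvg_pair (@cvg_cst _ t _ \oo _) bc).
exact: (cvg_comp _ _ c2 (cx _)).
Qed.

End C1c_functions.

Local Open Scope ereal_scope.

(** * Mixtures of measures *)

Section nonmeasurable_integral.
Import HBNNSimple.
Context d (T : measurableType d) (R : realType) (m : {measure set T -> \bar R}).
Implicit Types (f g : T -> \bar R) (D : set T).

(* The integral is a supremum over measurable simple functions, so changing
   its integrand on a null set is harmless even without measurability. *)
Lemma ae_ge0_le_integral_any D f g :
  (forall x, D x -> 0 <= f x) -> (forall x, D x -> 0 <= g x) ->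
  {ae m, forall x, D x -> f x <= g x} ->
  \int[m]_(x in D) f x <= \int[m]_(x in D) g x.
Proof.
move=> f0 g0 [N [mN N0 fgN]].
have r0 h : (forall x, D x -> 0 <= h x) -> forall x, 0 <= (h \_ D) x.
  by move=> h0 x; rewrite patchE; case: ifPn => // /set_mem; exact: h0.
rewrite integral_mkcond [leRHS]integral_mkcond.
rewrite ge0_integralTE; last exact: r0.
rewrite ge0_integralTE; last exact: r0.
apply: ge_ereal_sup => _ [s sf <-].
have mNC : measurable (~` N) by exact: measurableC.
pose s' := proj_nnsfun s mNC.
have -> : sintegral m s = sintegral m s'.
  rewrite -!integralT_nnsfun; apply: ae_eq_integral => //.
  - by apply/measurable_EFinP; exact: measurable_funP.
  - by apply/measurable_EFinP; exact: measurable_funP.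
  exists N; split => // x /=; apply: contra_notP => Nx _.
  by rewrite /s' /= /proj_nnsfun /= mindicE mem_set//= mulr1.
apply: ereal_sup_ubound; exists s' => //= x.
rewrite /s' /= mindicE; have [xN|xN] := boolP (x \in ~` N); last first.
  by rewrite mulr0; exact: r0.
rewrite mulr1 (le_trans (sf x))// !patchE; case: ifPn => // /set_mem Dx.
apply: contrapT => h; move: xN; rewrite inE; apply; apply: fgN => /=.
by move=> /(_ Dx).
Qed.

Lemma ae_ge0_eq_integral_any D f g :
  (forall x, D x -> 0 <= f x) -> (forall x, D x -> 0 <= g x) ->
  {ae m, forall x, D x -> f x = g x} ->
  \int[m]_(x in D) f x = \int[m]_(x in D) g x.
Proof.
move=> f0 g0 fg; apply/eqP; rewrite eq_le; apply/andP; split.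
  by apply: ae_ge0_le_integral_any => //; apply: filterS fg => x h Dx; rewrite h.
by apply: ae_ge0_le_integral_any => //; apply: filterS fg => x h Dx; rewrite h.
Qed.

Lemma ae_eq_integral_any D f g : {ae m, forall x, D x -> f x = g x} ->
  \int[m]_(x in D) f x = \int[m]_(x in D) g x.
Proof.
move=> fg; rewrite [LHS]integralE [RHS]integralE; congr (_ - _).
  apply: ae_ge0_eq_integral_any => //; apply: filterS fg => x h Dx.
  by rewrite !funeposE h.
apply: ae_ge0_eq_integral_any => //; apply: filterS fg => x h Dx.
by rewrite !funenegE h.
Qed.

End nonmeasurable_integral.

Lemma integralD_null d (T : measurableType d) (R : realType)
    (m : {measure set T -> \bar R}) (D N : set T) (f : T -> \bar R) :
  measurable N -> m N = 0 ->
  \int[m]_(x in D) f x = \int[m]_(x in D `\` N) f x.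
Proof.
move=> mN N0; rewrite integral_mkcond [RHS]integral_mkcond.
apply: ae_eq_integral_any; exists N; split => // x /=; apply: contra_notP => Nx _.
rewrite !patchE; congr (if _ then _ else _); apply/idP/idP => /set_mem Dx.
  by apply/mem_set.
by apply/mem_set; case: Dx.
Qed.

Section almost_measurable_families.
Context dS dU (S : measurableType dS) (U : measurableType dU) (R : realType).
Variables (m : {measure set S -> \bar R}) (D : set S).
Variable gam : S -> {measure set U -> \bar R}.
Hypothesis mD : measurable D.
Hypothesis mgam :
  forall B, measurable B -> almost_measurable m D (fun s => gam s B).
Hypothesis fgam : {ae m, forall s, D s -> gam s setT < +oo}.

Lemma almost_measurable_ge0 (f : S -> \bar R) : almost_measurable m D f ->
  (forall s, D s -> 0 <= f s) -> exists g : S -> \bar R,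
  [/\ measurable_fun D g, forall s, 0 <= g s &
      {ae m, forall s, D s -> f s = g s}].
Proof.
move=> [g mg fg] f0; exists (abse \o g); split => //.
- exact: measurableT_comp.
- by move=> s; exact: abse_ge0.
by apply: filterS fg => s h Ds; rewrite /= -h// gee0_abs// f0.
Qed.

Let sec (B : set (U * S)) s := [set u | B (u, s)].

Let msec B s : measurable B -> measurable (sec B s).
Proof.
have h : measurable_fun setT (fun u : U => (u, s)) by exact: measurable_pair2.
by move=> mB; have := h measurableT _ mB; rewrite setTI.
Qed.

Let sec_bigcup (F : (set (U * S))^nat) s : (forall n, measurable (F n)) ->
  trivIset setT F ->
  gam s (sec (\bigcup_n F n) s) = \sum_(n <oo) gam s (sec (F n) s).
Proof.
move=> mF tF; rewrite (_ : sec _ s = \bigcup_n sec (F n) s)//.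
apply/esym/cvg_lim => //.
have tsec : trivIset setT (fun n => sec (F n) s).
  by move=> i j _ _ [u [/= Fi Fj]]; apply: tF => //; exists (u, s).
by apply: (measure_sigma_additive _ tsec) => n; exact: msec.
Qed.

(** A Dynkin class argument from rectangles. Finiteness of almost every [gam s] serves for
    complements; a countable union of exceptional null sets serves for disjoint unions. *)
Lemma almost_measurable_section B : measurable B ->
  almost_measurable m D (fun s => gam s (sec B s)).
Proof.
pose G := [set A `*` B | A in @measurable _ U & B in @measurable _ S].
have GE : @measurable _ (U * S)%type = <<s G >>.
  exact: measurable_prod_measurableType.
move=> mB; have : <<s G >> B by rewrite -GE.
apply: (dynkin_induction (P := fun B => almost_measurable m D
  (fun s => gam s (sec B s))) GE) => [X Y [X1 mX1 [X2 mX2 <-]] [Y1 mY1 [Y2 mY2 <-]]||X [X1 mX1 [X2 mX2 <-]]|X mX PX|F mF tF PF].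
- exists (X1 `&` Y1); first exact: measurableI.
  by exists (X2 `&` Y2); [exact: measurableI|rewrite setXI].
- exact: (mgam measurableT).
- have [g mg gE] := mgam mX1.
  exists (fun s => g s * (\1_X2 s)%:E).
    apply: emeasurable_funM => //; apply/measurable_EFinP.
    exact: measurable_indic.
  apply: filterS gE => s h Ds; rewrite indicE.
  have [sX|sX] := boolP (s \in X2).
    rewrite mule1 -h//; congr (gam s _); apply/seteqP; split => u /=; first by case.
    by move=> Xu; split => //=; exact: set_mem.
  rewrite mule0 (_ : sec _ s = set0) ?measure0//.
  by apply/seteqP; split => u //= [_ /mem_set]; rewrite /= (negbTE sX).
- have [gT mgT gTE] := mgam measurableT; have [g mg gE] := PX.
  exists (fun s => gT s - g s); first exact: emeasurable_funB.
  apply: filterS3 fgam gTE gE => s h1 h2 h3 Ds.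
  have mXs : measurable (sec X s) by exact: msec.
  rewrite (_ : sec _ s = setT `\` sec X s); last by rewrite setTD.
  rewrite measureD//; last exact: h1.
  by rewrite setTI; congr (_ - _); [exact: h2|exact: h3].
- have /choice[g gP] : forall n, exists g : S -> \bar R,
      [/\ measurable_fun D g, forall s, 0 <= g s &
      {ae m, forall s, D s -> gam s (sec (F n) s) = g s}].
    by move=> n; exact: almost_measurable_ge0.
  exists (fun s => \sum_(n <oo) g n s).
    by apply: ge0_emeasurable_sum => [n s _ _|n _]; have [] := gP n.
  have : {ae m, forall s, forall n, D s -> gam s (sec (F n) s) = g n s}.
    by apply: ae_foralln => n; have [] := gP n.
  apply: filterS => s h Ds.
  by rewrite sec_bigcup//; apply: eq_eseriesr => n _; rewrite h.
Qed.


Let mix (B : set (U * S)) := \int[m]_(s in D) gam s (sec B s).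

Let mix0 : mix set0 = 0.
Proof. by apply: integral0_eq => s _; rewrite measure0. Qed.

Let mix_ge0 B : 0 <= mix B.
Proof. by apply: integral_ge0 => s _. Qed.

Let mix_sigma_additive : semi_sigma_additive mix.
Proof.
move=> F mF tF mUF.
have /choice[g gP] : forall n, exists g : S -> \bar R,
    [/\ measurable_fun D g, forall s, 0 <= g s &
    {ae m, forall s, D s -> gam s (sec (F n) s) = g s}].
  by move=> n; apply: almost_measurable_ge0 => //; exact: almost_measurable_section.
have gF : {ae m, forall s, forall n, D s -> gam s (sec (F n) s) = g n s}.
  by apply: ae_foralln => n; have [] := gP n.
have -> : mix (\bigcup_n F n) = \sum_(n <oo) mix (F n).
  rewrite /mix (@ae_eq_integral_any _ _ _ _ _ _ (fun s => \sum_(n <oo) g n s)).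
    rewrite integral_nneseries//.
    - apply: eq_eseriesr => n _; apply: ae_eq_integral_any.
      by apply: filterS gF => s h Ds; rewrite h.
    - by move=> n; have [] := gP n.
    - by move=> n s _; have [] := gP n.
  apply: filterS gF => s h Ds.
  by rewrite sec_bigcup//; apply: eq_eseriesr => n _; rewrite h.
by apply: is_cvg_ereal_nneg_natsum => n _; exact: mix_ge0.
Qed.

(* The hypotheses are arguments, so that the measure structure can be inferred. *)
Definition mixing_measure & measurable D
  & (forall B, measurable B -> almost_measurable m D (fun s => gam s B))
  & {ae m, forall s, D s -> gam s setT < +oo} : set (U * S) -> \bar R := mix.

Local Notation mixing := (mixing_measure mD mgam fgam).

HB.instance Definition _ := isMeasure.Build _ _ _ mixing mix0 mix_ge0
  mix_sigma_additive.

(** The statement of Tonelli for the mixture, bundled with almost measurability of the inner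
    integral so that it can be propagated from indicators to all nonnegative measurable
    functions. *)
Definition mixable (phi : U * S -> \bar R) :=
  [/\ measurable_fun setT phi, forall z, 0 <= phi z,
      almost_measurable m D (fun s => \int[gam s]_u phi (u, s)) &
      \int[mixing]_z phi z = \int[m]_(s in D) \int[gam s]_u phi (u, s)].

Let mphi_sec (phi : U * S -> \bar R) s : measurable_fun setT phi ->
  measurable_fun setT (fun u => phi (u, s)).
Proof. by move=> mphi; apply: measurableT_comp => //; exact: measurable_pair2. Qed.

Lemma mixable_indic (c : R) B : (0 <= c)%R -> measurable B ->
  mixable (fun z => c%:E * (\1_B z)%:E).
Proof.
move=> c0 mB.
have mI : measurable_fun setT (fun z : U * S => (\1_B z : R)%:E).
  by apply/measurable_EFinP; exact: measurable_indic.
have secE s : \int[gam s]_u (c%:E * (\1_B (u, s))%:E) = c%:E * gam s (sec B s).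
  rewrite ge0_integralZl//; last exact: (mphi_sec s mI).
  by rewrite -[LHS]/(c%:E * \int[gam s]_u (\1_(sec B s) u)%:E) integral_indic ?setIT//; exact: msec.
have [g [mg g0 gE]] := almost_measurable_ge0 (almost_measurable_section mB) (fun s _ => measure_ge0 _ _).
split.
- by apply: emeasurable_funM.
- by move=> z; rewrite mule_ge0// lee_fin.
- exists (fun s => c%:E * g s); first exact: measurable_funeM.
  by apply: filterS gE => s h Ds; rewrite secE h.
rewrite ge0_integralZl// integral_indic// setIT [X in c%:E * X](_ : _ = mix B)//.
under [in RHS]eq_integral do rewrite secE.
rewrite /mix (ae_eq_integral_any gE) -ge0_integralZl//.
by apply/esym/ae_eq_integral_any; apply: filterS gE => s h Ds; rewrite h.
Qed.

Lemma mixable0 : mixable (fun=> 0).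
Proof.
split => //.
  by under eq_fun do rewrite integral0; exists (cst 0) => //; exact: aeW.
by rewrite integral0 integral0_eq// => s _; rewrite integral0.
Qed.

Lemma mixableD phi psi : mixable phi -> mixable psi ->
  mixable (fun z => phi z + psi z).
Proof.
move=> [m1 p1 a1 i1] [m2 p2 a2 i2].
have i_ge0 (chi : U * S -> \bar R) s : (forall z, 0 <= chi z) ->
  D s -> 0 <= \int[gam s]_u chi (u, s) by move=> h _; exact: integral_ge0.
have [g [mg g0 gE]] := almost_measurable_ge0 a1 (fun s => i_ge0 _ s p1).
have [k [mk k0 kE]] := almost_measurable_ge0 a2 (fun s => i_ge0 _ s p2).
have secE s : \int[gam s]_u (phi (u, s) + psi (u, s)) =
    \int[gam s]_u phi (u, s) + \int[gam s]_u psi (u, s).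
  by rewrite ge0_integralD//; exact: mphi_sec.
split.
- exact: emeasurable_funD.
- by move=> z; rewrite adde_ge0.
- exists (fun s => g s + k s); first exact: emeasurable_funD.
  by apply: filterS2 gE kE => s h1 h2 Ds; rewrite secE h1// h2.
have -> : \int[mixing]_z (phi z + psi z) = \int[mixing]_z phi z + \int[mixing]_z psi z.
  by apply: ge0_integralD.
rewrite i1 i2 (ae_eq_integral_any gE) (ae_eq_integral_any kE).
have <- : \int[m]_(s in D) (g s + k s) = \int[m]_(s in D) g s + \int[m]_(s in D) k s.
  by apply: ge0_integralD.
apply/esym/ae_eq_integral_any.
by apply: filterS2 gE kE => s h1 h2 Ds; rewrite secE h1// h2.
Qed.

(** Monotone convergence in each [gam s], then in m. The versions of the inner integrals are
    monotone almost everywhere only, so a version of the limit is taken as their upper limit, which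
    is measurable in any case. *)
Lemma mixable_lim (phi_ : nat -> U * S -> \bar R) phi :
  (forall n, mixable (phi_ n)) ->
  (forall z, nondecreasing_seq (phi_ ^~ z)) ->
  (forall z, phi_ ^~ z @ \oo --> phi z) -> mixable phi.
Proof.
move=> Qn nd cv.
have m_ n : measurable_fun setT (phi_ n) by have [] := Qn n.
have p_ n z : 0 <= phi_ n z by have [_ +] := Qn n; exact.
have mphi : measurable_fun setT phi by exact: (emeasurable_fun_cvg phi_).
have p0 z : 0 <= phi z.
  by rewrite -(cvg_lim _ (cv z))//; apply: lime_ge; [apply/cvg_ex; exists (phi z)|exact: nearW].
have /choice[g gP] : forall n, exists g : S -> \bar R,
    [/\ measurable_fun D g, forall s, 0 <= g s &
    {ae m, forall s, D s -> \int[gam s]_u phi_ n (u, s) = g s}].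
  move=> n; have [_ _ a _] := Qn n; apply: almost_measurable_ge0 => //.
  by move=> s _; exact: integral_ge0.
have gE : {ae m, forall s, forall n, D s -> \int[gam s]_u phi_ n (u, s) = g n s}.
  by apply: ae_foralln => n; have [] := gP n.
have scv s : \int[gam s]_u phi_ n (u, s) @[n --> \oo] --> \int[gam s]_u phi (u, s).
  have -> : \int[gam s]_u phi (u, s) = \int[gam s]_u limn (phi_ ^~ (u, s)).
    by apply: eq_integral => u _; apply/esym/cvg_lim => //; exact: cv.
  apply: (@cvg_monotone_convergence _ _ _ (gam s) _ measurableT (fun n u => phi_ n (u, s))) => //.
  by move=> n; exact: mphi_sec.
have snd' s : nondecreasing_seq (fun n => \int[gam s]_u phi_ n (u, s)).
  move=> i j ij; apply: ge0_le_integral => //; try exact: mphi_sec.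
  by move=> u _; exact: nd.
have mG : measurable_fun D (fun s => limn_esup (g ^~ s)).
  by apply: measurable_fun_limn_esup => n; have [] := gP n.
have GE : {ae m, forall s, D s ->
    \int[gam s]_u phi (u, s) = limn_esup (g ^~ s)}.
  apply: filterS gE => s h Ds.
  have -> : g ^~ s = fun n => \int[gam s]_u phi_ n (u, s).
    by apply/funext => n; rewrite h.
  rewrite is_cvg_limn_esupE; last by apply/cvg_ex; eexists; exact: scv.
  by apply/esym/cvg_lim => //; exact: scv.
split => //; first by exists (fun s => limn_esup (g ^~ s)).
have lhs : \int[mixing]_z phi_ n z @[n --> \oo] --> \int[mixing]_z phi z.
  have -> : \int[mixing]_z phi z = \int[mixing]_z limn (phi_ ^~ z).
    by apply: eq_integral => u _; apply/esym/cvg_lim => //; exact: cv.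
  exact: (@cvg_monotone_convergence _ _ _ mixing _ measurableT phi_).
(* Outside [N] the inner integrals coincide with their versions, so they are measurable there and
   monotone convergence can be used on [D] minus [N]. *)
have [N [mN N0 NE]] := gE.
have mDN : measurable (D `\` N) by exact: measurableD.
have gDN n s : (D `\` N) s -> \int[gam s]_u phi_ n (u, s) = g n s.
  move=> [Ds Ns]; apply: contrapT => h; apply: Ns; apply: NE => /= h'.
  by apply: h; exact: h'.
have rhs : \int[m]_(s in D) \int[gam s]_u phi_ n (u, s) @[n --> \oo] -->
    \int[m]_(s in D) \int[gam s]_u phi (u, s).
  under eq_cvg do rewrite (integralD_null _ _ mN N0).
  rewrite (integralD_null _ _ mN N0).
  have -> : \int[m]_(s in D `\` N) \int[gam s]_u phi (u, s) =
      \int[m]_(s in D `\` N) limn (fun n => \int[gam s]_u phi_ n (u, s)).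
    by apply: eq_integral => s _; apply/esym/cvg_lim => //; exact: scv.
  apply: cvg_monotone_convergence => //.
  - move=> n; have [mg _ _] := gP n.
    apply: (@eq_measurable_fun _ _ _ _ _ (g n)).
      by move=> s /set_mem Ds; rewrite gDN.
    exact: measurable_funS mg.
  - by move=> n s _; exact: integral_ge0.
apply: (cvg_unique _ lhs) => //.
have -> // : (fun n => \int[mixing]_z phi_ n z) =
    fun n => \int[m]_(s in D) \int[gam s]_u phi_ n (u, s).
by apply/funext => n; have [] := Qn n.
Qed.

Import HBNNSimple.

Lemma mixable_ge0 phi : measurable_fun setT phi -> (forall z, 0 <= phi z) ->
  mixable phi.
Proof.
move=> mphi p0; pose h := nnsfun_approx measurableT mphi.
apply: (@mixable_lim (fun n => EFin \o h n)).
- move=> n.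
  have -> : EFin \o h n = fun z => \sum_(k <- finmap.enum_fset (fset_set (range (h n))))
      k%:E * (\1_(h n @^-1` [set k]) z)%:E.
    apply/funext => z /=; rewrite fimfunE -fsumEFin// fsbig_finite//.
  have : forall k, k \in finmap.enum_fset (fset_set (range (h n))) -> (0 <= k)%R.
    move=> k kh; have : k \in fset_set (range (h n)) by exact: kh.
    by rewrite in_fset_set// => /set_mem[z _ <-].
  elim: (finmap.enum_fset _) => [_|k r ih k0].
    by under eq_fun do rewrite big_nil; exact: mixable0.
  under eq_fun do rewrite big_cons; apply: mixableD.
    by apply: mixable_indic => //; apply: k0; rewrite mem_head.
  by apply: ih => j jr; apply: k0; rewrite in_cons jr orbT.
- by move=> z i j ij; rewrite lee_fin; exact/lefP/nd_nnsfun_approx.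
- by move=> z; exact: cvg_nnsfun_approx.
Qed.

End almost_measurable_families.

Section image_measure.
Context d d' (T : measurableType d) (U : measurableType d') (R : realType).
Variables (m : {measure set T -> \bar R}) (f : T -> U).
Hypothesis mf : measurable_fun setT f.

(* [pushforward] with the measurability of [f] as an argument, so that the
   measure structure can be inferred. *)
Definition image_measure & measurable_fun setT f : set U -> \bar R :=
  pushforward m f.

Let im0 : image_measure mf set0 = 0.
Proof. by rewrite /image_measure /pushforward preimage_set0 measure0. Qed.

Let im_ge0 B : 0 <= image_measure mf B.
Proof. by rewrite /image_measure /pushforward measure_ge0. Qed.

Let im_sigma_additive : semi_sigma_additive (image_measure mf).
Proof.
move=> F mF tF mUF; rewrite /image_measure /pushforward preimage_bigcup.
apply: measure_semi_sigma_additive.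
- by move=> n; rewrite -[X in measurable X]setTI; exact: mf.
- by move=> i j _ _ [x [Fi Fj]]; apply: tF => //; exists (f x).
- by rewrite -preimage_bigcup -[X in measurable X]setTI; exact: mf.
Qed.

HB.instance Definition _ := isMeasure.Build _ _ _ (image_measure mf)
  im0 im_ge0 im_sigma_additive.

Lemma ge0_integral_image (phi : U -> \bar R) : measurable_fun setT phi ->
  (forall y, 0 <= phi y) ->
  \int[image_measure mf]_y phi y = \int[m]_x phi (f x).
Proof.
by move=> mphi p0; rewrite (ge0_integral_pushforward mf m (D := setT)).
Qed.

Lemma integral_image (phi : U -> \bar R) : measurable_fun setT phi ->
  \int[image_measure mf]_y phi y = \int[m]_x phi (f x).
Proof.
move=> mphi; rewrite [LHS]integralE [RHS]integralE.
congr (_ - _).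
  rewrite (ge0_integral_image (measurable_funepos mphi) (funepos_ge0 phi)).
  by apply: eq_integral => x _; rewrite !funeposE.
rewrite (ge0_integral_image (measurable_funeneg mphi) (funeneg_ge0 phi)).
by apply: eq_integral => x _; rewrite !funenegE.
Qed.

End image_measure.

Section mixing_signed.
Context dS dU (S : measurableType dS) (U : measurableType dU) (R : realType).
Variables (m : {measure set S -> \bar R}) (D : set S).
Variable gam : S -> {measure set U -> \bar R}.
Hypothesis mD : measurable D.
Hypothesis mgam :
  forall B, measurable B -> almost_measurable m D (fun s => gam s B).
Hypothesis fgam : {ae m, forall s, D s -> gam s setT < +oo}.
Local Notation mixing := (mixing_measure mD mgam fgam).

Lemma almost_measurable_integral phi : measurable_fun setT phi ->
  almost_measurable m D (fun s => \int[gam s]_u phi (u, s)).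
Proof.
move=> mphi.
have [_ _ [gp mgp gpE] _] := mixable_ge0 mD mgam fgam (measurable_funepos mphi) (fun z => funepos_ge0 _ z).
have [_ _ [gn mgn gnE] _] := mixable_ge0 mD mgam fgam (measurable_funeneg mphi) (fun z => funeneg_ge0 _ z).
exists (fun s => gp s - gn s); first exact: emeasurable_funB.
apply: filterS2 gpE gnE => s h1 h2 Ds; rewrite integralE -h1// -h2//.
by congr (_ - _); apply: eq_integral => u _; rewrite ?funeposE ?funenegE.
Qed.

Lemma mixing_integrable phi : mixing.-integrable setT phi ->
  \int[mixing]_z phi z = \int[m]_(s in D) \int[gam s]_u phi (u, s).
Proof.
move=> iphi; have mphi := measurable_int _ iphi.
have [_ _ ap ep] := mixable_ge0 mD mgam fgam (measurable_funepos mphi) (fun z => funepos_ge0 _ z).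
have [_ _ an en] := mixable_ge0 mD mgam fgam (measurable_funeneg mphi) (fun z => funeneg_ge0 _ z).
have [gp [mgp gp0 gpE]] := almost_measurable_ge0 ap (fun s _ => integral_ge0 _ (fun u _ => funepos_ge0 phi (u, s))).
have [gn [mgn gn0 gnE]] := almost_measurable_ge0 an (fun s _ => integral_ge0 _ (fun u _ => funeneg_ge0 phi (u, s))).
have igp : m.-integrable D gp.
  apply/integrableP; split => //.
  under eq_integral do rewrite gee0_abs//.
  rewrite -(ae_eq_integral_any gpE) -ep.
  have /integrableP[_] := integrable_funepos measurableT iphi.
  by under eq_integral do rewrite gee0_abs//.
have ign : m.-integrable D gn.
  apply/integrableP; split => //.
  under eq_integral do rewrite gee0_abs//.
  rewrite -(ae_eq_integral_any gnE) -en.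
  have /integrableP[_] := integrable_funeneg measurableT iphi.
  by under eq_integral do rewrite gee0_abs//.
rewrite [LHS]integralE ep en (ae_eq_integral_any gpE) (ae_eq_integral_any gnE).
rewrite -(integralB mD igp ign); apply/esym/ae_eq_integral_any.
apply: filterS2 gpE gnE => s h1 h2 Ds; rewrite integralE -h1// -h2//.
by congr (_ - _); apply: eq_integral => u _; rewrite ?funeposE ?funenegE.
Qed.

End mixing_signed.

Lemma countable_surjection (T : countType) (x0 : T) :
  exists e : nat -> T, forall x, exists n, e n = x.
Proof.
exists (fun n => odflt x0 (choice.unpickle n)) => x.
by exists (choice.pickle x); rewrite choice.pickleK.
Qed.

(** * Supports and null sets *)

Section support.
Variable R : realType.

Lemma open_itv_rat (V : set R) (x : R) : open V -> V x ->
  exists q : rat * rat, `]ratr q.1, ratr q.2[%classic x /\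
    `]ratr q.1, ratr q.2[%classic `<=` V.
Proof.
rewrite openE => + Vx => /(_ _ Vx) [e /= e0 eV].
have [q1] : exists q : rat, (ratr q : R) \in `]x - e, x[%R.
  by apply: rat_in_itvoo; lra.
have [q2] : exists q : rat, (ratr q : R) \in `]x, x + e[%R.
  by apply: rat_in_itvoo; lra.
rewrite !in_itv/= => /andP[a1 a2] /andP[b1 b2].
exists (q1, q2); split => [|y] /=; rewrite in_itv/=; first by rewrite b2 a1.
by move=> /andP[h1 h2]; apply: eV => /=; rewrite ltr_distlC; lra.
Qed.

Lemma itv_rat_base : exists B : nat -> set R, (forall n, measurable (B n)) /\
  forall V x, open V -> V x -> exists n, B n x /\ B n `<=` V.
Proof.
have [e eP] := @countable_surjection (rat * rat)%type (0%R, 0%R).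
exists (fun n => `]ratr (e n).1, ratr (e n).2[%classic); split.
  by move=> n; exact: measurable_itv.
move=> V x oV Vx; have [q h] := open_itv_rat oV Vx.
by have [n en] := eP q; exists n; rewrite en.
Qed.

Lemma box_rat_base : exists B : nat -> set (R * R), (forall n, measurable (B n)) /\
  forall V x, open V -> V x -> exists n, B n x /\ B n `<=` V.
Proof.
have [e eP] := @countable_surjection (nat * nat)%type (0%N, 0%N).
have [I [mI IP]] := itv_rat_base.
exists (fun n => I (e n).1 `*` I (e n).2); split.
  by move=> n; exact: measurableX.
move=> V x oV Vx; have [[V1 V2] /= [nV1 nV2] V12] : nbhs x V by exact: open_nbhs_nbhs.
have [i [ix iV]] := IP _ _ (@open_interior _ V1) nV1.
have [j [jx jV]] := IP _ _ (@open_interior _ V2) nV2.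
have [n en] := eP (i, j); exists n; rewrite en; split => // y [/= /iV h1 /jV h2].
by apply: V12; split; exact: interior_subset.
Qed.

End support.

(** The complement of the support is covered by countably many null intervals with rational ends. *)
Lemma supp_negligible (R : realType) (m : {measure set R -> \bar R}) :
  m.-negligible (~` supp m).
Proof.
have [B [mB BP]] := itv_rat_base R.
pose F n := if m (B n) == 0 then B n else set0.
apply: (@negligibleS _ _ _ m (\bigcup_n F n)).
  move=> x /= /existsNP[V /not_implyP[oV /not_implyP[Vx /negP]]].
  rewrite -leNgt => mV; have [n [nx nV]] := BP V x oV Vx.
  exists n => //; rewrite /F ifT// eq_le measure_ge0 andbT; apply: le_trans mV.
  by rewrite le_measure ?inE//; exact: open_measurable.
apply: negligible_bigcup => n; rewrite /F.
by case: ifPn => [/eqP h|_]; [exact/negligibleP|exact: negligible_set0].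
Qed.

(** Measurability refers to the product of the Borel sigma-algebras; an open set is a countable
    union of rational boxes. *)
Lemma open_measurable2 (R : realType) (V : set (R * R)) : open V -> measurable V.
Proof.
have [B [mB BP]] := box_rat_base R.
move=> oV; pose F n := if `[< B n `<=` V >] then B n else set0.
rewrite (_ : V = \bigcup_n F n).
  by apply: bigcupT_measurable => n; rewrite /F; case: ifP.
apply/seteqP; split => x.
  move=> Vx; have [n [nx nV]] := BP V x oV Vx.
  by exists n => //; rewrite /F ifT//; exact/asboolP.
by move=> [n _]; rewrite /F; case: ifPn => // /asboolP; exact.
Qed.

Lemma continuous_measurable2 (R : realType) (f : R * R -> R) : continuous f ->
  measurable_fun setT f.
Proof.
move=> cf; apply: (measurability _ (RGenOpens.measurableE R)) => //.
move=> _ [_ [a [b ->] <-]]; rewrite setTI; apply: open_measurable2.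
by move/continuousP : cf; apply; exact: interval_open.
Qed.

Lemma supp_negligible2 (R : realType) (m : {measure set (R * R) -> \bar R}) :
  m.-negligible (~` supp m).
Proof.
have [B [mB BP]] := box_rat_base R.
pose F n := if m (B n) == 0 then B n else set0.
apply: (@negligibleS _ _ _ m (\bigcup_n F n)).
  move=> x /= /existsNP[V /not_implyP[oV /not_implyP[Vx /negP]]].
  rewrite -leNgt => mV; have [n [nx nV]] := BP V x oV Vx.
  exists n => //; rewrite /F ifT// eq_le measure_ge0 andbT; apply: le_trans mV.
  by rewrite le_measure ?inE//; exact: open_measurable2.
apply: negligible_bigcup => n; rewrite /F.
by case: ifPn => [/eqP h|_]; [exact/negligibleP|exact: negligible_set0].
Qed.

(** * Families of total mass one as probability spaces *)

Section mixing_probability.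
Context dS dU (S : measurableType dS) (U : measurableType dU) (R : realType).
Variables (m : {measure set S -> \bar R}) (D : set S).
Variable gam : S -> {measure set U -> \bar R}.
Hypothesis mD : measurable D.
Hypothesis mgam :
  forall B, measurable B -> almost_measurable m D (fun s => gam s B).
Hypothesis fgam : {ae m, forall s, D s -> gam s setT < +oo}.
Hypothesis gam1 : \int[m]_(s in D) gam s setT = 1.

Definition mixing_prob & \int[m]_(s in D) gam s setT = 1 :
  set (U * S) -> \bar R := mixing_measure mD mgam fgam.

HB.instance Definition _ := Measure.on (mixing_prob gam1).

Let mixing_probT : mixing_prob gam1 setT = 1.
Proof. by rewrite -gam1; apply: eq_integral. Qed.

HB.instance Definition _ := @Measure_isProbability.Build _ _ _
  (mixing_prob gam1) mixing_probT.

Local Notation Q := (mixing_prob gam1).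

Lemma mixing_probE B : Q B = \int[m]_(s in D) gam s [set u | B (u, s)].
Proof. by []. Qed.

Lemma mixing_prob_integrable phi : bmeas phi ->
  \int[Q]_z (phi z)%:E = \int[m]_(s in D) \int[gam s]_u (phi (u, s))%:E.
Proof.
move=> bphi; exact: (mixing_integrable (phi := EFin \o phi) (bmeas_integrable Q bphi)).
Qed.

End mixing_probability.

Section lifted_family.
Context dU (U : measurableType dU) (R : realType).
Variables (mu : {sigma_finite_measure set R -> \bar R}) (A : set R).
Variable g : R -> {measure set U -> \bar R}.
Hypothesis mA : measurable A.
Hypothesis mg :
  forall B, measurable B -> almost_measurable mu A (fun s => g s B).
Hypothesis fg : {ae mu, forall s, A s -> g s setT < +oo}.
Hypothesis g1 : \int[mu]_(s in A) g s setT = 1.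
Local Notation Q := (mixing_prob mA mg fg g1).
Variables (n : R -> {measure set R -> \bar R}) (Y b : U * R -> R).
Hypotheses (bY : bmeas Y) (bb : bmeas b) (bA : forall u a, A a -> b (u, a) = a).
Hypothesis nE : {ae mu, forall a, A a -> forall B, measurable B ->
  n a B = g a [set u | B (Y (u, a))]}.

Let mY : measurable_fun setT Y. Proof. by have [] := bY. Qed.

Let mYa a : measurable_fun setT (fun u => Y (u, a)).
Proof. by apply: measurableT_comp => //; exact: measurable_pair2. Qed.

Lemma lifted_integral : {ae mu, forall a, A a -> forall phi : R -> \bar R,
  measurable_fun setT phi -> \int[n a]_x phi x = \int[g a]_u phi (Y (u, a))}.
Proof.
apply: filterS nE => a na Aa phi mphi; have {}na := na Aa.
by rewrite (eq_set_integral (m2 := image_measure (g a) (mYa a)))// integral_image.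
Qed.

Lemma lifted_mixture B : measurable B -> mixture mu A n B = Q (Y @^-1` B).
Proof.
move=> mB; rewrite mixing_probE /mixture; apply: ae_eq_integral_any.
by apply: filterS nE => a na Aa; rewrite na.
Qed.

Let b_abs x : bmeas (fun z => `|x - Y z|%R).
Proof. by apply: bmeas_norm; apply: bmeasB => //; exact: bmeas_cst. Qed.

(** Serves for both ends of a coupling on the same space [Q], with [Y] the truncated first or second
    coordinate, so that the two energies are compared there. *)
Lemma lifted_J : J mu A n = (energy Q b Y)%:E.
Proof.
have absm x : measurable_fun setT (fun y : R => (`|x - y|%R)%:E).
  apply/measurable_EFinP; apply: measurableT_comp => //.
  by apply: measurable_funB.
have mixE (phi : R -> \bar R) : measurable_fun setT phi ->
    \int[mixture mu A n]_x phi x = \int[Q]_z phi (Y z).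
  move=> mphi; rewrite (eq_set_integral (m2 := image_measure Q mY)).
    by rewrite integral_image.
  by move=> B mB; exact: lifted_mixture.
have mG : measurable_fun setT (fun x : R => \int[Q]_z (`|x - Y z|%R)%:E).
  apply: (measurable_fun_fubini_tonelli_F (fun p : R * (U * R) => (`|p.1 - Y p.2|%R)%:E)).
    apply/measurable_EFinP; apply: measurableT_comp => //.
    apply: measurable_funB; first exact: measurable_fst.
    by apply: measurableT_comp => //; exact: measurable_snd.
  by move=> p; rewrite lee_fin.
have bdY : bmeas (fun p : (U * R) * (U * R) => `|Y p.1 - Y p.2|%R).
  apply: bmeas_norm; apply: bmeasB.
    by apply: bmeas_comp => //; exact: measurable_fst.
  by apply: bmeas_comp => //; exact: measurable_snd.
have e1 : \int[mixture mu A n]_x \int[mixture mu A n]_y (`|x - y|%R)%:E =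
    (Rintegral Q setT (fun w => Rintegral Q setT (fun w' => `|Y w - Y w'|)))%:E.
  have -> : (fun x : R => \int[mixture mu A n]_y (`|x - y|%R)%:E) =
      (fun x => \int[Q]_z (`|x - Y z|%R)%:E).
    by apply/funext => x; rewrite mixE.
  rewrite mixE// EFin_E; last exact: (bmeas_E Q bdY).
  by apply: eq_integral => w _; rewrite EFin_E.
have bl : bmeas (fun z => (2^-1 - b z) * Y z)%R.
  by apply: bmeasM => //; apply: bmeasB => //; exact: bmeas_cst.
have e2 : \int[mu]_(a in A) \int[n a]_x ((2^-1 - a) * x)%:E =
    (Rintegral Q setT (fun z => (2^-1 - b z) * Y z))%:E.
  rewrite EFin_E// mixing_prob_integrable//.
  apply: ae_eq_integral_any; apply: filterS lifted_integral => a na Aa.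
  rewrite na//; last by apply/measurable_EFinP; exact: measurable_funM.
  by apply: eq_integral => u _; rewrite bA.
by rewrite /J e1 e2.
Qed.

End lifted_family.

(** * The initial datum *)

Section initial_data.
Context (R : realType) (Rx Rv : R).
Hypotheses (Rx_gt0 : (0 < Rx)%R) (Rv_gt0 : (0 < Rv)%R).
Variable f0 : probability (R * R)%type R.
Hypothesis f0_supp : supp f0 `<=` `[(- Rx)%R, Rx] `*` `[(- Rv)%R, Rv].
Variables (mu : {sigma_finite_measure set R -> \bar R}) (h : R -> R).
Hypotheses (h_meas : measurable_fun setT h) (h_ge0 : forall a, (0 <= h a)%R).
Hypothesis h_out : forall a, a \notin `[(- Rv)%R, (Rv + 1)%R] -> h a = 0%R.
Hypothesis h_density : forall B : set R, measurable B ->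
  pushforward (eta0 f0) snd B = \int[mu]_(a in B) (h a)%:E.
Variable nu0 : R -> {measure set R -> \bar R}.
Hypothesis nu0_disintegration : disintegration mu (eta0 f0) nu0.
Local Notation A := (`[(- Rv)%R, (Rv + 1)%R]%classic : set R).

Let mA : measurable A. Proof. exact: measurable_itv. Qed.

Let mh : measurable_fun setT (fun a => (h a)%:E).
Proof. exact/measurable_EFinP. Qed.

Lemma measurable_G0 : measurable_fun setT (G0 f0).
Proof.
have m1 (B : set R) : measurable B -> measurable ((@fst R R) @^-1` B).
  by move=> mB; rewrite -[X in measurable X]setTI; exact: measurable_fst.
apply: nondecreasing_measurable => // x y xy.
apply: fine_le; rewrite /rho0 /pushforward ?fin_num_measure//; try exact: m1.
rewrite le_measure ?inE//; try exact: m1.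
by move=> p /=; rewrite !in_itv/= => /le_trans; apply.
Qed.

Let shift (p : R * R) : R * R := (p.1, p.2 + G0 f0 p.1)%R.

Let mshift : measurable_fun setT shift.
Proof.
apply: measurable_fun_pair; first exact: measurable_fst.
apply: measurable_funD; first exact: measurable_snd.
by apply: measurableT_comp; [exact: measurable_G0|exact: measurable_fst].
Qed.

Lemma disintegration_f0 (phi : R * R -> \bar R) : measurable_fun setT phi ->
  (forall p, 0 <= phi p) ->
  \int[mu]_a \int[nu0 a]_x phi (x, a) = \int[f0]_p phi (p.1, p.2 + G0 f0 p.1)%R.
Proof.
move=> mphi p0; have [_ <-//] := nu0_disintegration.
exact: (ge0_integral_image f0 mshift).
Qed.

Let mnuT B : measurable B -> almost_measurable mu setT (fun a => nu0 a B).
Proof. by have [+ _] := nu0_disintegration; exact. Qed.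

Lemma nu0_measurable B : measurable B -> almost_measurable mu A (fun a => nu0 a B).
Proof.
move=> /mnuT[g mg gE]; exists g; first exact: measurable_funTS.
by apply: filterS gE => a ga _; exact: ga.
Qed.

Lemma int_h : \int[mu]_a (h a)%:E = 1.
Proof. by rewrite -h_density// -(probability_setT f0). Qed.

Lemma int_hA : \int[mu]_(a in A) (h a)%:E = 1.
Proof.
rewrite -int_h integral_mkcond; apply: eq_integral => a _.
rewrite patchE; case: ifPn => // /negP aA; rewrite h_out//.
by apply/negP => aA'; apply: aA; exact/mem_set.
Qed.

(** Testing the disintegration with the indicator of a in B shows that the mass of [nu0 a] and [h a]
    have the same integral over every measurable set B. *)
Lemma nu0_mass : {ae mu, forall a, nu0 a setT = (h a)%:E}.
Proof.
have [g [mg g0 gE]] := almost_measurable_ge0 (mnuT measurableT) (fun a _ => measure_ge0 _ _).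
have ih : mu.-integrable setT (fun a => (h a)%:E).
  apply/integrableP; split => //.
  under eq_integral do rewrite gee0_abs ?lee_fin//.
  by rewrite int_h ltry.
have : ae_eq mu setT (fun a => (h a)%:E) g.
  apply: integral_ae_eq => // B _ mB.
  rewrite -h_density//.
  transitivity (\int[f0]_p (\1_B (p.2 + G0 f0 p.1)%R)%:E).
    rewrite /pushforward /eta0 /pushforward.
    rewrite -[RHS]/(\int[f0]_p (\1_((snd \o shift) @^-1` B) p)%:E) integral_indic ?setIT//.
    by rewrite -[X in measurable X]setTI; apply: measurableT_comp => //; exact: measurable_snd.
  have mI : measurable_fun setT (fun p : R * R => (\1_B p.2 : R)%:E).
    apply/measurable_EFinP; apply: measurableT_comp; first exact: measurable_indic.
    exact: measurable_snd.
  rewrite -(disintegration_f0 (phi := fun p => (\1_B p.2)%:E)) => [||p]; [|exact: mI|by rewrite lee_fin].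
  rewrite [RHS]integral_mkcond; apply: ae_eq_integral_any.
  apply: filterS gE => a ga _; rewrite patchE -ga//= indicE.
  rewrite -[LHS]/(\int[nu0 a]_x (cst (a \in B)%:R%:E x)) integral_cst//.
  by case: (a \in B); rewrite ?mul1e ?mul0e.
by apply: filterS2 gE => a h1 h2; rewrite h1// h2.
Qed.

(** Test the disintegration with the indicator of |x| > Rx: the shift from [f0] to [eta0] leaves x
    unchanged, and [f0] does not charge the complement of its support. *)
Lemma nu0_supp : {ae mu, forall a, nu0 a [set x | Rx < `|x|]%R = 0}.
Proof.
pose B := [set x : R | Rx < `|x|]%R.
have mB : measurable B.
  by rewrite -[X in measurable X]setTI; apply: measurable_fun_ltr => //; exact: measurableT_comp.
have [g [mg g0 gE]] := almost_measurable_ge0 (mnuT mB) (fun a _ => measure_ge0 _ _).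
have mI : measurable_fun setT (fun p : R * R => (\1_B p.1 : R)%:E).
  apply/measurable_EFinP; apply: measurableT_comp; first exact: measurable_indic.
  exact: measurable_fst.
have ig : \int[mu]_a g a = 0.
  transitivity (\int[mu]_a \int[nu0 a]_x (\1_B x)%:E).
    apply/esym/ae_eq_integral_any; apply: filterS gE => a ga _.
    by rewrite integral_indic// setIT ga.
  rewrite (disintegration_f0 (phi := fun p => (\1_B p.1)%:E)) => [||p]; [|exact: mI|by rewrite lee_fin].
  have mB1 : measurable ((@fst R R) @^-1` B).
    by rewrite -[X in measurable X]setTI; exact: measurable_fst.
  rewrite -[LHS]/(\int[f0]_p (\1_((@fst R R) @^-1` B) p)%:E) integral_indic ?setIT//.
  apply: measure_negligible => //; apply: negligibleS (supp_negligible2 f0).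
  move=> p; rewrite /B/= => pB /f0_supp[/=]; rewrite in_itv/= => /andP[p1 p2] _.
  by move: pB; rewrite ltNge ler_norml p1 p2.
have : ae_eq mu setT g (cst 0).
  apply/(ae_eq_integral_abs mu measurableT mg).
  by under eq_integral do rewrite gee0_abs//.
by apply: filterS2 gE => a h1 h2; rewrite h1// h2.
Qed.

End initial_data.

Section product_ae.
Context (R : realType) (mu : {sigma_finite_measure set R -> \bar R}).
Local Notation time := (measurableTypeR R).

Lemma ae_snd (Q : R -> Prop) : {ae mu, forall a, Q a} ->
  {ae (@lebesgue_measure R \x mu), forall p : time * R, Q p.2}.
Proof.
move=> [N [mN N0 QN]]; exists (setT `*` N); split.
- exact: measurableX.
- rewrite product_measure1E//; rewrite [X in _ * X]N0; exact: mule0.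
- by move=> p Qp; split => //; apply: QN.
Qed.

Lemma almost_measurable_snd d (U : measurableType d) (I : set time) (A : set R)
    (f : R -> U) : measurable A -> almost_measurable mu A f ->
  almost_measurable (@lebesgue_measure R \x mu) (I `*` A) (fun p : time * R => f p.2).
Proof.
move=> mA [g mg gE]; exists (fun p => g p.2).
  apply: (measurable_comp mA) mg (measurable_funTS measurable_snd).
  by move=> _ [p [_ Ap] <-].
by apply: filterS (ae_snd gE) => p h [_ Ap]; exact: h.
Qed.

End product_ae.

Lemma bounded_Fubini d d' (T : measurableType d) (U : measurableType d')
    (R : realType) (m : {sigma_finite_measure set T -> \bar R}) (D : set T)
    (n : {measure set U -> \bar R}) (f : T * U -> R) (K : R) :
  measurable D -> m D < +oo -> n setT < +oo -> measurable_fun setT f ->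
  (forall p, (`|f p| <= K)%R) ->
  \int[m]_(t in D) \int[n]_u (f (t, u))%:E = \int[n]_u \int[m]_(t in D) (f (t, u))%:E.
Proof.
move=> mD fD fn mf fK.
(* [n] is finite by hypothesis only; the copy [n'] carries the structure from which the product
   measure is built. *)
pose n' : {finite_measure set U -> \bar R} := mfrestr measurableT fn.
have nn' B : measurable B -> n B = n' B by move=> mB; rewrite -[in LHS](setIT B).
have toN (g : U -> \bar R) : \int[n]_u g u = \int[n']_u g u by exact: eq_set_integral.
pose F := (fun p => (f p)%:E) \_ (D `*` [set: U]).
have mDT : measurable (D `*` [set: U]) by exact: measurableX.
have iF : (m \x n').-integrable setT F.
  suff : (m \x n').-integrable (D `*` setT) (EFin \o f) by move/(integrable_mkcond _ mDT).
  apply: (measurable_bounded_integrable mDT) => //.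
  - apply: (@le_lt_trans _ _ (m D * n' setT)).
      by rewrite le_eqVlt; apply/orP; left; apply/eqP; exact: product_measure1E.
    apply: lte_mul_pinfty => //; first by rewrite ge0_fin_numE.
    by rewrite -nn'.
  - exact: measurable_funTS.
  - by exists K; split; [exact: num_real|move=> N /ltW KN p _ /=; exact: le_trans (fK p) KN].
have FE t u : F (t, u) = ((fun t => (f (t, u))%:E) \_ D) t.
  rewrite /F !patchE; have [tD|tD] := boolP (t \in D).
    by rewrite mem_set//; split => //; exact: set_mem.
  by rewrite memNset// => -[/= /mem_set]; rewrite (negbTE tD).
rewrite [LHS]integral_mkcond [RHS]toN.
transitivity (\int[m]_t \int[n']_u F (t, u)).
  apply: eq_integral => t _; rewrite patchE; have [tD|tD] := boolP (t \in D).
    by rewrite toN; apply: eq_integral => u _; rewrite FE patchE tD.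
  by rewrite integral0_eq// => u _; rewrite FE patchE (negbTE tD).
rewrite (Fubini iF); apply: eq_integral => u _.
by rewrite [RHS]integral_mkcond; apply: eq_integral => t _; rewrite FE.
Qed.

Local Open Scope ring_scope.

(** * Trajectories *)

Section dynamics.
Context d (T : measurableType d) (R : realType) (P : probability T R).
Variables (al Z : T -> R) (M : R).
Hypotheses (mal : measurable_fun setT al) (alM : forall w, `|al w| <= M).
Hypotheses (bZ : bmeas Z) (M0 : 0 <= M).
Variable S : R.
Hypothesis S0 : 0 < S.
Local Notation C := (1 + M).
Local Notation flow := (flow P al Z).
Local Notation quot := (quot P al Z M S).
Local Notation vel := (vel P al Z M S).
Local Notation leb := (@lebesgue_measure R).

Let C0 : 0 < C. Proof. by rewrite ltr_wpDr. Qed.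

Let flow_lip w s t : `|flow s w - flow t w| <= C * `|s - t|.
Proof. exact: flow_lipschitz. Qed.

Let flow_cont w : continuous (flow ^~ w).
Proof.
move=> t; apply/cvgrPdist_le => e e0.
near=> s; rewrite (le_trans (flow_lip w t s))// mulrC -ler_pdivlMr//.
near: s; have : id @ t --> t by exact: cvg_id.
by move/cvgrPdist_le; apply; rewrite divr_gt0.
Unshelve. all: by end_near. Qed.

Lemma vel_ae w : {ae leb, forall t : measurableTypeR R, t \in `]0, S[ ->
  (fun m => quot m t (flow t w) (al w)) @ \oo --> vel t (flow t w) (al w) /\
  (forall h : R^nat, (forall n, h n != 0) -> h @ \oo --> 0 ->
    (fun n => (h n)^-1 * (flow (t + h n) w - flow t w)) @ \oo -->
      vel t (flow t w) (al w))}.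
Proof.
have [g [_ _]] := lipschitz_derivative C0 (flow_lip w) S0.
apply: filterS => t tg tS; have {}tg := tg tS.
move: tS; rewrite in_itv/= => /andP[t0 tS].
have [hq hv] := vel_flow mal alM bZ M0 (ltW t0) (ltW tS) (tg _ (@dy_neq0 R) (@dy_cvg0 R)).
by rewrite hv.
Qed.

(** It vanishes exactly where the quotients converge. Being a measurable function of (t, y, b), it
    makes failure of convergence a measurable event, determined by position and parameter. *)
Definition defect (t y b : R) : \bar R :=
  limn_esup (fun m => (`|quot m t y b - vel t y b|)%:E).

Lemma defect_ge0 t y b : (0 <= defect t y b)%E.
Proof.
rewrite /defect limn_esup_lim; apply: lime_ge; first exact: is_cvg_esups.
apply: nearW => n; apply: (@le_trans _ _ (`|quot n t y b - vel t y b|)%:E) => //.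
by apply: ereal_sup_ubound; exists n => /=.
Qed.

Lemma defect0P t y b : defect t y b = 0%E <->
  (fun m => quot m t y b) @ \oo --> vel t y b.
Proof.
split => [d0|hq].
  have h : (fun m => (`|quot m t y b - vel t y b|)%:E) @ \oo --> 0%E.
    by apply: limn_esup_le_cvg => [|n]; [rewrite -d0|rewrite lee_fin].
  have {}h : (fun m => `|quot m t y b - vel t y b|) @ \oo --> 0 by exact: fine_cvg h.
  apply/cvgrPdist_le => e e0; move/cvgrPdist_le : h => /(_ e e0).
  by apply: filterS => n; rewrite sub0r normrN normr_id distrC.
have h : (fun m => (`|quot m t y b - vel t y b|)%:E) @ \oo --> 0%E.
  apply: cvg_EFin; first exact: nearW.
  apply/cvgrPdist_le => e e0; move/cvgrPdist_le : hq => /(_ e e0).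
  by apply: filterS => n; rewrite /= sub0r normrN normr_id distrC.
rewrite /defect is_cvg_limn_esupE; first exact: cvg_lim h.
by apply/cvg_ex; exists 0%E.
Qed.

Lemma measurable_defect d' (U : measurableType d') (t y b : U -> R) :
  measurable_fun setT t -> measurable_fun setT y -> measurable_fun setT b ->
  (forall u, `|b u| <= M) ->
  measurable_fun setT (fun u => defect (t u) (y u) (b u)).
Proof.
move=> mt my mb bM; apply: measurable_fun_limn_esup => m.
apply/measurable_EFinP; apply: measurableT_comp => //.
apply: measurable_funB; first exact: measurable_quot.
exact: measurable_vel.
Qed.

(** [vel_ae] gives convergence at almost every time for each label; Tonelli exchanges this into
    almost every label for almost every time. *)
Lemma defect_ae : {ae leb, forall t : measurableTypeR R, t \in `]0, S[ ->
  {ae P, forall w, defect t (flow t w) (al w) = 0%E}}.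
Proof.
pose I : set (measurableTypeR R) := `]0, S[%classic.
have mI : measurable I by exact: measurable_itv.
pose F (z : measurableTypeR R * T) :=
  (defect z.1 (flow z.1 z.2) (al z.2) * (\1_I z.1)%:E)%E.
have m1 : measurable_fun setT (fst : measurableTypeR R * T -> measurableTypeR R).
  exact: measurable_fst.
have m2 : measurable_fun setT (snd : measurableTypeR R * T -> T).
  exact: measurable_snd.
have mF : measurable_fun setT F.
  apply: emeasurable_funM.
    apply: measurable_defect => //; first exact: measurable_flow.
    exact: measurableT_comp.
  apply/measurable_EFinP; apply: measurableT_comp => //.
have F0 z : (0 <= F z)%E by rewrite mule_ge0 ?defect_ge0// lee_fin.
have h0 : (\int[leb]_t \int[P]_w F (t, w) = 0)%E.
  rewrite (fubini_tonelli (m1 := leb) (m2 := P) F)//.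
  apply: integral0_eq => w _; rewrite -(integral0 leb setT).
  apply: ae_eq_integral_any; apply: filterS (vel_ae w) => t ht _.
  rewrite /F /= indicE; have [tI|_] := boolP (t \in I); last by rewrite mule0.
  by rewrite mule1; apply/defect0P; case: (ht (set_mem tI)).
have mG : measurable_fun setT (fun t => \int[P]_w F (t, w))%E.
  exact: (measurable_fun_fubini_tonelli_F F).
have : ae_eq leb setT (fun t => \int[P]_w F (t, w))%E (cst 0%E).
  apply/(ae_eq_integral_abs leb measurableT mG).
  by under eq_integral do rewrite gee0_abs ?integral_ge0//.
apply: filterS => t ht tI; have {ht} := ht Logic.I.
have mt : measurable_fun setT (fun w => defect t (flow t w) (al w)).
  by apply: measurable_defect => //; have [] := bmeas_flow P mal alM bZ M0 t.
rewrite (eq_integral (fun w => defect t (flow t w) (al w))); last first.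
  by move=> w _; rewrite /F/= indicE mem_set ?mule1.
move=> h.
have : ae_eq P setT (fun w => defect t (flow t w) (al w)) (cst 0%E).
  apply/(ae_eq_integral_abs P measurableT mt).
  by under eq_integral do rewrite gee0_abs ?defect_ge0//.
by apply: filterS => w; apply.
Qed.

(** Along a trajectory phi is Lipschitz in time, hence the integral of its derivative, which the
    chain rule identifies at almost every time. *)
Lemma vel_chain w (phi : R * R -> R) : C1c phi ->
  (\int[leb]_(t in `[0%R, S])
    (dt phi (t, flow t w) + vel t (flow t w) (al w) * dx phi (t, flow t w))%:E =
  (phi (S, flow S w) - phi (0, flow 0 w))%:E)%E.
Proof.
move=> hphi; have [K [Kt Kx]] := C1c_bound hphi.
have K0 : 0 <= K by exact: le_trans (Kt (0, 0)).
have [dphi _ _ _] := hphi.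
pose psi t := phi (t, flow t w).
(* The added 1 makes the constant positive even when [K] is 0. *)
have psi_lip s t : `|psi s - psi t| <= (K + K * C + 1) * `|s - t|.
  have h1 : `|phi (s, flow s w) - phi (t, flow s w)| <= K * `|s - t|.
    apply: (@derivable_lipschitz _ (fun r => phi (r, flow s w))) => r.
      by have [h _] := dphi (r, flow s w); exact: h.
    exact: (Kt (r, flow s w)).
  have h2 : `|phi (t, flow s w) - phi (t, flow t w)| <= K * (C * `|s - t|).
    apply: le_trans (ler_wpM2l K0 (flow_lip w s t)).
    apply: (@derivable_lipschitz _ (fun r => phi (t, r))) => r.
      by have [_ h] := dphi (t, r); exact: h.
    exact: (Kx (t, r)).
  rewrite /psi -(subrK (phi (t, flow s w)) (phi (s, _))) -addrA.
  rewrite (le_trans (ler_normD _ _))// (le_trans (lerD h1 h2))//.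
  by rewrite mulrA -mulrDl ler_wpM2r// lerDl.
have KC0 : 0 < K + K * C + 1 by rewrite ltr_wpDl// addr_ge0// mulr_ge0// ltW.
have [g [_ <- gE]] := lipschitz_derivative KC0 psi_lip S0.
apply: ae_eq_integral_any.
have n01 : leb.-negligible ([set 0; S] : set (measurableTypeR R)).
  have n1 (x : R) : leb.-negligible ([set x] : set (measurableTypeR R)).
    by exists [set x]; split; [exact: measurable_set1|exact: lebesgue_measure_set1|].
  exact: (negligibleU (n1 0) (n1 S)).
have ae01 : {ae leb, forall t : measurableTypeR R, ~ [set 0; S] t}.
  by apply: negligibleS n01 => t /= /contrapT.
apply: filterS3 (vel_ae w) gE ae01 => t h1 h2 h3; rewrite /= in_itv/= => /andP[t0 tS].
have tI : t \in `]0, S[.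
  rewrite in_itv/= !lt_neqAle t0 tS !andbT; apply/andP; split; apply/eqP => e; apply: h3.
    by left.
  by right.
congr EFin; have [_ hv] := h1 tI.
have c1 := hv _ (@dy_neq0 R) (@dy_cvg0 R).
have c2 := C1c_chain hphi (@flow_cont w t) (@dy_neq0 R) (@dy_cvg0 R) c1.
exact: (cvg_unique _ c2 (h2 tI _ (@dy_neq0 R) (@dy_cvg0 R))).
Qed.

End dynamics.

(** * The curve of measures *)

Section clip.
Context (R : realType).
Implicit Types r x : R.

(** Truncation to [-r, r]. It turns bounds that hold almost everywhere into bounds at every point,
    at the price of a change on a null set. *)
Definition clip r x : R := Num.max (- r) (Num.min r x).

Lemma clip_le r x : 0 <= r -> `|clip r x| <= r.
Proof.
move=> r0; rewrite ler_norml /clip le_max lexx/= ge_max ge_min lexx/= andbT.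
by rewrite (le_trans _ r0)// oppr_le0.
Qed.

Lemma clip_id r x : `|x| <= r -> clip r x = x.
Proof.
rewrite ler_norml => /andP[rx xr].
by rewrite /clip (min_idPr xr) (max_idPr rx).
Qed.

Lemma bmeas_clip d (T : measurableType d) r (f : T -> R) : 0 <= r ->
  measurable_fun setT f -> bmeas (fun w => clip r (f w)).
Proof.
move=> r0 mf; split; last by exists r => w; exact: clip_le.
by apply: measurable_maxr => //; exact: measurable_minr.
Qed.

End clip.

Section clip_measure.
Local Open Scope ereal_scope.

Lemma measurable_norm_gt d (T : measurableType d) (R : realType) (r : R)
    (f : T -> R) :
  measurable_fun setT f -> measurable [set w | (r < `|f w|)%R].
Proof.
move=> mf.
have mN : measurable_fun setT (fun w => `|f w|%R) by exact: measurableT_comp.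
have := mN measurableT _ (measurable_itv `]r, +oo[); rewrite setTI.
rewrite (_ : _ @^-1` _ = [set w | (r < `|f w|)%R])//.
by apply/seteqP; split => x /=; rewrite in_itv/= andbT.
Qed.

Lemma clip_null d (T : measurableType d) (R : realType)
    (m : {measure set T -> \bar R}) (r : R) (f : T -> R) (B : set R) :
  (0 <= r)%R -> measurable_fun setT f -> m [set w | (r < `|f w|)%R] = 0 ->
  measurable B -> m [set w | B (f w)] = m [set w | B (clip r (f w))].
Proof.
move=> r0 mf f0 mB; have mN := measurable_norm_gt r mf.
have pre (g : T -> R) : measurable_fun setT g -> measurable [set w | B (g w)].
  by move=> mg; rewrite -[X in measurable X]setTI; exact: mg.
have mc := pre _ (bmeas_clip r0 mf).1.
rewrite -[LHS](measureU0 (pre _ mf) mN f0) -[RHS](measureU0 mc mN f0).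
congr (m _); apply/seteqP; split => x /=.
  have [|xr] := ltP r `|f x|%R; first by right.
  by rewrite clip_id//; case=> //; left.
have [|xr] := ltP r `|f x|%R; first by right.
by rewrite clip_id//; case=> //; left.
Qed.

Lemma supp_null (R : realType) (m : {measure set R -> \bar R}) (r : R) :
  supp m `<=` `[(- r)%R, r] -> m [set x | (r < `|x|)%R] = 0.
Proof.
move=> sm; apply/negligibleP; first exact: (measurable_norm_gt r (@measurable_id _ _ setT)).
apply: negligibleS (supp_negligible m) => x /= rx sx.
by have := sm _ sx; rewrite /= in_itv/= -ler_norml leNgt rx.
Qed.

End clip_measure.

Local Open Scope ereal_scope.

Section lagrangian_curve.
Context (R : realType) (mu : {sigma_finite_measure set R -> \bar R}).
Variables (A : set R) (h : R -> R) (nu0 : R -> {measure set R -> \bar R}).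
Variables (M r0 T : R).
Hypotheses (mA : measurable A) (AM : forall a, A a -> (`|a| <= M)%R).
Hypotheses (M0 : (0 <= M)%R) (r0_gt0 : (0 < r0)%R) (T0 : (0 < T)%R).
Hypothesis h0 : forall a, (0 <= h a)%R.
Hypothesis mh : measurable_fun setT h.
Hypothesis nu0_meas :
  forall B, measurable B -> almost_measurable mu A (fun a => nu0 a B).
Hypothesis nu0_fin : {ae mu, forall a, A a -> nu0 a setT < +oo}.
Hypothesis nu0_1 : \int[mu]_(a in A) nu0 a setT = 1.

(** The parameters at which the almost sure properties of the initial family do hold. *)
Definition regular a :=
  nu0 a setT = (h a)%:E /\ nu0 a [set x | (r0 < `|x|)%R] = 0.

Hypothesis nu0_reg : {ae mu, forall a, A a -> regular a}.

Let P0 : probability (R * R)%type R := mixing_prob mA nu0_meas nu0_fin nu0_1.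
Let al (p : R * R) := clip M p.2.
Let Z (p : R * R) := clip r0 p.1.

Local Notation C := (1 + M)%R.
Local Notation radius := (r0 + C * T)%R.

Let C0 : (0 <= C)%R. Proof. by rewrite addr_ge0. Qed.

Let mal : measurable_fun setT al.
Proof. by have [] := bmeas_clip M0 (@measurable_snd _ _ R R). Qed.

Let alM p : (`|al p| <= M)%R. Proof. exact: clip_le. Qed.

Let bZ : bmeas Z. Proof. exact: (bmeas_clip (ltW r0_gt0) measurable_fst). Qed.

Definition trajectory t : R * R -> R := flow P0 al Z t.

Definition velocity (t a x : R) : R := vel P0 al Z M T t x (clip M a).

Let bX t : bmeas (trajectory t). Proof. exact: bmeas_flow. Qed.

Let mX t : measurable_fun setT (trajectory t). Proof. by have [] := bX t. Qed.

Let mXa t a : measurable_fun setT (fun x => trajectory t (x, a)).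
Proof. by apply: measurableT_comp => //; exact: measurable_pair2. Qed.

Lemma trajectory0 p : trajectory 0 p = clip r0 p.1.
Proof. exact: flow0. Qed.

Lemma trajectory_lipschitz s t p :
  (`|trajectory s p - trajectory t p| <= C * `|s - t|)%R.
Proof. exact: flow_lipschitz. Qed.

Let radius_gt0 : (0 < radius)%R.
Proof. by rewrite ltr_wpDr// mulr_ge0// ltW. Qed.

Lemma trajectory_le t p : t \in `[0%R, T] -> (`|trajectory t p| <= radius)%R.
Proof.
rewrite in_itv/= => /andP[t0 tT].
rewrite -(subrK (trajectory 0 p) (trajectory t p)) (le_trans (ler_normD _ _))//.
rewrite addrC lerD//; first by rewrite trajectory0 clip_le// ltW.
rewrite (le_trans (trajectory_lipschitz _ _ _))// subr0 ger0_norm//.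
by rewrite ler_wpM2l.
Qed.

Section curve.
Variable e : R -> {measure set R -> \bar R}.

(** At exceptional parameters the curve is constant in time, equal to [e a]. The value is left free
    because the gradient flow must start exactly from [nu0 a] for every a in [A], whereas a measure
    solution must have mass exactly [h a] for every a in [A]. *)
Definition curve t a : {measure set R -> \bar R} :=
  if pselect (A a /\ regular a)
  then [the measure _ _ of image_measure (nu0 a) (mXa t a)] else e a.

Lemma curveE t a : A a -> regular a ->
  forall B, curve t a B = nu0 a [set x | B (trajectory t (x, a))].
Proof. by move=> Aa ra B; rewrite /curve; case: pselect => // -[]. Qed.

Lemma curve_lift t : {ae mu, forall a, A a -> forall B, measurable B ->
  curve t a B = nu0 a [set x | B (trajectory t (x, a))]}.
Proof. by apply: filterS nu0_reg => a ra Aa B _; apply: curveE => //; exact: ra. Qed.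

Lemma curve_integral t a phi : A a -> regular a -> measurable_fun setT phi ->
  \int[curve t a]_x phi x = \int[nu0 a]_x phi (trajectory t (x, a)).
Proof.
move=> Aa ra mphi; rewrite (eq_set_integral (m2 := image_measure (nu0 a) (mXa t a))).
  by rewrite integral_image.
by move=> B mB; exact: curveE.
Qed.

Lemma curve_null t a : t \in `[0%R, T] -> A a -> regular a ->
  curve t a [set x | (radius < `|x|)%R] = 0.
Proof.
move=> tT Aa ra; rewrite curveE//.
rewrite (_ : [set x | _] = set0) ?measure0//.
by apply/seteqP; split => // x /=; rewrite ltNge trajectory_le.
Qed.

Lemma curve_family t : measurable_family mu A (curve t).
Proof.
move=> B mB; have mXB : measurable (trajectory t @^-1` B).
  by rewrite -[X in measurable X]setTI; exact: mX.
have [g mg gE] := almost_measurable_section nu0_meas nu0_fin mXB.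
exists g => //; apply: filterS2 nu0_reg gE => a ra ga Aa.
by rewrite -ga// curveE//; exact: ra.
Qed.

Let curve_setT t a : A a -> regular a -> curve t a setT = (h a)%:E.
Proof. by move=> Aa ra; rewrite curveE//; case: ra => + _. Qed.

Let int_hA : \int[mu]_(a in A) (h a)%:E = 1.
Proof.
rewrite -nu0_1; apply: ae_eq_integral_any.
by apply: filterS nu0_reg => a ra Aa; have [-> _] := ra Aa.
Qed.

Lemma curve_X t : t \in `[0%R, T] -> X_ mu A h radius (curve t).
Proof.
move=> tT; split; first split; first exact: curve_family.
- by apply: filterS nu0_reg => a ra Aa; apply: curve_setT => //; exact: ra.
- apply: (@le_lt_trans _ _ (\int[mu]_(a in A) ((radius ^+ 2)%:E * (h a)%:E))).
    apply: ae_ge0_le_integral_any.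
    + by move=> a _; apply: integral_ge0 => x _; rewrite lee_fin sqr_ge0.
    + by move=> a _; rewrite mule_ge0// lee_fin ?sqr_ge0.
    apply: filterS nu0_reg => a ra Aa; have {}ra := ra Aa.
    rewrite curve_integral//; last exact/measurable_EFinP/measurable_funX.
    apply: (@le_trans _ _ (\int[nu0 a]_x (radius ^+ 2)%:E)).
      apply: ge0_le_integral => //.
      - by move=> x _; rewrite lee_fin sqr_ge0.
      - by apply/measurable_EFinP; apply: measurable_funX.
      - move=> x _; rewrite lee_fin -real_normK ?num_real//.
        by rewrite ler_pXn2r ?nnegrE ?(ltW radius_gt0)// trajectory_le.
    by rewrite integral_cst//; case: ra => -> _.
  rewrite ge0_integralZl//; last by rewrite lee_fin sqr_ge0.
  - by rewrite int_hA mule1 ltry.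
  - by apply/measurable_EFinP; exact: measurable_funTS.
  - by move=> a _; rewrite lee_fin.
- apply: filterS nu0_reg => a ra Aa x sx; have {}ra := ra Aa.
  rewrite /= in_itv/= -ler_norml leNgt; apply/negP => rx.
  have oU : open [set x : R | (radius < `|x|)%R].
    by apply: open_comp (@open_gt _ radius) => y _; exact: norm_continuous.
  by have := sx _ oU rx; rewrite curve_null// ltxx.
Qed.

(** The image of [nu0 a] under the pair of positions at times s and t is a coupling of cost at most
    h(a) (C |s - t|)^2, and [h] has integral 1. *)
Lemma curve_lipschitz s t : dist mu A (curve s) (curve t) <= (C * `|s - t|)%:E.
Proof.
have d2_le : d2 mu A (curve s) (curve t) <= ((C * `|s - t|) ^+ 2)%:E.
  rewrite -[leRHS]mule1 -int_hA -ge0_integralZl//; last first.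
  - by rewrite lee_fin sqr_ge0.
  - by move=> a _; rewrite lee_fin.
  - by apply/measurable_EFinP; exact: measurable_funTS.
  apply: ae_ge0_le_integral_any.
  - move=> a _; apply: le_ereal_inf_tmp => _ [g _ <-].
    by apply: integral_ge0 => p _; rewrite lee_fin sqr_ge0.
  - by move=> a _; rewrite mule_ge0// lee_fin ?sqr_ge0.
  apply: filterS nu0_reg => a ra Aa; have {}ra := ra Aa.
  have mst : measurable_fun setT
      (fun x => (trajectory s (x, a), trajectory t (x, a))).
    exact: measurable_fun_pair.
  apply: (@le_trans _ _ (\int[image_measure (nu0 a) mst]_p
      ((`|p.1 - p.2| ^+ 2)%R)%:E)).
    apply: ereal_inf_lbound => /=; exists (image_measure (nu0 a) mst) => //.
    by move=> B mB; rewrite !curveE.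
  have mphi : measurable_fun setT (fun p : R * R => ((`|p.1 - p.2| ^+ 2)%R)%:E).
    apply/measurable_EFinP; apply: measurable_funX; apply: measurableT_comp => //.
    exact: measurable_funB.
  rewrite integral_image//.
  apply: (@le_trans _ _ (\int[nu0 a]_x ((C * `|s - t|) ^+ 2)%:E)).
    apply: ge0_le_integral => //.
    - exact: (measurableT_comp mphi mst).
    - move=> x _ /=; rewrite lee_fin lerXn2r ?nnegrE ?mulr_ge0//.
      exact: trajectory_lipschitz.
  by rewrite integral_cst//; case: ra => -> _.
rewrite /dist.
have -> : (C * `|s - t|)%:E = sqrte ((C * `|s - t|) ^+ 2)%:E.
  by rewrite /= sqrtr_sqr (ger0_norm (mulr_ge0 C0 (normr_ge0 _))).
by rewrite lee_sqrt// lee_fin sqr_ge0.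
Qed.

Lemma curve_init : (forall a, A a -> ~ regular a -> e a = nu0 a) ->
  forall a, A a -> forall B, measurable B -> curve 0 a B = nu0 a B.
Proof.
move=> eE a Aa B mB; have [ra|nra] := pselect (regular a); last first.
  by rewrite /curve; case: pselect => [Ara|nAra] /=; [case: nra; case: Ara|rewrite eE].
rewrite curveE//; have [_ rN] := ra.
rewrite [RHS](clip_null (f := id) (ltW r0_gt0) _ rN mB)//.
by congr (nu0 a _); apply/seteqP; split => x; rewrite /= trajectory0.
Qed.

Lemma measurable_velocity3 :
  measurable_fun setT (fun q : measurableTypeR R * R * R => velocity q.1.1 q.1.2 q.2).
Proof.
rewrite /velocity; apply: (measurable_vel P0 mal alM bZ M0 T (t := fun q : measurableTypeR R * R * R => q.1.1)
  (y := fun q => q.2) (b := fun q => clip M q.1.2)).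
- by apply: measurableT_comp; [exact: measurable_fst|exact: measurable_fst].
- exact: measurable_snd.
- apply: (bmeas_clip M0 _).1.
  by apply: measurableT_comp; [exact: measurable_snd|exact: measurable_fst].
- by move=> q; exact: clip_le.
Qed.

Lemma measurable_velocity2 t :
  measurable_fun setT (fun p : R * R => velocity t p.1 p.2).
Proof.
rewrite /velocity; apply: (measurable_vel P0 mal alM bZ M0 T (t := fun p : R * R => t)
  (y := snd) (b := fun p => clip M p.1)).
- exact: measurable_cst.
- exact: measurable_snd.
- exact: (bmeas_clip M0 measurable_fst).1.
- by move=> q; exact: clip_le.
Qed.

Let mv t a : measurable_fun setT (velocity t a).
Proof.
exact: (measurableT_comp (measurable_velocity2 t) (measurable_pair1 a)).
Qed.

Lemma velocity_le t a x : (`|velocity t a x| <= C)%R.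
Proof. by apply: vel_le => //; exact: clip_le. Qed.

Lemma curve_measurable_velocity : measurable_velocity mu A T curve velocity.
Proof.
exists (fun q => velocity q.1.1 q.1.2 q.2).
  exact: measurable_funTS measurable_velocity3.
exists set0; split => //; first by rewrite /space_time integral0_eq// => p _; rewrite xsection0 measure0.
by move=> q; case.
Qed.

Lemma curve_L1 t : L1 mu A (curve t) (velocity t).
Proof.
split.
  exists (fun p => velocity t p.1 p.2).
    exact: measurable_funTS (measurable_velocity2 t).
  exists set0; split => //; last by move=> q; case.
  by rewrite /otimes integral0_eq// => a _; rewrite xsection0 measure0.
apply: (@le_lt_trans _ _ (\int[mu]_(a in A) (C%:E * (h a)%:E))).
  apply: ae_ge0_le_integral_any.
  - by move=> a _; exact: integral_ge0.
  - by move=> a _; rewrite mule_ge0// lee_fin.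
  apply: filterS nu0_reg => a ra Aa; have {}ra := ra Aa.
  have mva : measurable_fun setT (fun x => `|(velocity t a x)%:E|).
    by apply: measurableT_comp => //; apply/measurable_EFinP.
  rewrite curve_integral//.
  apply: (@le_trans _ _ (\int[nu0 a]_x C%:E)).
    apply: ge0_le_integral => //.
    - exact: (measurableT_comp mva (mXa t a)).
    - by move=> x _; rewrite lee_fin velocity_le.
  by rewrite integral_cst//; case: ra => -> _.
rewrite ge0_integralZl//.
- by rewrite int_hA mule1 ltry.
- by apply/measurable_EFinP; exact: measurable_funTS.
- by move=> a _; rewrite lee_fin.
Qed.

Lemma curve_measurable_curve : measurable_curve mu A T curve.
Proof.
move=> phi mphi _; set D := `[0%R, T] `*` setT `*` setT in mphi.
have mI : measurable (`[0%R, T]%classic : set (measurableTypeR R)).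
  exact: measurable_itv.
have mD : measurable D by do 2!apply: measurableX => //.
(* Extension by zero, so that the integrand is measurable on the whole space. *)
pose psi := phi \_ D.
have mpsi : measurable_fun setT psi by apply/(measurable_restrictT _ _).1.
have mDA : measurable (`[0%R, T]%classic `*` A : set (measurableTypeR R * R)).
  exact: measurableX.
have mX3 : measurable_fun setT (fun z : R * (measurableTypeR R * R) =>
    trajectory z.2.1 (z.1, z.2.2)).
  apply: (measurable_flow P0 mal alM bZ M0 (t := fun z : R * (measurableTypeR R * R) => z.2.1)
    (w := fun z => (z.1, z.2.2))).
    by apply: measurableT_comp; [exact: measurable_fst|exact: measurable_snd].
  apply: measurable_fun_pair; first exact: measurable_fst.
  by apply: measurableT_comp; [exact: measurable_snd|exact: measurable_snd].
pose Psi (z : R * (measurableTypeR R * R)) :=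
  (psi (z.2, trajectory z.2.1 (z.1, z.2.2)))%:E.
have mPsi : measurable_fun setT Psi.
  apply/measurable_EFinP; apply: measurableT_comp => //.
  by apply: measurable_fun_pair => //; exact: measurable_snd.
have mgam B : measurable B -> almost_measurable (@lebesgue_measure R \x mu)
    (`[0%R, T] `*` A) (fun p : measurableTypeR R * R => nu0 p.2 B).
  by move=> mB; exact: (almost_measurable_snd _ mA (nu0_meas mB)).
have fgam : {ae (@lebesgue_measure R \x mu), forall p : measurableTypeR R * R,
    (`[0%R, T] `*` A) p -> nu0 p.2 setT < +oo}.
  by apply: filterS (ae_snd nu0_fin) => p + [_ Ap]; exact.
have [g mg gE] := almost_measurable_integral (gam := fun p : measurableTypeR R * R => nu0 p.2) mDA mgam fgam mPsi.
exists g => //; apply: filterS2 gE (ae_snd nu0_reg) => p gp ra [pI pA].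
rewrite -gp//; have {}ra := ra pA.
have mpx : measurable_fun setT (fun x => (psi (p, x))%:E).
  apply/measurable_EFinP; exact: (measurableT_comp mpsi (measurable_pair1 p)).
transitivity (\int[curve p.1 p.2]_x (psi (p, x))%:E).
  apply: eq_integral => x _; rewrite /psi patchE mem_set//.
by rewrite curve_integral.
Qed.

(** * The subgradient inequality for a given coupling *)

Section coupling.
Variables (t r : R) (theta : R -> {measure set R -> \bar R}).
Variable gam : R -> {measure set (R * R) -> \bar R}.
Hypotheses (tT : t \in `[0%R, T]) (rge0 : (0 <= r)%R).
Hypothesis thetaX : X_ mu A h r theta.
Hypothesis gamC : family_couplings mu A (curve t) theta gam.
Hypothesis defect0 :
  {ae P0, forall p, defect P0 al Z M T t (trajectory t p) (al p) = 0}.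

Let rad0 : (0 <= radius)%R. Proof. exact: ltW. Qed.

(** The two positions and the parameter on the space of the coupling, truncated because the results
    on flows and energies require bounds everywhere. *)
Let y (u : (R * R) * R) := clip radius u.1.1.
Let z (u : (R * R) * R) := clip r u.1.2.
Let b (u : (R * R) * R) := clip M u.2.

Let by_ : bmeas y.
Proof. apply: bmeas_clip => //; by apply: measurableT_comp; [exact: measurable_fst|exact: measurable_fst]. Qed.

Let bz : bmeas z.
Proof. apply: bmeas_clip => //; by apply: measurableT_comp; [exact: measurable_snd|exact: measurable_fst]. Qed.

Let mb : measurable_fun setT b.
Proof. by have [] := bmeas_clip M0 (@measurable_snd _ _ (R * R)%type R). Qed.

Let bM u : (`|b u| <= M)%R. Proof. exact: clip_le. Qed.

Let bb : bmeas b. Proof. by split => //; exists M. Qed.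

Let bA (u : R * R) a : A a -> b (u, a) = a.
Proof. by move=> Aa; rewrite /b clip_id// AM. Qed.

Let gam_fst : {ae mu, forall a, A a -> forall B, measurable B ->
  gam a [set u | B u.1] = nu0 a [set x | B (trajectory t (x, a))]}.
Proof.
have [_ gC] := gamC; apply: filterS2 gC nu0_reg => a gCa ra Aa B mB.
by have [+ _] := gCa Aa B mB; rewrite /pushforward => ->; apply: curveE => //; exact: ra.
Qed.

Let gam_snd : {ae mu, forall a, A a -> forall B, measurable B ->
  gam a [set u | B u.2] = theta a B}.
Proof.
have [_ gC] := gamC; apply: filterS gC => a gCa Aa B mB.
by have [_] := gCa Aa B mB.
Qed.

Let mgam B : measurable B -> almost_measurable mu A (fun a => gam a B).
Proof. by have [+ _] := gamC; exact. Qed.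

Let gamT : {ae mu, forall a, A a -> gam a setT = nu0 a setT}.
Proof. by apply: filterS gam_fst => a ga Aa; exact: (ga Aa setT). Qed.

Let fgam : {ae mu, forall a, A a -> gam a setT < +oo}.
Proof. by apply: filterS2 gamT nu0_fin => a ga fa Aa; rewrite ga//; exact: fa. Qed.

Let gam1 : \int[mu]_(a in A) gam a setT = 1.
Proof. by rewrite -nu0_1; exact: ae_eq_integral_any. Qed.

Let Q : probability ((R * R) * R)%type R := mixing_prob mA mgam fgam gam1.

(** For almost every a, the first marginal of [gam a] is the image of [nu0 a] under the trajectory,
    and trajectories never leave the truncation radius up to time [T]. *)
Let coupling_law (B : set (R * R)) : measurable B ->
  P0 ((fun p => (trajectory t p, al p)) @^-1` B) = Q ((fun u => (y u, b u)) @^-1` B).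
Proof.
move=> mB; rewrite [LHS]mixing_probE [RHS]mixing_probE; apply: ae_eq_integral_any.
apply: filterS gam_fst => a ga Aa.
have mBa : measurable [set x | B (clip radius x, clip M a)].
  have mc : measurable_fun setT (fun x : R => (clip radius x, clip M a)).
    by apply: measurable_fun_pair => //; by have [] := bmeas_clip rad0 (@measurable_id _ R setT).
  by have := mc measurableT _ mB; rewrite setTI.
rewrite [RHS](ga Aa _ mBa); congr (nu0 a _).
by apply/seteqP; split => x /=; rewrite clip_id// trajectory_le.
Qed.

Let mtb : measurable_fun setT (fun p : R * R => defect P0 al Z M T t p.1 (clip M p.2)).
Proof.
apply: (measurable_defect P0 mal alM bZ M0 T (t := fun=> t) (y := fst)) => //.
Qed.

(** The bad set is the preimage of the measurable set of (position, parameter) with nonzero defect,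
    so it is null for the coupling as soon as it is null for the flow. *)
Let coupling_cvg : {ae Q, forall u,
  (fun m => quot P0 al Z M T m t (y u) (b u)) @ \oo --> vel P0 al Z M T t (y u) (b u)}.
Proof.
pose B := [set p : R * R | defect P0 al Z M T t p.1 (clip M p.2) != 0].
have mB : measurable B.
  rewrite (_ : B = setT `&`
      (fun p => defect P0 al Z M T t p.1 (clip M p.2)) @^-1` [set~ 0]).
    by apply: mtb => //; apply: measurableC; exact: emeasurable_set1.
  by rewrite setTI; apply/seteqP; split => p /=; move/eqP.
have myb : measurable_fun setT (fun u => (y u, b u)).
  by apply: measurable_fun_pair => //; have [] := by_.
exists ((fun u => (y u, b u)) @^-1` B); split.
- by rewrite -[X in measurable X]setTI; exact: myb.
- rewrite -coupling_law//; apply/negligibleP.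
    rewrite -[X in measurable X]setTI.
    by apply: (measurable_fun_pair (mX t) mal).
  apply: negligibleS defect0 => p /= + d0.
  by rewrite /B /= (clip_id (alM p)) => /eqP; apply.
- move=> u /= nu; apply/negP => /eqP d0; apply: nu; apply/defect0P.
  by rewrite -[b u](clip_id (bM u)).
Qed.

(** This is [vel_energy] on the space of the coupling; the truncations are then removed, since
    almost every [gam a] charges no pair that they alter. *)
Lemma coupling_subdiff :
  \int[mu]_(a in A) \int[gam a]_p (- velocity t a p.1 * (p.2 - p.1))%:E <=
  J mu A theta - J mu A (curve t).
Proof.
have := vel_energy mal alM bZ M0 by_ bz mb bM coupling_law coupling_cvg.
have gam_out1 : {ae mu, forall a, A a -> gam a [set u | (radius < `|u.1|)%R] = 0}.
  apply: filterS gam_fst => a ga Aa.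
  rewrite (ga Aa _ (measurable_norm_gt radius (@measurable_id _ _ setT))).
  rewrite (_ : [set x | _] = set0) ?measure0//.
  by apply/seteqP; split => // x /=; rewrite ltNge trajectory_le.
have gam_out2 : {ae mu, forall a, A a -> gam a [set u | (r < `|u.2|)%R] = 0}.
  have [_ thS] := thetaX; apply: filterS2 gam_snd thS => a ga sa Aa.
  rewrite (ga Aa _ (measurable_norm_gt r (@measurable_id _ _ setT))).
  exact/supp_null/sa.
have -> : J mu A theta = (energy Q b z)%:E.
  apply: lifted_J => //; apply: filterS2 gam_snd gam_out2 => a ga oa Aa B mB.
  by rewrite -ga// (clip_null (f := snd) rge0 measurable_snd (oa Aa) mB).
have -> : J mu A (curve t) = (energy Q b y)%:E.
  apply: lifted_J => //; apply: filterS2 nu0_reg (filterI gam_fst gam_out1) => a ra [ga oa] Aa B mB.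
  by rewrite curveE ?ga// -?ga//; [rewrite (clip_null (f := fst) rad0 measurable_fst (oa Aa) mB)|exact: ra].
rewrite -EFinB -lee_fin; apply: le_trans.
have bv : bmeas (fun u => vel P0 al Z M T t (y u) (b u)).
  split; last by exists C => u; apply: vel_le.
  by apply: (measurable_vel P0 mal alM bZ M0 T (t := fun=> t)) => //; have [] := by_.
have bf : bmeas (fun u => - vel P0 al Z M T t (y u) (b u) * (z u - y u))%R.
  by apply: bmeasM; [exact: bmeasN|exact: bmeasB].
rewrite EFin_E// mixing_prob_integrable// le_eqVlt; apply/orP; left; apply/eqP.
apply: ae_eq_integral_any.
apply: filterS2 gam_out1 gam_out2 => a o1 o2 Aa; apply: ae_eq_integral_any.
have n1 : (gam a).-negligible [set u | (radius < `|u.1|)%R].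
  by apply/negligibleP; [exact: measurable_norm_gt|exact: o1].
have n2 : (gam a).-negligible [set u | (r < `|u.2|)%R].
  by apply/negligibleP; [exact: measurable_norm_gt|exact: o2].
apply: negligibleS (negligibleU n1 n2) => u /= nu.
have [|u1] := ltP radius `|u.1|%R; first by left.
have [|u2] := ltP r `|u.2|%R; first by right.
exfalso; apply: nu => _.
by rewrite /velocity /y /z /b/= (clip_id u1) (clip_id u2).
Qed.

End coupling.

(** The times 0 and [T] are discarded, as the defect is controlled on the open interval only. *)
Lemma curve_subdiff : {ae lebesgue_measure, forall t : measurableTypeR R,
  t \in `[0%R, T] -> subdiff mu A h (curve t) (fun a x => - velocity t a x)%R}.
Proof.
have ne (s : R) : {ae @lebesgue_measure R, forall t : measurableTypeR R, t <> s}.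
  exists [set s]; split; first exact: measurable_set1.
  - exact: lebesgue_measure_set1.
  - by move=> t /= /contrapT ->.
have := defect_ae P0 mal alM bZ M0 T0.
move=> da; apply: filterS2 (filterI (ne 0%R) (ne T)) da => t [t0 tT] da tI; split.
  split.
    have [[g mg gE] _] := curve_L1 t.
    exists (fun p => - g p)%R; first exact: measurableT_comp.
    have [N [mN N0 hN]] := gE; exists N; split => // p np.
    by apply: hN => hp; apply: np => Ap; rewrite hp.
  have [_] := curve_L1 t; apply: le_lt_trans.
  rewrite le_eqVlt; apply/orP; left; apply/eqP.
  by apply: eq_integral => a _; apply: eq_integral => x _; rewrite EFinN abseN.
move=> r theta gam r_gt0 thX gC; apply: (coupling_subdiff tI (ltW r_gt0) thX gC).
apply: da; move: tI; rewrite !in_itv/= => /andP[t0' tT'].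
rewrite !lt_neqAle t0' tT' !andbT; apply/andP; split; apply/eqP => //.
by move/esym.
Qed.

(** Transport the integral back to [nu0 a], exchange it with the one in time, and use [vel_chain] on
    each trajectory. *)
Lemma curve_continuity_equation a : A a -> regular a ->
  continuity_equation T (fun t => curve t a) (fun t => velocity t a) (nu0 a).
Proof.
move=> Aa ra phi hphi F; have [K [Kt Kx]] := C1c_bound hphi.
have [dphi ct cx _] := hphi; have [na nN] := ra.
have fna : nu0 a setT < +oo by rewrite na ltry.
have K0 : (0 <= K)%R by exact: le_trans (Kt (0%R, 0%R)).
pose D : set (measurableTypeR R) := `[0%R, T]%classic.
have mD : measurable D by exact: measurable_itv.
have fD : @lebesgue_measure R D < +oo.
  by rewrite /D lebesgue_measure_itv/= lte_fin T0 oppr0 adde0 ltry.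
pose H (p : measurableTypeR R * R) := F p.1 (trajectory p.1 (p.2, a)).
have FK t x : (`|F t x| <= K + C * K)%R.
  rewrite /F (le_trans (ler_normD _ _))// lerD ?Kt// normrM.
  by rewrite ler_pM ?velocity_le ?Kx.
have mX2 : measurable_fun setT
    (fun p : measurableTypeR R * R => trajectory p.1 (p.2, a)).
  apply: (measurable_flow P0 mal alM bZ M0 (t := fst) (w := fun p => (p.2, a))).
    exact: measurable_fst.
  by apply: measurable_fun_pair; [exact: measurable_snd|exact: measurable_cst].
have mtX : measurable_fun setT
    (fun p : measurableTypeR R * R => (p.1 : R, trajectory p.1 (p.2, a))).
  by apply: measurable_fun_pair => //; exact: measurable_fst.
have mH : measurable_fun setT H.
  apply: measurable_funD.
    exact: (measurableT_comp (continuous_measurable2 ct) mtX).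
  apply: measurable_funM; last exact: (measurableT_comp (continuous_measurable2 cx) mtX).
  have mq : measurable_fun setT (fun p : measurableTypeR R * R =>
      ((p.1, a), trajectory p.1 (p.2, a)) : measurableTypeR R * R * R).
    apply: measurable_fun_pair => //.
    by apply: measurable_fun_pair; [exact: measurable_fst|exact: measurable_cst].
  exact: (measurableT_comp measurable_velocity3 mq).
have mFt t : measurable_fun setT (F t).
  apply: measurable_funD.
    exact: (measurableT_comp (continuous_measurable2 ct) (measurable_pair1 t)).
  apply: measurable_funM; first exact: mv.
  exact: (measurableT_comp (continuous_measurable2 cx) (measurable_pair1 t)).
have mphi t : measurable_fun setT (fun x => phi (t, x)).
  apply: continuous_measurable_fun => x; apply: differentiable_continuous.
  by apply/derivable1_diffP; have [_ h1] := dphi (t, x); exact: h1.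
split.
  apply: (@le_lt_trans _ _ (\int[lebesgue_measure]_(t in D) ((K + C * K)%:E * nu0 a setT))).
    apply: ae_ge0_le_integral_any.
    - by move=> t _; exact: integral_ge0.
    - by move=> t _; rewrite mule_ge0// lee_fin addr_ge0// mulr_ge0.
    apply: aeW => t _.
    have mFa : measurable_fun setT (fun x => `|(F t x)%:E|).
      by apply: measurableT_comp => //; apply/measurable_EFinP; exact: mFt.
    rewrite curve_integral//.
    apply: (@le_trans _ _ (\int[nu0 a]_x (K + C * K)%:E)).
      apply: ge0_le_integral => //.
      - exact: (measurableT_comp mFa (mXa t a)).
      - by move=> x _; rewrite lee_fin FK.
    by rewrite integral_cst.
  rewrite integral_cst//; apply: lte_mul_pinfty => //.
    by rewrite mule_ge0// lee_fin addr_ge0// mulr_ge0.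
  by rewrite na.
transitivity (\int[lebesgue_measure]_(t in D) \int[nu0 a]_x (H (t, x))%:E).
  apply: eq_integral => t _; rewrite curve_integral//.
  by apply/measurable_EFinP; exact: mFt.
rewrite (bounded_Fubini mD fD fna mH (fun p => FK _ _)).
transitivity (\int[nu0 a]_x ((phi (T, trajectory T (x, a)))%:E -
                             (phi (0%R, trajectory 0 (x, a)))%:E)).
  apply: eq_integral => x _.
  exact: (vel_chain P0 mal alM bZ M0 T0 (x, a) hphi).
have iphi t : t \in `[0%R, T] ->
    (nu0 a).-integrable setT (fun x => (phi (t, trajectory t (x, a)))%:E).
  move=> tT; apply: measurable_bounded_integrable => //.
    exact: (measurableT_comp (mphi t) (mXa t a)).
  exists (`|phi (t, 0%R)| + K * radius)%R; split; first exact: num_real.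
  move=> N /ltW NK x _ /=; apply: le_trans NK.
  rewrite -(subrK (phi (t, 0%R)) (phi (t, _))) addrC (le_trans (ler_normD _ _))//.
  rewrite lerD2l (le_trans (@derivable_lipschitz _ (fun y => phi (t, y)) K _ _ _ _))//.
  - by move=> y; have [_ h1] := dphi (t, y); exact: h1.
  - by move=> y; exact: (Kx (t, y)).
  - by rewrite subr0 ler_wpM2l// trajectory_le.
have T1 : T \in `[0%R, T] by rewrite in_itv/= lexx ltW.
have T2 : 0%R \in `[0%R, T] by rewrite in_itv/= lexx ltW.
rewrite (integralB _ (iphi _ T1) (iphi _ T2))//; congr (_ - _).
  by rewrite curve_integral//; apply/measurable_EFinP; exact: mphi.
(* At time 0 the trajectory is the truncation of x, equal to x outside a null set of [nu0 a]. *)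
apply: ae_eq_integral_any.
have : (nu0 a).-negligible [set x | (r0 < `|x|)%R].
  by apply/negligibleP => //; exact: measurable_norm_gt (@measurable_id _ _ setT).
apply: negligibleS => x /= nx; rewrite ltNge; apply/negP => xr.
by apply: nx => _; rewrite trajectory0 clip_id.
Qed.

Lemma curve_gradient_flow : (forall a, A a -> ~ regular a -> e a = nu0 a) ->
  gradient_flow mu A h T nu0 curve velocity.
Proof.
move=> eE; split.
- by exists radius => // t; exact: curve_X.
- by exists C => s t _ _; exact: curve_lipschitz.
- exact: curve_init.
- exact: curve_measurable_curve.
- exact: curve_measurable_velocity.
- by move=> t _; exact: curve_L1.
- exact: curve_subdiff.
- by apply: filterS nu0_reg => a ra Aa; apply: curve_continuity_equation => //; exact: ra.
Qed.

Let law_trajectory t (B : set R) : measurable B ->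
  mixture mu A (curve t) B = (fine (P0 [set p | B (trajectory t p)]))%:E.
Proof.
move=> mB; rewrite fineK; last first.
  by apply: fin_num_measure; rewrite -[X in measurable X]setTI; exact: mX.
exact: (lifted_mixture mA nu0_meas nu0_fin nu0_1 (curve_lift t) mB).
Qed.

Lemma curve_velocity_bounds t a x : A a ->
  a%:E - G mu A (curve t) x <= (velocity t a x)%:E
    <= a%:E - Gminus mu A (curve t) x.
Proof.
move=> Aa; rewrite /G /Gminus !law_trajectory//.
have := vel_cdf P0 mal alM bZ M0 T t x (clip_le a M0).
by rewrite -/(velocity t a x) (clip_id (AM Aa)) -!EFinB !lee_fin.
Qed.

(** With multiples of a Dirac mass at exceptional parameters, the mass is [h a] and the support
    bounded for every a in [A], as the definition demands. *)
Lemma curve_measure_solution :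
  (forall a B, measurable B -> e a B = (h a)%:E * \d_(0%R : R) B) ->
  measure_solution mu A h T nu0 curve.
Proof.
move=> eE; split.
- move=> t a tT Aa; pose N := [set x : R | (radius < `|x|)%R].
  have mN : measurable N by exact: measurable_norm_gt (@measurable_id _ _ setT).
  have N0 : \d_(0%R : R) N = 0 :> \bar R.
    rewrite diracE memNset// /N /= normr0 => /lt_trans /(_ radius_gt0).
    by rewrite ltxx.
  have [cT cN] : curve t a setT = (h a)%:E /\ curve t a N = 0.
    have [ra|nra] := pselect (regular a); first by rewrite curve_setT ?curve_null.
    have -> : curve t a = e a.
      by rewrite /curve; case: pselect => [Ara|nAra] //=; case: nra; case: Ara.
    by rewrite !eE// N0 mule0 diracT mule1.
  (* The second argument of [mnormalize] is the value used when the mass [h a] is zero. *)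
  pose P : probability R R := mnormalize (curve t a) \d_(0%R : R).
  have PE B : P B = if h a == 0%R then \d_(0%R : R) B else curve t a B * ((h a)^-1)%:E.
    rewrite /P /= /mnormalize cT /= (_ : (_ || _) = (h a == 0%R))//.
      by case: ifP.
    by apply/orP/eqP => [[/eqP[]|/eqP]//|->]; left.
  exists P; split.
    move=> B mB; rewrite PE; have [ha|ha] := eqVneq (h a) 0%R.
      rewrite ha mul0e; apply/eqP; rewrite eq_le measure_ge0 andbT.
      apply: (@le_trans _ _ (curve t a setT)); last by rewrite cT ha.
      by apply: le_measure; rewrite ?inE.
    by rewrite muleCA -EFinM divff// mule1.
  have PN : P N = 0.
    by rewrite PE cN mul0e N0 if_same.
  apply: (@le_lt_trans _ _ (\int[P]_x (radius ^+ 2)%:E)).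
    apply: ae_ge0_le_integral_any.
    + by move=> x _; rewrite lee_fin sqr_ge0.
    + by move=> x _; rewrite lee_fin sqr_ge0.
    have : P.-negligible N by exact/negligibleP.
    apply: negligibleS => x /= nx; rewrite /N/= ltNge; apply/negP => xr; apply: nx => _.
    by rewrite lee_fin -real_normK ?num_real// lerXn2r// nnegrE ltW.
  by rewrite integral_cst// [X in _ * X](_ : _ = 1) ?mule1 ?ltry//; exact: probability_setT.
- exact: curve_measurable_curve.
- exists velocity; split; first exact: curve_measurable_velocity.
    (* A set that is null for [mu] is null for the measure with density [h]. *)
    have [N [mN N0 hN]] := nu0_reg; exists N; split => //.
      rewrite /hmu -[RHS](integral0 mu N); apply: ae_eq_integral_any.
      by exists N; split => // a /= /not_implyP[].
    move=> a na; apply: hN => ra; apply: na => Aa.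
    by apply: curve_continuity_equation => //; exact: ra.
  (* The bounds on the velocity hold at every point with a in [A], so the exceptional set is
     empty. *)
  exists set0; split => //.
    by rewrite /space_time integral0_eq// => p _; rewrite xsection0 measure0.
  move=> [[t a] x] /= nq; apply: nq => -[[tT Aa] _].
  exact: curve_velocity_bounds.
Qed.

End curve.
End lagrangian_curve.

(** * Existence for the given data, with speed bound built on |a| <= Rv + 1 *)

Theorem theorem4p5 (R : realType) (Rx Rv : R)
  (Rx_gt0 : (0 < Rx)%R) (Rv_gt0 : (0 < Rv)%R)
  (f0 : probability (R * R)%type R)
  (f0_supp : supp f0 `<=` `[(- Rx)%R, Rx] `*` `[(- Rv)%R, Rv])
  (f0_atomless : forall x : R, f0 ([set x] `*` setT) = 0)
  (mu : {sigma_finite_measure set R -> \bar R})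
  (h : R -> R) (h_meas : measurable_fun setT h)
  (h_ge0 : forall a, (0 <= h a)%R)
  (h_out : forall a, a \notin `[(- Rv)%R, (Rv + 1)%R] -> h a = 0%R)
  (h_density : forall B : set R, measurable B ->
    pushforward (eta0 f0) snd B = \int[mu]_(a in B) (h a)%:E)
  (nu0 : R -> {measure set R -> \bar R})
  (nu0_disintegration : disintegration mu (eta0 f0) nu0)
  (T : R) (T_gt0 : (0 < T)%R) :
  (exists nu v,
    gradient_flow mu `[(- Rv)%R, (Rv + 1)%R] h T nu0 nu v) /\
  (exists nu,
    measure_solution mu `[(- Rv)%R, (Rv + 1)%R] h T nu0 nu).
Proof.
have mA : measurable (`[(- Rv)%R, (Rv + 1)%R]%classic : set R) by exact: measurable_itv.
have M0 : (0 <= Rv + 1)%R by rewrite addr_ge0// ltW.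
have AM (a : R) : `[(- Rv)%R, (Rv + 1)%R]%classic a -> (`|a| <= Rv + 1)%R.
  rewrite /= in_itv/= ler_norml => /andP[a1 ->]; rewrite andbT.
  by rewrite (le_trans _ a1)// lerN2 lerDl.
have mnu0 B : measurable B ->
    almost_measurable mu `[(- Rv)%R, (Rv + 1)%R] (fun a => nu0 a B).
  exact: (nu0_measurable _ nu0_disintegration).
have nu0T := nu0_mass h_meas h_ge0 h_density nu0_disintegration.
have fnu0 : {ae mu, forall a, `[(- Rv)%R, (Rv + 1)%R]%classic a -> nu0 a setT < +oo}.
  by apply: filterS nu0T => a -> _; rewrite ltry.
have nu01 : \int[mu]_(a in `[(- Rv)%R, (Rv + 1)%R]) nu0 a setT = 1.
  rewrite -(int_hA h_out h_density); apply: ae_eq_integral_any.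
  exact: filterS nu0T.
have reg : {ae mu, forall a, `[(- Rv)%R, (Rv + 1)%R]%classic a -> regular h nu0 Rx a}.
  apply: filterS2 nu0T (nu0_supp f0_supp nu0_disintegration) => a h1 h2 _; split => //.
split.
  (* Exceptional parameters keep their initial measure, so the initial condition is exact. *)
  exists (curve h mA M0 Rx_gt0 mnu0 fnu0 nu01 nu0), (velocity (Rv + 1) Rx T mA mnu0 fnu0 nu01).
  exact: curve_gradient_flow.
(* The same curve up to exceptional parameters, which now receive [h a] times the Dirac mass at
   0. *)
exists (curve h mA M0 Rx_gt0 mnu0 fnu0 nu01
  (fun a => [the measure _ _ of mscale (NngNum (h_ge0 a)) \d_(0%R : R)])).
by apply: curve_measure_solution.
Qed.
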